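(* Let $H$ be a Hilbert space and let $E$ be a Hilbert $\mathcal{K}(H)$-module. Two operators in $FredR(E)$ have the same index if and only if they are homotopic, i.e. if and only if they can be connected by a continuous path in $FredR(E)$, where $FredR(E)$ carries the gap topology.
   Context: $\mathcal{K}(H)$ is the C*-algebra of compact operators on $H$. Hilbert $\mathcal{K}(H)$-modules are left modules with $\mathcal{K}(H)$-valued inner product that is linear in the first variable. $B(E)$ is the C*-algebra of bounded adjointable operators on $E$, and $K(E)\subseteq B(E)$ is the ideal of (module-)compact operators, the closed linear span of the maps $z\mapsto\langle z,x\rangle y$, $x,y\in E$. A regular operator on $E$ is a closed $\mathcal{K}(H)$-linear operator $t$ with dense domain $Dom(t)\subseteq E$, densely defined adjoint $t^*$, and $1+t^*t$ of dense range. A regular operator $t$ is Fredholm if it has a pseudo left inverse and a pseudo right inverse: there is $G\in B(E)$ such that $Gt$ is closable with closure $\overline{Gt}\in B(E)$ and $\overline{Gt}-1\in K(E)$, and there is $G'\in B(E)$ such that $tG'$ is closable with $\overline{tG'}\in B(E)$ and $\overline{tG'}-1\in K(E)$. $FredR(E)$ is the set of regular Fredholm operators on $E$ with the gap topology, i.e. the topology of the metric $d(t,s)=\|P_{G(t)}-P_{G(s)}\|$, where $P_{G(t)}$ is the orthogonal projection of $E\oplus E$ onto the graph $G(t)=\{(x,tx):x\in Dom(t)\}$. An orthonormal basis of a Hilbert $\mathcal{K}(H)$-module $M$ is a family $(x_\lambda)$ that generates a dense submodule of $M$, with $\langle x_\lambda,x_\mu\rangle=0$ for $\lambda\ne\mu$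 and each $\langle x_\lambda,x_\lambda\rangle$ a minimal projection of $\mathcal{K}(H)$; all orthonormal bases have the same cardinality, denoted $\dim_{\mathcal{K}}M$ (equal to the Hilbert space dimension of $eM$ for any minimal projection $e\in\mathcal{K}(H)$). For $t\in FredR(E)$ both $\dim_{\mathcal{K}}Ker(t)$ and $\dim_{\mathcal{K}}Ker(t^* )$ are finite, and the index is $\mathrm{ind}\,t=\dim_{\mathcal{K}}Ker(t)-\dim_{\mathcal{K}}Ker(t^* )$. *)

(* Defs.v *)
From HB Require Import structures.
From mathcomp Require Import all_boot all_order all_algebra.
From mathcomp Require Import complex.
From mathcomp Require Import all_classical all_reals all_analysis.

Set Implicit Arguments.
Unset Strict Implicit.
Unset Printing Implicit Defensive.

Import Order.TTheory GRing.Theory Num.Theory numFieldNormedType.Exports.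

Local Open Scope classical_set_scope.
Local Open Scope ring_scope.
Local Open Scope complex_scope.

(* Complex Hilbert spaces: the library's complete normed spaces over R[i],
   with an inner product (linear in the first variable) inducing the norm.
   Norms of such spaces are R[i]-valued. *)

HB.mixin Record CompleteNormedModule_isHilbert (R : realType) H
    of CompleteNormedModule R[i] H := {
  hdot : H -> H -> R[i] ;
  hdotDl : forall x y z, hdot (x + y) z = hdot x z + hdot y z ;
  hdotZl : forall (c : R[i]) x y, hdot (c *: x) y = c * hdot x y ;
  hdotC : forall x y, hdot y x = (hdot x y)^* ;
  hdot_norm : forall x, `|x| ^+ 2 = hdot x x
}.

#[short(type="hilbertType")]
HB.structure Definition Hilbert (R : realType) :=
  {H of CompleteNormedModule_isHilbert R H & CompleteNormedModule R[i] H}.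

Definition rnorm (R : realType) (V : normedModType R[i]) (x : V) : R :=
  complex.Re `|x|.

(* Operator norm with respect to N. [sup] is 0 on unbounded sets, so this is
   meaningful for bounded T only. *)
Definition opnorm (R : realType) (V : Type) (N : V -> R) (T : V -> V) : R :=
  sup [set N (T x) | x in [set x | N x <= 1]].

Section CompactOperators.
Context (R : realType) (H : hilbertType R).

Definition compact_op : {pred (H -> H)} :=
  mem [set T : H -> H |
        linear T /\ precompact (T @` [set h | `|h| <= 1])].

Lemma compact_opP (T : H -> H) :
  T \in compact_op <->
  linear T /\ precompact (T @` [set h | `|h| <= 1]).
Proof. by split=> [/set_mem//|?]; apply/mem_set. Qed.

Let precompact_img (A B : set H) (f : H -> H) : continuous f ->
  precompact A -> B `<=` f @` A -> precompact B.
Proof.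
move=> cf; rewrite precompactE => cA BA.
apply: (@precompact_subset _ _ (f @` closure A)).
  by move=> x /BA[a Aa <-]; exists a => //; exact: subset_closure.
apply: compact_precompact; first exact: norm_hausdorff.
by apply: continuous_compact => //; exact/continuous_subspaceT.
Qed.

Let compact_bnd (A : set H) :
  compact A -> exists2 M : R[i], 0 < M & forall x, A x -> `|x| <= M.
Proof.
rewrite compact_cover => Aco.
have covA : A `<=` \bigcup_(n : nat) [set p | `|p| < n%:R].
  move=> p _; exists (Num.truncn (rnorm p)).+1 => //=.
  by rewrite -(RRe_real (normr_real p)) -[ltRHS](rmorph_nat (real_complex R))
    ltcR truncnS_gt.
have [|D _ DcovA] := Aco _ _ _ _ covA.
  move=> n _; rewrite openE => p; rewrite /= -subr_gt0 => ltpn.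
  apply/nbhs_ballP; exists (n%:R - `|p|) => // q.
  rewrite -ball_normE /= ltrBrDr distrC; apply: le_lt_trans.
  by rewrite -{1}(subrK p q) ler_normD.
exists (\sum_(n <- finmap.enum_fset D) n).+1%:R => // x /DcovA[n Dn /ltW/le_trans]; apply.
rewrite ler_nat (@leq_trans (\sum_(n <- finmap.enum_fset D) n))//.
by rewrite (big_rem n)//= leq_addr.
Qed.

Lemma compact_op_submod_closed : submod_closed compact_op.
Proof.
split.
  apply/compact_opP; split=> [c x y|]; first by rewrite /= scaler0 addr0.
  apply: (@precompact_subset _ _ [set 0]); first by move=> _ [h _ <-].
  by apply: compact_precompact; [exact: norm_hausdorff|exact: compact_set1].
move=> c S T /compact_opP[lS pS] /compact_opP[lT pT].
apply/compact_opP; split=> [d x y|].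
  have E z : (c *: S + T) z = c *: S z + T z by [].
  by rewrite !E lS lT !scalerDr !scalerA (mulrC c d) addrACA.
set A := S @` _ in pS; set B := T @` _ in pT.
rewrite precompactE in pS; rewrite precompactE in pT.
pose f (p : H * H) := c *: p.1 + p.2.
apply: (@precompact_subset _ _ (f @` (closure A `*` closure B))).
  move=> _ [h Hh <-]; exists (S h, T h) => //; split.
    by apply: subset_closure; exists h.
  by apply: subset_closure; exists h.
apply: compact_precompact; first exact: norm_hausdorff.
apply: continuous_compact; last exact: compact_setX.
apply: continuous_subspaceT => p; apply: cvgD; last exact: cvg_snd.
by apply: cvgZr; exact: cvg_fst.
Qed.

HB.instance Definition _ :=
  GRing.isSubmodClosed.Build R[i] (H -> H) compact_op compact_op_submod_closed.

Record kop := Kop { kfun :> H -> H ; kfunP : kfun \in compact_op }.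
HB.instance Definition _ := [isSub for kfun].
HB.instance Definition _ := [Choice of kop by <:].
HB.instance Definition _ := [SubChoice_isSubLmodule of kop by <:].

Lemma compact_op_comp (S T : H -> H) :
  S \in compact_op -> T \in compact_op -> S \o T \in compact_op.
Proof.
move=> /compact_opP[lS pS] /compact_opP[lT pT].
apply/compact_opP; split=> [c x y|]; first by rewrite /= lT lS.
rewrite precompactE in pT; have [M M0 bT] := compact_bnd pT.
apply: (precompact_img (f := fun x => M *: x) _ pS) => [x|_ [h Hh <-]].
  exact: scaler_continuous.
exists (S (M^-1 *: T h)); last by rewrite (scalable_linear lS) scalerA divff ?gt_eqF// scale1r.
exists (M^-1 *: T h) => //=.
rewrite normrZ normfV gtr0_norm// mulrC ler_pdivrMr// mul1r.
by apply: bT; apply: subset_closure; exists h.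
Qed.

Definition kmul (a b : kop) : kop := Kop (compact_op_comp (kfunP a) (kfunP b)).

End CompactOperators.

(* Hilbert K(H)-modules; the module is complete for the norm
   |x| = |<x,x>|^(1/2), which is the norm of E as a normed space. *)

HB.mixin Record CompleteNormedModule_isHilbertKModule
    (R : realType) (H : hilbertType R) E of CompleteNormedModule R[i] E := {
  kact : kop H -> E -> E ;
  kip : E -> E -> kop H ;
  kactDr : forall a x y, kact a (x + y) = kact a x + kact a y ;
  kactDl : forall a b x, kact (a + b) x = kact a x + kact b x ;
  kactM : forall a b x, kact (kmul a b) x = kact a (kact b x) ;
  kactZl : forall (c : R[i]) a x, kact (c *: a) x = c *: kact a x ;
  kactZr : forall (c : R[i]) a x, kact a (c *: x) = c *: kact a x ;
  kipDl : forall x y z, kip (x + y) z = kip x z + kip y z ;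
  kipZl : forall (c : R[i]) x y, kip (c *: x) y = c *: kip x y ;
  kipM : forall a x y, kip (kact a x) y = kmul a (kip x y) ;
  (* <y,x> is the Hilbert space adjoint of <x,y> *)
  kip_adj : forall x y h k, hdot (kip x y h) k = hdot h (kip y x k) ;
  kip_ge0 : forall x h, 0 <= hdot (kip x x h) h ;
  kip_norm : forall x, `|x| ^+ 2 = (opnorm (@rnorm R H) (kip x x))%:C
}.

#[short(type="hilbertKModType")]
HB.structure Definition HilbertKModule (R : realType) (H : hilbertType R) :=
  {E of CompleteNormedModule_isHilbertKModule R H E & CompleteNormedModule R[i] E}.

Section HilbertKModules.
Context (R : realType) (H : hilbertType R) (E : hilbertKModType H).

Local Notation kip := (@kip R H E).
Local Notation kact := (@kact R H E).

(* Bounded adjointable operators, B(E). *)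
Definition adjointable : set (E -> E) :=
  [set T | [/\ linear T,
               exists M : R[i], forall x, `|T x| <= M * `|x|
             & exists S : E -> E, forall x y, kip (T x) y = kip x (S y)]].

Definition rank_one (x y : E) : E -> E := fun z => kact (kip z x) y.

(* Module-compact operators, K(E). *)
Definition module_compact : set (E -> E) :=
  [set T | adjointable T /\ forall e : R, 0 < e ->
     exists n (c : 'I_n -> R[i]) (x y : 'I_n -> E),
       opnorm (@rnorm R E)
         (fun z => T z - \sum_(i < n) c i *: rank_one (x i) (y i) z) < e].

(* A partially defined operator on E is identified with its graph, a subset of
   E (+) E; a densely defined t has a single-valued adjoint. *)

Definition dom (t : set (E * E)) : set E := [set x | exists y, t (x, y)].

Definition ker (t : set (E * E)) : set E := [set x | t (x, 0)].

Definition graph (T : E -> E) : set (E * E) := [set p | p.2 = T p.1].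

Definition adjoint (t : set (E * E)) : set (E * E) :=
  [set p | forall x y, t (x, y) -> kip y p.1 = kip x p.2].

(* The composite "s after t". *)
Definition graph_comp (s t : set (E * E)) : set (E * E) :=
  [set p | exists2 y, t (p.1, y) & s (y, p.2)].

Definition klinear (t : set (E * E)) : Prop :=
  [/\ t 0,
      forall p q, t p -> t q -> t (p + q),
      forall (c : R[i]) p, t p -> t (c *: p),
      forall a x y, t (x, y) -> t (kact a x, kact a y)
    & forall x y z, t (x, y) -> t (x, z) -> y = z].

Record regular (t : set (E * E)) : Prop := {
  regular_klinear : klinear t ;
  regular_closed : closed t ;
  regular_dense : dense (dom t) ;
  regular_dense_adj : dense (dom (adjoint t)) ;
  regular_range : dense [set p.1 + p.2 | p in graph_comp (adjoint t) t]
}.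

(* That the closure of the graph of Gt is the graph of some S in B(E) says
   both that Gt is closable and that its closure S is in B(E). *)
Definition fredholm (t : set (E * E)) : Prop :=
  (exists2 G, adjointable G &
     exists S, [/\ adjointable S, closure (graph_comp (graph G) t) = graph S
                 & module_compact (fun x => S x - x)]) /\
  (exists2 G', adjointable G' &
     exists S, [/\ adjointable S, closure (graph_comp t (graph G')) = graph S
                 & module_compact (fun x => S x - x)]).

Definition fredR : set (set (E * E)) := [set t | regular t /\ fredholm t].

(* The Hilbert module E (+) E: its inner product and norm. (The library norm
   on E * E is the equivalent maximum norm.) *)

Definition kip2 (p q : E * E) : kop H := kip p.1 q.1 + kip p.2 q.2.

Definition norm2 (p : E * E) : R :=
  Num.sqrt (opnorm (@rnorm R H) (kip2 p p)).

(* Orthogonal projection onto an orthogonally complemented submodule, such as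
   the graph of a regular operator. *)
Definition orth_proj (t : set (E * E)) (p : E * E) : E * E :=
  xget 0 [set q | t q /\ forall r, t r -> kip2 (p - q) r = 0].

Definition gap (t s : set (E * E)) : R :=
  opnorm norm2 (fun p => orth_proj t p - orth_proj s p).

Definition gap_homotopic (t s : set (E * E)) : Prop :=
  exists g : R -> set (E * E),
    [/\ g 0 = t, g 1 = s,
        forall u : R, `[0, 1]%classic u -> fredR (g u)
      & forall u : R, `[0, 1]%classic u ->
          gap (g v) (g u) @[v --> within `[0, 1]%classic (nbhs u)] --> (0 : R)].

Definition submodule (M : set E) : Prop :=
  [/\ M 0,
      forall x y, M x -> M y -> M (x + y),
      forall (c : R[i]) x, M x -> M (c *: x)
    & forall a x, M x -> M (kact a x)].

Definition projection (p : kop H) : Prop :=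
  kmul p p = p /\ forall h k, hdot (p h) k = hdot h (p k).

(* [kmul p q = q] is the order q <= p between projections. *)
Definition minimal_projection (p : kop H) : Prop :=
  [/\ projection p, p <> 0
    & forall q, projection q -> kmul p q = q -> q = 0 \/ q = p].

(* Members of an orthonormal family are nonzero and pairwise orthogonal, hence
   pairwise distinct: such a family is the set of its values. *)
Definition orthonormal_basis (M B : set E) : Prop :=
  [/\ B `<=` M,
      M `<=` closure (smallest submodule B),
      forall x y, B x -> B y -> x <> y -> kip x y = 0
    & forall x, B x -> minimal_projection (kip x x)].

(* The dimension of M when it is finite, and 0 otherwise. *)
Definition dimK (M : set E) : nat :=
  xget 0%N [set n | exists2 B, orthonormal_basis M B & (B #= `I_n)%card].

Definition ind (t : set (E * E)) : int :=
  (dimK (ker t))%:Z - (dimK (ker (adjoint t)))%:Z.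

End HilbertKModules.

(* Main.v *)
(* Fix a unit vector u of H and the minimal projection e = <., u> u. The corner
   X = eE is a Hilbert space, and E is recovered from X: an element x of E is
   determined by the vectors <., h> u acting on x, and closed K(H)-linear
   relations on E correspond to closed relations on X. Under this correspondence
   regular Fredholm operators become closed densely defined Fredholm operators on
   X, with the same kernel and cokernel dimensions and the same gap metric, so it
   suffices to work on X.

   The index is locally constant because it is the index of the pair formed by the
   graph V and the horizontal subspace U of X + X, namely the dimension of the
   intersection of V and U minus that of their orthogonal complements.

   Conversely, let l be the Moore-Penrose inverse of a Fredholm operator, with
   polar decomposition l = v |l|. The Moore-Penrose inverses of (1 - a) l + a v
   join the operator to the partial isometry v^*. Adding finite rank partial
   isometries turns a Fredholm partial isometry into a coisometry or an isometry.
   Two coisometries with kernels of equal dimension differ by a unitary w, and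
   w is joined to 1 by three segments of invertible operators: with c the real
   part of w, the kernel of |c| - c splits the space into a part where c >= 0 and
   one where c <= 0. *)

From HB Require Import structures.
Require Import Defs.
From mathcomp Require Import all_boot all_order all_algebra.
From mathcomp Require Import complex ring lra zify.
From mathcomp Require Import all_classical all_reals all_analysis.

Set Implicit Arguments.
Unset Strict Implicit.
Unset Printing Implicit Defensive.

Import Order.TTheory GRing.Theory Num.Theory numFieldNormedType.Exports.

Local Open Scope classical_set_scope.
Local Open Scope ring_scope.
Local Open Scope complex_scope.

(** * Hilbert spaces *)

(** The operators to be compared have different domains, so everything is phrased for their graphs,
    closed subspaces of X + X. The index of a pair is symmetric under orthogonal complements: one
    inequality, applied to the pair and to its complements, gives the equality. The Moore-Penrose
    inverse turns an unbounded Fredholm operator into a bounded datum: its kernel and that of its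
    adjoint are the cokernel and the kernel of the operator. Along the segment to the polar part
    both stay fixed, so the graphs move in one coordinate only, at Lipschitz speed. Functional
    calculus is reduced to square roots of positive operators, built by an iteration with an
    explicit rate; sequential limits of vectors are stated with rate K / (n + 1). On the module side
    the decisive input is compactness of <x,x>: it lets x be approximated using finitely many of its
    coordinates in the corner, so that bounded maps and closed relations can be carried back and
    forth. The space H = 0 has no unit vector and is treated apart. *)

HB.mixin Record Lmodule_isHspace (R : realType) V of GRing.Lmodule R[i] V := {
  ip : V -> V -> R[i] ;
  ipDl : forall x y z, ip (x + y) z = ip x z + ip y z ;
  ipZl : forall (c : R[i]) x y, ip (c *: x) y = c * ip x y ;
  ipC : forall x y, ip y x = conjc (ip x y) ;
  ip_ge0 : forall x, 0 <= complex.Re (ip x x) ;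
  ip_eq0 : forall x, complex.Re (ip x x) = 0 -> x = 0 ;
  (* Completeness along sequences with an explicit rate. The limit inherits the same constant K, so
     estimates can be chained without choosing subsequences. *)
  ip_complete : forall (u : nat -> V) (K : R),
    (forall n m, (n <= m)%N ->
       Num.sqrt (complex.Re (ip (u m - u n) (u m - u n))) <= K / n.+1%:R) ->
    exists l, forall n,
       Num.sqrt (complex.Re (ip (u n - l) (u n - l))) <= K / n.+1%:R
}.

#[short(type="hspaceType")]
HB.structure Definition Hspace (R : realType) :=
  {V of Lmodule_isHspace R V & GRing.Lmodule R[i] V}.

(** A real inner product with the same norm. Most identities are proved for it; [rip_ip0], [orth_ip]
    and [ip_rip] recover the complex statements. *)
Definition rip (R : realType) (V : hspaceType R) (x y : V) : R :=
  complex.Re (ip x y).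

Definition nrm (R : realType) (V : hspaceType R) (x : V) : R :=
  Num.sqrt (rip x x).

Definition cabs (R : realType) (c : R[i]) : R := complex.Re `|c|.

Section ComplexFacts.
Context (R : realType).
Implicit Types (c d : R[i]) (a b : R).

Lemma ReD c d : complex.Re (c + d) = complex.Re c + complex.Re d.
Proof. by case: c; case: d. Qed.

Lemma ReN c : complex.Re (- c) = - complex.Re c.
Proof. by case: c. Qed.

Lemma Reconj c : complex.Re (conjc c) = complex.Re c.
Proof. by case: c. Qed.

Lemma ReZ a c : complex.Re (a%:C * c) = a * complex.Re c.
Proof. by case: c => u v /=; rewrite mul0r subr0. Qed.

Lemma ReI c : complex.Re ('i * c) = - complex.Im c.
Proof. by case: c => u v /=; rewrite mul0r mul1r sub0r. Qed.

Lemma cabsE c : `|c| = (cabs c)%:C.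
Proof. by rewrite /cabs RRe_real ?normr_real. Qed.

Lemma cabs_ge0 c : 0 <= cabs c.
Proof. by rewrite -lecR -cabsE normr_ge0. Qed.

Lemma cabs_sqr c : cabs c ^+ 2 = complex.Re c ^+ 2 + complex.Im c ^+ 2.
Proof. by apply: complexI; rewrite add_Re2_Im2 cabsE rmorphXn. Qed.

Lemma conj_mul c : conjc c * c = (cabs c ^+ 2)%:C.
Proof.
rewrite cabs_sqr; case: c => u v; apply/eqP; rewrite eq_complex /=.
by apply/andP; split; apply/eqP; ring.
Qed.

Lemma conjM c d : conjc (c * d) = conjc c * conjc d.
Proof. exact: rmorphM. Qed.

Lemma cabsR a : cabs a%:C = `|a|.
Proof. by rewrite /cabs normc_def /= expr0n addr0 sqrtr_sqr. Qed.

Lemma cabsM c d : cabs (c * d) = cabs c * cabs d.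
Proof. by apply: complexI; rewrite -cabsE normrM !cabsE rmorphM. Qed.

Lemma cabsN c : cabs (- c) = cabs c.
Proof. by rewrite /cabs normrN. Qed.

Lemma cabsi : cabs ('i : R[i]) = 1.
Proof. by rewrite /cabs normc_def /= expr0n expr1n add0r sqrtr1. Qed.

Lemma Re_le_cabs c : `|complex.Re c| <= cabs c.
Proof.
rewrite -(ler_pXn2r (n := 2)) ?nnegrE ?cabs_ge0//.
by rewrite cabs_sqr real_normK ?num_real// lerDl sqr_ge0.
Qed.

Lemma cabs_eq0 c : cabs c = 0 -> c = 0.
Proof. by move=> h; apply/eqP; rewrite -normr_eq0 cabsE h. Qed.

End ComplexFacts.

Section InnerProduct.
Context (R : realType) (V : hspaceType R).
Implicit Types (x y z : V) (c : R[i]) (a : R).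

Lemma ip0l y : ip 0 y = 0.
Proof. by rewrite -(scale0r (0 : V)) ipZl mul0r. Qed.

Lemma ipDr x y z : ip x (y + z) = ip x y + ip x z.
Proof. by rewrite ipC ipDl rmorphD/= -!ipC. Qed.

Lemma ipZr c x y : ip x (c *: y) = conjc c * ip x y.
Proof. by rewrite ipC ipZl rmorphM/= -ipC. Qed.

Lemma ip0r y : ip y 0 = 0.
Proof. by rewrite ipC ip0l conjc0. Qed.

Lemma ipNl x y : ip (- x) y = - ip x y.
Proof. by rewrite -scaleN1r ipZl mulN1r. Qed.

Lemma ipNr x y : ip x (- y) = - ip x y.
Proof. by rewrite ipC ipNl rmorphN/= -ipC. Qed.

Lemma ipBl x y z : ip (x - y) z = ip x z - ip y z.
Proof. by rewrite ipDl ipNl. Qed.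

Lemma ipBr x y z : ip x (y - z) = ip x y - ip x z.
Proof. by rewrite ipDr ipNr. Qed.

Lemma ip_suml I (s : seq I) (P : pred I) (F : I -> V) y :
  ip (\sum_(i <- s | P i) F i) y = \sum_(i <- s | P i) ip (F i) y.
Proof.
apply: (big_morph (fun x => ip x y)) => [u v|]; [exact: ipDl|exact: ip0l].
Qed.

Lemma ip_sumr I (s : seq I) (P : pred I) (F : I -> V) y :
  ip y (\sum_(i <- s | P i) F i) = \sum_(i <- s | P i) ip y (F i).
Proof.
apply: (big_morph (fun x => ip y x)) => [u v|]; [exact: ipDr|exact: ip0r].
Qed.

Lemma ripC x y : rip x y = rip y x.
Proof. by rewrite /rip ipC Reconj. Qed.

Lemma ripDl x y z : rip (x + y) z = rip x z + rip y z.
Proof. by rewrite /rip ipDl ReD. Qed.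

Lemma ripDr x y z : rip x (y + z) = rip x y + rip x z.
Proof. by rewrite /rip ipDr ReD. Qed.

Lemma ripNl x y : rip (- x) y = - rip x y.
Proof. by rewrite /rip ipNl ReN. Qed.

Lemma ripNr x y : rip x (- y) = - rip x y.
Proof. by rewrite /rip ipNr ReN. Qed.

Lemma rip0l y : rip 0 y = 0.
Proof. by rewrite /rip ip0l. Qed.

Lemma rip0r y : rip y 0 = 0.
Proof. by rewrite /rip ip0r. Qed.

Lemma ripZl a x y : rip (a%:C *: x) y = a * rip x y.
Proof. by rewrite /rip ipZl ReZ. Qed.

Lemma ripZr a x y : rip x (a%:C *: y) = a * rip x y.
Proof. by rewrite ripC ripZl ripC. Qed.

Definition ripE := (ripDl, ripDr, ripNl, ripNr, ripZl, ripZr, rip0l, rip0r).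

Lemma scaleRA (a b : R) x : a%:C *: (b%:C *: x) = (a * b)%:C *: x.
Proof. by rewrite scalerA -rmorphM. Qed.

Lemma scaleR1 x : (1 : R)%:C *: x = x.
Proof. by rewrite rmorph1 scale1r. Qed.

Lemma ripi x y : rip x ('i *: y) = complex.Im (ip x y).
Proof.
rewrite /rip ipZr; case: (ip x y) => u v /=.
by rewrite mul0r sub0r mulN1r opprK.
Qed.

Lemma rip_ip0 x y : rip x y = 0 -> rip x ('i *: y) = 0 -> ip x y = 0.
Proof.
rewrite ripi /rip => h1 h2; apply/eqP; rewrite eq_complex.
by rewrite /= h1 h2 !eqxx.
Qed.

Lemma ipxx x : ip x x = (rip x x)%:C.
Proof.
have := ipC x x; rewrite /rip; case: (ip x x) => u v /= [].
by move=> h; apply/eqP; rewrite eq_complex /= eqxx /=; apply/eqP; lra.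
Qed.

Lemma rip_ge0 x : 0 <= rip x x. Proof. exact: ip_ge0. Qed.

Lemma rip_eq0 x : rip x x = 0 -> x = 0. Proof. exact: ip_eq0. Qed.

Lemma nrm_ge0 x : 0 <= nrm x. Proof. exact: sqrtr_ge0. Qed.

Lemma nrm_sqr x : nrm x ^+ 2 = rip x x.
Proof. by rewrite sqr_sqrtr// rip_ge0. Qed.

Lemma nrm_le x a : 0 <= a -> (nrm x <= a) = (rip x x <= a ^+ 2).
Proof.
by move=> a0; rewrite -nrm_sqr ler_pXn2r// nnegrE ?nrm_ge0.
Qed.

Lemma nrm_eq0 x : nrm x = 0 -> x = 0.
Proof. by move=> h; apply: rip_eq0; rewrite -nrm_sqr h expr0n. Qed.

Lemma nrm0 : nrm (0 : V) = 0.
Proof. by rewrite /nrm rip0l sqrtr0. Qed.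

Lemma nrm_gt0 x : x != 0 -> 0 < nrm x.
Proof.
move=> x0; rewrite lt0r nrm_ge0 andbT; apply/eqP => /nrm_eq0 h.
by rewrite h eqxx in x0.
Qed.

Lemma rip_le x y : rip x y <= nrm x * nrm y.
Proof.
have [->|x0] := eqVneq x 0; first by rewrite rip0l nrm0 mul0r.
have [->|y0] := eqVneq y 0; first by rewrite rip0r nrm0 mulr0.
have := rip_ge0 ((nrm y)%:C *: x - (nrm x)%:C *: y).
rewrite !ripE (ripC y x) -!nrm_sqr.
have := nrm_gt0 x0; have := nrm_gt0 y0.
move: (nrm x) (nrm y) (rip x y) => a b c b0 a0 h.
have : 0 <= (a * b) * ((a * b) - c) by nra.
by rewrite pmulr_rge0 ?mulr_gt0// subr_ge0.
Qed.

Lemma rip_abs x y : `|rip x y| <= nrm x * nrm y.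
Proof.
rewrite ler_norml rip_le andbT lerNl -ripNl (le_trans (rip_le _ _))//.
by rewrite /nrm ripNl ripNr opprK.
Qed.

Lemma nrmN x : nrm (- x) = nrm x.
Proof. by rewrite /nrm !ripE opprK. Qed.

Lemma nrmB x y : nrm (x - y) = nrm (y - x).
Proof. by rewrite -nrmN opprB. Qed.

Lemma nrmD x y : nrm (x + y) <= nrm x + nrm y.
Proof.
rewrite nrm_le ?addr_ge0 ?nrm_ge0//.
by rewrite !ripE (ripC y x) -!nrm_sqr; have := rip_le x y; nra.
Qed.

Lemma nrmDB x y : nrm (x - y) <= nrm x + nrm y.
Proof. by rewrite -(nrmN y) nrmD. Qed.

Lemma nrmT z x y : nrm (x - y) <= nrm (x - z) + nrm (z - y).
Proof. by have := nrmD (x - z) (z - y); rewrite addrA subrK. Qed.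

Lemma nrmZ c x : nrm (c *: x) = cabs c * nrm x.
Proof.
rewrite /nrm /rip ipZl ipZr mulrA (mulrC c) conj_mul ReZ.
by rewrite sqrtrM ?sqr_ge0// sqrtr_sqr ger0_norm ?cabs_ge0.
Qed.

(** The real Cauchy-Schwarz inequality, applied after multiplying x by the conjugate of <x,y>, which
    makes the inner product real and nonnegative. *)
Lemma cabs_ip x y : cabs (ip x y) <= nrm x * nrm y.
Proof.
have [->|h] := eqVneq (ip x y) 0.
  by rewrite /cabs normr0 mulr_ge0 ?nrm_ge0.
have c0 : 0 < cabs (ip x y).
  rewrite lt0r cabs_ge0 andbT; apply/eqP => /cabs_eq0 h0.
  by rewrite h0 eqxx in h.
have := rip_le (conjc (ip x y) *: x) y.
rewrite /rip ipZl conj_mul nrmZ /=.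
have -> : cabs (conjc (ip x y)) = cabs (ip x y).
  by rewrite /cabs !normc_def; case: (ip x y) => u v /=; rewrite sqrrN.
by rewrite -mulrA expr2 ler_pM2l.
Qed.

Lemma pyth x y : rip x y = 0 -> nrm (x + y) ^+ 2 = nrm x ^+ 2 + nrm y ^+ 2.
Proof. by move=> h; rewrite !nrm_sqr !ripE (ripC y x) h; ring. Qed.

Lemma nrm_small x : (forall e, 0 < e -> nrm x <= e) -> x = 0.
Proof.
move=> h; apply: nrm_eq0; apply/eqP; rewrite eq_le nrm_ge0 andbT.
by apply/ler_addgt0Pl => e e0; rewrite addr0 h.
Qed.

Lemma rip_ext x y : (forall z, rip x z = rip y z) -> x = y.
Proof.
move=> h; apply/eqP; rewrite -subr_eq0; apply/eqP/rip_eq0.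
by rewrite {1}[x - y]lock ripDr ripNr -lock !ripDl !ripNl !h !subrr.
Qed.

Lemma hcomplete (u : nat -> V) (K : R) :
  (forall n m, (n <= m)%N -> nrm (u m - u n) <= K / n.+1%:R) ->
  exists l, forall n, nrm (u n - l) <= K / n.+1%:R.
Proof. exact: ip_complete. Qed.
End InnerProduct.

Arguments nrmT {R V} z x y.

Section RealAux.
Context (R : realType).

Lemma invS_small (K e : R) : 0 < e -> exists n : nat, K / n.+1%:R < e.
Proof.
move=> e0; exists (Num.truncn (`|K| / e)).
rewrite ltr_pdivrMr ?ltr0n//; apply: (le_lt_trans (ler_norm K)).
by rewrite mulrC -ltr_pdivrMr// truncnS_gt.
Qed.

Lemma ler_invS (K : R) (n m : nat) : 0 <= K -> (n <= m)%N ->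
  K / m.+1%:R <= K / n.+1%:R.
Proof.
by move=> K0 nm; rewrite ler_wpM2l// lef_pV2 ?posrE ?ltr0n// ler_nat.
Qed.

Lemma limS_le (K a b : R) : (forall n : nat, a <= b + K / n.+1%:R) -> a <= b.
Proof.
move=> h; apply/ler_addgt0Pl => e e0; have [n hn] := invS_small K e0.
by apply: le_trans (h n) _; rewrite addrC lerD2r ltW.
Qed.
End RealAux.

(** * Orthogonal direct sums *)

Section ProductSpace.
Context (R : realType) (V W : hspaceType R).

Let pip (p q : V * W) : R[i] := ip p.1 q.1 + ip p.2 q.2.

Let pipDl x y z : pip (x + y) z = pip x z + pip y z.
Proof. by rewrite /pip !ipDl addrACA. Qed.

Let pipZl (c : R[i]) x y : pip (c *: x) y = c * pip x y.
Proof. by rewrite /pip !ipZl mulrDr. Qed.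

Let pipC x y : pip y x = conjc (pip x y).
Proof. by rewrite /pip rmorphD/= -!ipC. Qed.

Let pip_ge0 x : 0 <= complex.Re (pip x x).
Proof. by rewrite ReD addr_ge0 ?ip_ge0. Qed.

Let pip_eq0 x : complex.Re (pip x x) = 0 -> x = 0.
Proof.
rewrite ReD; have := ip_ge0 x.1; have := ip_ge0 x.2 => h2 h1 h.
have /ip_eq0 e1 : complex.Re (ip x.1 x.1) = 0 by lra.
have /ip_eq0 e2 : complex.Re (ip x.2 x.2) = 0 by lra.
by rewrite [x]surjective_pairing e1 e2.
Qed.

Let pnrm (p : V * W) := Num.sqrt (complex.Re (pip p p)).

Let pnrm_le1 p : nrm p.1 <= pnrm p.
Proof. by rewrite ler_wsqrtr// ReD lerDl ip_ge0. Qed.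

Let pnrm_le2 p : nrm p.2 <= pnrm p.
Proof. by rewrite ler_wsqrtr// ReD lerDr ip_ge0. Qed.

Let pnrm_le p (a b : R) : nrm p.1 <= a -> nrm p.2 <= b -> pnrm p <= a + b.
Proof.
move=> h1 h2; have a0 := le_trans (nrm_ge0 _) h1.
have b0 := le_trans (nrm_ge0 _) h2.
rewrite -[leRHS]ger0_norm ?addr_ge0// -sqrtr_sqr ler_wsqrtr// ReD.
have := nrm_sqr p.1; have := nrm_sqr p.2; rewrite /rip => <- <-.
by have := nrm_ge0 p.1; have := nrm_ge0 p.2; nra.
Qed.

(** [nrmD] applies to the sum only once its completeness is known, and that proof uses this
    inequality. It reduces to Cauchy-Schwarz for the plane vectors formed by the norms of the
    components. *)
Let pnrmD p q : pnrm (p + q) <= pnrm p + pnrm q.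
Proof.
have ge0 r : 0 <= pnrm r by exact: sqrtr_ge0.
have sq r : pnrm r ^+ 2 = nrm r.1 ^+ 2 + nrm r.2 ^+ 2.
  by rewrite sqr_sqrtr ?pip_ge0// ReD -/(rip _ _) -/(rip _ _) !nrm_sqr.
rewrite -(ler_pXn2r (n := 2)) ?nnegrE ?addr_ge0// sq.
have h1 := nrmD p.1 q.1; have h2 := nrmD p.2 q.2.
have cs : nrm p.1 * nrm q.1 + nrm p.2 * nrm q.2 <= pnrm p * pnrm q.
  rewrite -(ler_pXn2r (n := 2)) ?nnegrE ?addr_ge0 ?mulr_ge0 ?nrm_ge0//.
  rewrite exprMn !sq -subr_ge0.
  rewrite [X in 0 <= X](_ : _ = (nrm p.1 * nrm q.2 - nrm p.2 * nrm q.1) ^+ 2).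
    exact: sqr_ge0.
  by ring.
have := sq p; have := sq q; rewrite sqrrD => -> ->.
have := nrm_ge0 (p.1 + q.1); have := nrm_ge0 (p.2 + q.2).
have := nrm_ge0 p.1; have := nrm_ge0 p.2; have := nrm_ge0 q.1.
have := nrm_ge0 q.2; move: h1 h2 cs => /=.
move: (nrm p.1) (nrm p.2) (nrm q.1) (nrm q.2) (pnrm p) (pnrm q).
move: (nrm (p.1 + q.1)) (nrm (p.2 + q.2)) => s t a b c d e f h1 h2 cs *.
have : s ^+ 2 <= (a + c) ^+ 2 by rewrite ler_pXn2r// nnegrE ?addr_ge0.
have : t ^+ 2 <= (b + d) ^+ 2 by rewrite ler_pXn2r// nnegrE ?addr_ge0.
by rewrite !sqrrD; lra.
Qed.

Let pip_complete (u : nat -> V * W) (K : R) :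
  (forall n m, (n <= m)%N -> pnrm (u m - u n) <= K / n.+1%:R) ->
  exists l, forall n, pnrm (u n - l) <= K / n.+1%:R.
Proof.
move=> h.
have [|l1 h1] := @hcomplete R V (fun n => (u n).1) K.
  by move=> n m nm; apply: le_trans (h _ _ nm); exact: (pnrm_le1 (u m - u n)).
have [|l2 h2] := @hcomplete R W (fun n => (u n).2) K.
  by move=> n m nm; apply: le_trans (h _ _ nm); exact: (pnrm_le2 (u m - u n)).
exists (l1, l2) => n.
have pN q : pnrm (- q) = pnrm q.
  by rewrite /pnrm /pip /= !ipNl !ipNr !opprK.
(* The componentwise limits alone give the constant K + K. Comparing with u m and letting m grow
   brings it back to K. *)
apply: (@limS_le _ (K + K)) => m.
have K0 : 0 <= K by have := le_trans (sqrtr_ge0 _) (h 0 0 (leqnn 0)); rewrite divr1.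
have [nm|/ltnW mn] := leqP n m.
  rewrite -(subrK (u m) (u n)) -addrA (le_trans (pnrmD _ _))//.
  rewrite lerD//; first by rewrite -pN opprB h.
  by rewrite mulrDl; apply: pnrm_le; [exact: h1|exact: h2].
rewrite -[leLHS]add0r lerD//; first by rewrite divr_ge0.
by rewrite mulrDl; apply: pnrm_le => /=; apply: le_trans (ler_invS K0 mn);
  [exact: h1|exact: h2].
Qed.

HB.instance Definition _ := Lmodule_isHspace.Build R (V * W)%type
  pipDl pipZl pipC pip_ge0 pip_eq0 pip_complete.

Lemma ip_pair (p q : V * W) : ip p q = ip p.1 q.1 + ip p.2 q.2.
Proof. by []. Qed.

Lemma rip_pair (p q : V * W) : rip p q = rip p.1 q.1 + rip p.2 q.2.
Proof. by rewrite /rip ReD. Qed.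

Lemma nrm_fst (p : V * W) : nrm p.1 <= nrm p. Proof. exact: pnrm_le1. Qed.

Lemma nrm_snd (p : V * W) : nrm p.2 <= nrm p. Proof. exact: pnrm_le2. Qed.

Lemma nrm_pair_le (p : V * W) : nrm p <= nrm p.1 + nrm p.2.
Proof. exact: pnrm_le. Qed.

Lemma nrm_pair0l (y : W) : nrm ((0, y) : V * W) = nrm y.
Proof. by rewrite /nrm rip_pair/= rip0l add0r. Qed.

Lemma nrm_pair0r (x : V) : nrm ((x, 0) : V * W) = nrm x.
Proof. by rewrite /nrm rip_pair/= rip0l addr0. Qed.
End ProductSpace.

Lemma subrACA (U : zmodType) (a b c d : U) : (a - b) - (c - d) = (a - c) - (b - d).
Proof. by rewrite !opprB addrACA [RHS]addrACA [- b - c]addrC. Qed.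

Section LinearAux.
Context (C : pzRingType) (V W : lmodType C) (T : V -> W) (lT : linear T).

Lemma lin0 : T 0 = 0.
Proof. by have := lT (-1) 0 0; rewrite scaler0 addr0 scaleN1r addNr. Qed.

Lemma linD x y : T (x + y) = T x + T y.
Proof. by have := lT 1 x y; rewrite !scale1r. Qed.

Lemma linZ c x : T (c *: x) = c *: T x.
Proof. by have := lT c x 0; rewrite !addr0 lin0 addr0. Qed.

Lemma linN x : T (- x) = - T x.
Proof. by rewrite -scaleN1r linZ scaleN1r. Qed.

Lemma linB x y : T (x - y) = T x - T y.
Proof. by rewrite linD linN. Qed.

Lemma lin_sum I (s : seq I) (P : pred I) (F : I -> V) :
  T (\sum_(i <- s | P i) F i) = \sum_(i <- s | P i) T (F i).
Proof. exact: (big_morph T linD lin0). Qed.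
End LinearAux.

(** * Closed subspaces and orthogonal projections *)

Section Subspaces.
Context (R : realType) (V : hspaceType R).
Implicit Types (M N : set V) (x y z : V).

Definition subsp M := [/\ M 0, forall x y, M x -> M y -> M (x + y)
  & forall (c : R[i]) x, M x -> M (c *: x)].

Definition hcl M : set V :=
  [set x | forall e : R, 0 < e -> exists2 y, M y & nrm (x - y) <= e].

Definition csub M := subsp M /\ hcl M `<=` M.

(** Orthogonality for the real inner product. Against a complex subspace it is the usual one, since
    the subspace contains 'i *: y along with y; see [orth_ip]. *)
Definition orth M : set V := [set x | forall y, M y -> rip x y = 0].

Definition prj M x : V := xget 0 [set m | M m /\ orth M (x - m)].

Lemma subspN M x : subsp M -> M x -> M (- x).
Proof. by move=> [_ _ h] Mx; rewrite -scaleN1r; exact: h. Qed.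

Lemma subspB M x y : subsp M -> M x -> M y -> M (x - y).
Proof. by move=> sM Mx My; case: (sM) => _ h _; apply: h => //; exact: subspN. Qed.

Lemma subsp_sum M I (s : seq I) (P : pred I) (F : I -> V) : subsp M ->
  (forall i, P i -> M (F i)) -> M (\sum_(i <- s | P i) F i).
Proof. by move=> [h0 hD _] h; apply: big_ind. Qed.

Lemma subset_hcl M : M `<=` hcl M.
Proof. by move=> x Mx e e0; exists x => //; rewrite subrr nrm0 ltW. Qed.

Lemma csub_hcl M : subsp M -> csub (hcl M).
Proof.
move=> sM; have [M0 MD MZ] := sM; split; first split.
- exact: subset_hcl.
- move=> x y hx hy e e0; have e2 : 0 < e / 2 by rewrite divr_gt0.
  have [x' Mx' lx] := hx _ e2; have [y' My' ly] := hy _ e2.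
  exists (x' + y'); first exact: MD.
  by rewrite opprD addrACA (le_trans (nrmD _ _))// (splitr e) lerD.
- move=> c x hx e e0; have c0 : 0 < cabs c + 1 by rewrite ltr_wpDl ?cabs_ge0.
  have [x' Mx' lx] := hx _ (divr_gt0 e0 c0); exists (c *: x'); first exact: MZ.
  rewrite -scalerBr nrmZ (@le_trans _ _ ((cabs c + 1) * nrm (x - x')))//.
    by rewrite ler_wpM2r ?nrm_ge0// lerDl.
  by rewrite mulrC -ler_pdivlMr.
- move=> x hx e e0; have e2 : 0 < e / 2 by rewrite divr_gt0.
  have [y hy lx] := hx _ e2; have [z Mz lz] := hy _ e2.
  by exists z => //; rewrite (le_trans (nrmT y _ _))// (splitr e) lerD.
Qed.

Lemma orth_ip M x y : subsp M -> orth M x -> M y -> ip x y = 0.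
Proof. by move=> [_ _ hZ] ox My; apply: rip_ip0; apply: ox => //; exact: hZ. Qed.

Lemma csub_orth M : subsp M -> csub (orth M).
Proof.
move=> sM; split; first split.
- by move=> y _; rewrite rip0l.
- by move=> x y hx hy z Mz; rewrite ripDl hx// hy// addr0.
- by move=> c x hx y My; rewrite /rip ipZl (orth_ip sM)// mulr0.
move=> x hx y My; apply/eqP; rewrite -normr_le0.
apply/ler_addgt0Pl => e e0; rewrite addr0.
have y0 : 0 < nrm y + 1 by rewrite ltr_wpDl ?nrm_ge0.
have [z oz lz] := hx _ (divr_gt0 e0 y0).
rewrite -(subr0 (rip x y)) -(oz _ My) -ripNl -ripDl.
rewrite (le_trans (rip_abs _ _))//.
rewrite (@le_trans _ _ (nrm (x - z) * (nrm y + 1)))//.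
  by rewrite ler_wpM2l ?nrm_ge0// lerDl.
by rewrite -ler_pdivlMr.
Qed.

(* Minimizing sequences are Cauchy by the parallelogram law. *)
Lemma prj_exists M x : csub M -> exists m, M m /\ orth M (x - m).
Proof.
move=> [[M0 MD MZ] Mcl].
pose S := [set rip (x - m) (x - m) | m in M].
have S0 : S !=set0 by exists (rip (x - 0) (x - 0)), 0.
have lS : has_lbound S by exists 0 => _ [m _ <-]; exact: rip_ge0.
pose d := inf S; have dle m : M m -> d <= rip (x - m) (x - m).
  by move=> Mm; apply: ge_inf => //; exists m.
have hu n : exists m, M m /\ rip (x - m) (x - m) <= d + (n.+1%:R ^-1) ^+ 2.
  have e0 : 0 < (n.+1%:R ^-1 : R) ^+ 2 by rewrite exprn_gt0// invr_gt0.
  have [_ [m Mm <-] h] := inf_adherent e0 (conj S0 lS).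
  by exists m; split => //; exact: ltW.
have [u hu'] := choice hu.
pose h2 : R[i] := (2^-1 : R)%:C.
have par m n : (m <= n)%N -> rip (u n - u m) (u n - u m) <= (2 / m.+1%:R) ^+ 2.
  move=> mn; have [Mn hn] := hu' n; have [Mm hm] := hu' m.
  have := dle (h2 *: (u n + u m)) (MZ _ _ (MD _ _ Mn Mm)).
  have : (n.+1%:R^-1 : R) ^+ 2 <= (m.+1%:R^-1) ^+ 2.
    by rewrite ler_pXn2r ?nnegrE ?invr_ge0// lef_pV2 ?posrE// ler_nat.
  move: hn hm; rewrite /h2 exprMn !ripE (ripC (u n) x) (ripC (u m) x) (ripC (u m) (u n)).
  by move: (n.+1%:R^-1 ^+ 2) (m.+1%:R^-1 ^+ 2) => en em; lra.
have [|l hl] := @hcomplete R V u 2.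
  move=> m n mn; rewrite nrm_le ?divr_ge0//; exact: par.
have Ml : M l.
  apply: Mcl => e e0; have [n hn] := invS_small 2 e0.
  by exists (u n); [case: (hu' n)|rewrite nrmB (le_trans (hl n))// ltW].
have dl : rip (x - l) (x - l) <= d.
  have sd : 0 <= d by apply: lb_le_inf => // _ [m _ <-]; exact: rip_ge0.
  have : nrm (x - l) <= Num.sqrt d.
    apply: (@limS_le _ 3) => n.
    rewrite (le_trans (nrmT (u n) _ _))//.
    have -> : (3 : R) = 1 + 2 by lra.
    rewrite mulrDl addrA lerD// ?hl// mul1r nrm_le ?addr_ge0 ?sqrtr_ge0 ?invr_ge0//.
    rewrite (le_trans (hu' n).2)// sqrrD sqr_sqrtr// lerD2r lerDl.
    by rewrite mulrn_wge0// mulr_ge0 ?sqrtr_ge0 ?invr_ge0.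
  by rewrite nrm_le ?sqrtr_ge0// sqr_sqrtr.
exists l; split=> // y My.
have key a : 0 <= - 2 * a * rip (x - l) y + a ^+ 2 * rip y y.
  have := dle (l + a%:C *: y) (MD _ _ Ml (MZ _ _ My)); move: dl.
  by rewrite !ripE (ripC l x) (ripC y x) (ripC y l); lra.
have [->|y0] := eqVneq y 0; first by rewrite rip0r.
have yy : 0 < rip y y by rewrite -nrm_sqr exprn_gt0// nrm_gt0.
(* This value minimises the quadratic polynomial in [key]; its minimum is minus a square, which must
   therefore vanish. *)
have := key (rip (x - l) y / rip y y).
rewrite [X in 0 <= X](_ : _ = - (rip (x - l) y ^+ 2 / rip y y)).
  by rewrite oppr_ge0 pmulr_lle0 ?invr_gt0// => h; apply/eqP; rewrite -sqrf_eq0 eq_le h sqr_ge0.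
by field; rewrite gt_eqF.
Qed.

Section Projection.
Variables (M : set V) (cM : csub M).
Let sM : subsp M := cM.1.

Lemma prjP x : M (prj M x) /\ orth M (x - prj M x).
Proof. exact: (xgetPex 0 (prj_exists x cM)). Qed.

Lemma prj_in x : M (prj M x). Proof. by case: (prjP x). Qed.

Lemma prj_orth x y : M y -> rip (x - prj M x) y = 0.
Proof. by case: (prjP x) => _; apply. Qed.

Lemma prj_uniq x m : M m -> orth M (x - m) -> prj M x = m.
Proof.
move=> Mm om; apply/eqP; rewrite -subr_eq0; apply/eqP/rip_eq0.
have Md : M (prj M x - m) by apply: subspB => //; exact: prj_in.
have h1 := om _ Md; have h2 := prj_orth x Md.
rewrite {1}(_ : prj M x - m = (x - m) - (x - prj M x)); last first.
  by rewrite opprB [RHS]addrC addrA subrK.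
by rewrite ripDl ripNl h1 h2 subrr.
Qed.

Lemma prj_id x : M x -> prj M x = x.
Proof. by move=> Mx; apply: prj_uniq => // y _; rewrite subrr rip0l. Qed.

Lemma prj_eq0 x : orth M x -> prj M x = 0.
Proof. by move=> ox; apply: prj_uniq; [case: sM|rewrite subr0]. Qed.

Lemma prj_orthP x : orth M (x - prj M x). Proof. by case: (prjP x). Qed.

Lemma prj_linear : linear (prj M).
Proof.
move=> c x y; have [_ MD MZ] := sM; apply: prj_uniq.
  by apply: MD; [apply: MZ|]; exact: prj_in.
have [_ oD oZ] := (csub_orth sM).1.
rewrite opprD addrACA -scalerBr; apply: oD; last exact: prj_orthP.
by apply: oZ; exact: prj_orthP.
Qed.

Lemma prj_sa x y : rip (prj M x) y = rip x (prj M y).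
Proof.
have h1 := prj_orth y (prj_in x); have h2 := prj_orth x (prj_in y).
move: h1 h2; rewrite !ripE => h1 h2; rewrite (ripC (prj M x) y).
by rewrite (ripC (prj M y)) in h1; lra.
Qed.

Lemma prj_pyth x : nrm x ^+ 2 = nrm (prj M x) ^+ 2 + nrm (x - prj M x) ^+ 2.
Proof.
rewrite -pyth; first by rewrite addrC subrK.
by rewrite ripC prj_orth//; exact: prj_in.
Qed.

Lemma prj_nrm x : nrm (prj M x) <= nrm x.
Proof.
rewrite -(ler_pXn2r (n := 2)) ?nnegrE ?nrm_ge0//.
by rewrite (prj_pyth x) lerDl sqr_ge0.
Qed.

Lemma prjC_nrm x : nrm (x - prj M x) <= nrm x.
Proof.
rewrite -(ler_pXn2r (n := 2)) ?nnegrE ?nrm_ge0//.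
by rewrite (prj_pyth x) lerDr sqr_ge0.
Qed.

End Projection.

Lemma prj_orthc M x : csub M -> prj (orth M) x = x - prj M x.
Proof.
move=> cM; apply: prj_uniq; [exact: (csub_orth cM.1)|exact: prj_orthP|].
by move=> y oy; rewrite opprB addrC subrK ripC oy//; exact: prj_in.
Qed.

Lemma orth_orth M : csub M -> orth (orth M) = M.
Proof.
move=> cM; apply/seteqP; split=> x hx; last by move=> y oy; rewrite ripC oy.
suff -> : x = prj M x by exact: prj_in.
apply/eqP; rewrite -subr_eq0; apply/eqP/rip_eq0.
have o1 := prj_orthP cM x.
by rewrite ripDl ripNl (hx _ o1) ripC (o1 _ (prj_in cM x)) subr0.
Qed.

Lemma orth_subset M N : M `<=` N -> orth N `<=` orth M.
Proof. by move=> MN x ox y /MN /ox. Qed.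

Lemma orth_hcl M : subsp M -> orth (orth M) = hcl M.
Proof.
move=> sM; have cM := csub_hcl sM; rewrite -[RHS](orth_orth cM).
congr (orth _); apply/seteqP; split; last exact/orth_subset/subset_hcl.
move=> x ox y hy; rewrite ripC.
have cO := csub_orth (csub_orth sM).1.
suff h : orth (orth M) y by rewrite h.
apply: cO.2 => e e0; have [z Mz hz] := hy _ e0; exists z => //.
by move=> w ow; rewrite ripC ow.
Qed.

Lemma dense_orth0 M : subsp M -> (forall x, orth M x -> x = 0) ->
  forall x, hcl M x.
Proof.
move=> sM h x; rewrite -orth_hcl// => y oy.
by rewrite (h _ oy) rip0r.
Qed.

Lemma orth0_dense M x : (forall x, hcl M x) -> orth M x -> x = 0.
Proof.
move=> dM ox; apply: nrm_eq0; apply/eqP; rewrite eq_le nrm_ge0 andbT.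
apply/ler_addgt0Pl => e e0; rewrite addr0.
have [y My hy] := dM x e e0; apply: le_trans hy.
rewrite -(ler_pXn2r (n := 2)) ?nnegrE ?nrm_ge0//.
by rewrite pyth ?lerDl ?sqr_ge0// ripNr ox ?oppr0.
Qed.

Lemma csubI M N : csub M -> csub N -> csub (M `&` N).
Proof.
move=> [[M0 MD MZ] Mc] [[N0 ND NZ] Nc]; split; first split=> //.
- by move=> x y [? ?] [? ?]; split; [apply: MD|apply: ND].
- by move=> c x [? ?]; split; [apply: MZ|apply: NZ].
move=> x hx; split; [apply: Mc|apply: Nc] => e e0;
  by have [y [My Ny] hy] := hx _ e0; exists y.
Qed.

End Subspaces.

(** * Bounded operators and adjoints *)

Section Operators.
Context (R : realType).
Implicit Types (U V W : hspaceType R).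

Definition bnd V W (T : V -> W) (K : R) := forall x, nrm (T x) <= K * nrm x.

Definition bdd V W (T : V -> W) := linear T /\ exists K, bnd T K.

Lemma bdd_pos V W (T : V -> W) : bdd T -> exists2 K, 0 < K & bnd T K.
Proof.
move=> [_ [K hK]]; exists (`|K| + 1); first by rewrite ltr_wpDl.
move=> x; rewrite (le_trans (hK x))// ler_wpM2r ?nrm_ge0//.
by rewrite (le_trans (ler_norm K))// lerDl.
Qed.

Lemma bdd_id V : bdd (@idfun V).
Proof. by split=> //; exists 1 => x; rewrite mul1r. Qed.

Lemma bdd_comp U V W (S : V -> W) (T : U -> V) :
  bdd S -> bdd T -> bdd (fun x => S (T x)).
Proof.
move=> bS bT; have [K K0 hK] := bdd_pos bS; have [L L0 hL] := bdd_pos bT.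
split=> [c x y|]; first by rewrite bT.1 bS.1.
by exists (K * L) => x; rewrite (le_trans (hK _))// -mulrA ler_pM2l.
Qed.

Lemma bdd_add V W (S T : V -> W) : bdd S -> bdd T -> bdd (fun x => S x + T x).
Proof.
move=> [lS [K hK]] [lT [L hL]]; split=> [c x y|].
  by rewrite lS lT scalerDr addrACA.
by exists (K + L) => x; rewrite mulrDl (le_trans (nrmD _ _))// lerD.
Qed.

Lemma bdd_scale V W (c : R[i]) (T : V -> W) : bdd T -> bdd (fun x => c *: T x).
Proof.
move=> bT; have [K K0 hK] := bdd_pos bT; split=> [d x y|].
  by rewrite bT.1 scalerDr !scalerA mulrC.
by exists (cabs c * K) => x; rewrite nrmZ -mulrA ler_wpM2l ?cabs_ge0.
Qed.

Lemma bdd_sub V W (S T : V -> W) : bdd S -> bdd T -> bdd (fun x => S x - T x).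
Proof.
move=> bS bT; have := bdd_add bS (bdd_scale (-1) bT).
by under [X in bdd X]eq_fun do rewrite scaleN1r.
Qed.

Lemma bdd_prj V (M : set V) : csub M -> bdd (prj M).
Proof.
move=> cM; split; first exact: prj_linear.
by exists 1 => x; rewrite mul1r prj_nrm.
Qed.

Lemma bdd_prjC V (M : set V) : csub M -> bdd (fun x => x - prj M x).
Proof. by move=> cM; apply: bdd_sub; [exact: bdd_id|exact: bdd_prj]. Qed.

Lemma csub_preim V W (T : V -> W) (M : set W) : bdd T -> csub M ->
  csub [set x | M (T x)].
Proof.
move=> bT [[M0 MD MZ] Mc]; have lT := bT.1; split; first split=> /=.
- by rewrite (lin0 lT).
- by move=> x y hx hy; rewrite (linD lT); exact: MD.
- by move=> c x hx; rewrite (linZ lT); exact: MZ.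
have [K K0 hK] := bdd_pos bT.
move=> x hx; apply: Mc => e e0; have [y My hy] := hx _ (divr_gt0 e0 K0).
exists (T y) => //; rewrite -(linB lT) (le_trans (hK _))//.
by rewrite mulrC -ler_pdivlMr.
Qed.

Lemma csub0 V : csub [set (0 : V)].
Proof.
split; first split=> //.
- by move=> _ _ -> ->; rewrite addr0.
- by move=> c _ ->; rewrite scaler0.
by move=> x hx; apply: nrm_small => e e0; have [_ -> ] := hx _ e0; rewrite subr0.
Qed.

Definition hker V W (T : V -> W) : set V := [set x | T x = 0].

Lemma csub_ker V W (T : V -> W) : bdd T -> csub (hker T).
Proof. by move=> bT; exact: (csub_preim bT (csub0 W)). Qed.

Definition adj V W (T : V -> W) (y : W) : V :=
  xget 0 [set z | forall x, rip (T x) y = rip x z].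

(** For a nonzero f, a vector w orthogonal to the closed kernel spans the complement of the kernel:
    x - (f x / f w) w always lies in the kernel. The representing vector is a multiple of w. *)
Lemma riesz V (f : V -> R[i]) (K : R) :
  (forall c x y, f (c *: x + y) = c * f x + f y) ->
  (forall x, cabs (f x) <= K * nrm x) ->
  exists z, forall x, f x = ip x z.
Proof.
move=> fl fK.
have fD x y : f (x + y) = f x + f y by have := fl 1 x y; rewrite scale1r mul1r.
have f0 : f 0 = 0 by apply: (addrI (f 0)); rewrite -fD !addr0.
have fZ c x : f (c *: x) = c * f x by have := fl c x 0; rewrite f0 !addr0.
have fN x : f (- x) = - f x by rewrite -scaleN1r fZ mulN1r.
pose M := [set x | f x = 0].
have sM : subsp M.
  split=> [//|x y /= hx hy|c x /= hx]; first by rewrite /M/= fD hx hy addr0.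
  by rewrite /M/= fZ hx mulr0.
have K1 : 0 < `|K| + 1 by rewrite ltr_wpDl.
have cM : csub M.
  split=> // x hx; apply: cabs_eq0; apply/eqP; rewrite eq_le cabs_ge0 andbT.
  apply/ler_addgt0Pl => e e0; rewrite addr0.
  have [y My hy] := hx _ (divr_gt0 e0 K1).
  rewrite -[f x]subr0 -My -fN -fD (le_trans (fK _))//.
  apply: (@le_trans _ _ ((`|K| + 1) * nrm (x - y))); last by rewrite mulrC -ler_pdivlMr.
  by rewrite ler_wpM2r ?nrm_ge0// (le_trans (ler_norm K))// lerDl.
have [h|] := pselect (forall x, f x = 0).
  by exists 0 => x; rewrite h ip0r.
move=> /existsNP[x0 fx0]; pose w := x0 - prj M x0.
have fw : f w = f x0 by rewrite fD fN (prj_in cM x0) subr0.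
have w0 : rip w w != 0.
  by apply/eqP => /rip_eq0 h; apply: fx0; rewrite -fw h.
exists ((conjc (f w) / (rip w w)%:C) *: w) => x.
have fw0 : f w != 0 by rewrite fw; apply/eqP.
have Mx : M (x - (f x / f w) *: w) by rewrite /M /= fD fN fZ divfK// subrr.
have := orth_ip sM (prj_orthP cM x0) Mx; rewrite -/w ipC => /eqP.
rewrite conjc_eq0 ipBl ipZl ipxx subr_eq0 => /eqP h.
rewrite ipZr h conjM conjcK conjc_inv conjc_real.
have rw0 : (rip w w)%:C != 0 by apply/eqP => /complexI/eqP; apply/negP.
by field; rewrite ?fw0 ?rw0.
Qed.

Lemma adj_exists V W (T : V -> W) y : bdd T ->
  exists z, forall x, rip (T x) y = rip x z.
Proof.
move=> [lT [K hK]].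
have [c x x'|x|z hz] := @riesz V (fun x => ip (T x) y) (K * nrm y).
- by rewrite lT ipDl ipZl.
- rewrite (le_trans (cabs_ip _ _))// mulrAC ler_wpM2r ?nrm_ge0//.
- by exists z => x; rewrite /rip hz.
Qed.

Lemma adjP V W (T : V -> W) x y : bdd T -> rip (T x) y = rip x (adj T y).
Proof.
by move=> bT; have := xgetPex 0 (adj_exists y bT); exact.
Qed.

(** The imaginary part of <T x, y> is, up to sign, the real part at 'i *: x. *)
Lemma ip_rip V W (T : V -> W) (S : W -> V) :
  linear T -> (forall x y, rip (T x) y = rip x (S y)) ->
  forall x y, ip (T x) y = ip x (S y).
Proof.
move=> lT h x y; apply/eqP; rewrite eq_complex; apply/andP; split; apply/eqP.
  exact: h.
apply: oppr_inj; rewrite -!ReI -!ipZl -(linZ lT); exact: h.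
Qed.

Lemma adj_ip V W (T : V -> W) x y : bdd T -> ip (T x) y = ip x (adj T y).
Proof. by move=> bT; apply: (ip_rip bT.1) => *; exact: adjP. Qed.

Lemma adj_uniq V W (T : V -> W) (S : W -> V) : bdd T ->
  (forall x y, rip (T x) y = rip x (S y)) -> adj T = S.
Proof.
move=> bT h; apply/funext => y; apply: rip_ext => z.
by rewrite ripC -adjP// h ripC.
Qed.

(** At x = S y the identity gives |S y|^2 <= K |S y| |y|. *)
Lemma bnd_dual V W (T : V -> W) (S : W -> V) K : 0 <= K ->
  (forall x y, rip (T x) y = rip x (S y)) -> bnd T K -> bnd S K.
Proof.
move=> K0 h hK y.
have [->|S0] := eqVneq (S y) 0; first by rewrite nrm0 mulr_ge0 ?nrm_ge0.
rewrite -(ler_pM2r (nrm_gt0 S0)) -expr2 nrm_sqr -h.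
rewrite (le_trans (rip_le _ _))// mulrAC ler_wpM2r ?nrm_ge0//.
Qed.

Lemma adj_bdd V W (T : V -> W) : bdd T -> bdd (adj T).
Proof.
move=> bT; split=> [c x y|].
  apply: rip_ext => z; rewrite ripC -adjP// ripDl !ripDr.
  rewrite ![rip _ z]ripC -(adjP z y bT); congr (_ + _).
  by rewrite /rip !ipZr (adj_ip z x bT).
have [K K0 hK] := bdd_pos bT; exists K.
by apply: (bnd_dual (ltW K0) _ hK) => *; exact: adjP.
Qed.

Lemma adjK V W (T : V -> W) : bdd T -> adj (adj T) = T.
Proof.
move=> bT; apply: adj_uniq; first exact: adj_bdd.
by move=> x y; rewrite ripC -adjP// ripC.
Qed.

Lemma adj_comp U V W (S : V -> W) (T : U -> V) : bdd S -> bdd T ->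
  adj (fun x => S (T x)) = fun y => adj T (adj S y).
Proof.
move=> bS bT; apply: adj_uniq; first exact: bdd_comp.
by move=> x y; rewrite !adjP.
Qed.

Lemma adj_add V W (S T : V -> W) : bdd S -> bdd T ->
  adj (fun x => S x + T x) = fun y => adj S y + adj T y.
Proof.
move=> bS bT; apply: adj_uniq; first exact: bdd_add.
by move=> x y; rewrite !ripE !adjP.
Qed.

Lemma adj_scale V W (c : R[i]) (T : V -> W) : bdd T ->
  adj (fun x => c *: T x) = fun y => conjc c *: adj T y.
Proof.
move=> bT; apply: adj_uniq; first exact: bdd_scale.
by move=> x y; rewrite /rip ipZl ipZr conjcK adj_ip.
Qed.

Lemma orth_ker_adj V W (T : V -> W) : bdd T ->
  orth (range T) = hker (adj T).
Proof.
move=> bT; apply/seteqP; split=> y hy.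
  by apply: rip_ext => z; rewrite rip0l ripC -adjP// ripC hy//; exists z.
by move=> _ [x _ <-]; rewrite ripC adjP// hy rip0r.
Qed.

Lemma subsp_range V W (T : V -> W) : linear T -> subsp (range T).
Proof.
move=> lT; split; first by exists 0 => //; exact: lin0.
  by move=> _ _ [x _ <-] [y _ <-]; exists (x + y) => //; exact: linD.
by move=> c _ [x _ <-]; exists (c *: x) => //; exact: linZ.
Qed.

(* Bounded below together with its adjoint: closed range and dense range. *)
Lemma bounded_below_surj V W (T : V -> W) (c : R) : bdd T -> 0 < c ->
  (forall x, c * nrm x <= nrm (T x)) -> (forall y, adj T y = 0 -> y = 0) ->
  forall y, exists x, T x = y.
Proof.
move=> bT c0 hc inj y; have lT := bT.1.
have sR := subsp_range lT.
have dR : hcl (range T) y.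
  apply: dense_orth0 => // x; rewrite orth_ker_adj//; exact: inj.
have hu n : exists x, nrm (T x - y) <= n.+1%:R^-1.
  have e0 : 0 < (n.+1%:R^-1 : R) by rewrite invr_gt0.
  by have [_ [x _ <-] hx] := dR _ e0; exists x; rewrite nrmB.
have [u hu'] := choice hu.
have [n m nm|l hl] := @hcomplete R V u (2 / c).
  have := hc (u m - u n); rewrite (linB lT) mulrC -ler_pdivlMr//.
  move/le_trans; apply; rewrite mulrAC ler_pM2r ?invr_gt0//.
  rewrite (le_trans (nrmT y _ _))// (_ : 2 = 1 + 1 :> R)// mulrDl !mul1r lerD//.
    by rewrite (le_trans (hu' m))// lef_pV2 ?posrE// ler_nat.
  by rewrite nrmB.
exists l; have [K K0 hK] := bdd_pos bT.
apply/eqP; rewrite -subr_eq0; apply/eqP/nrm_small => e e0.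
have [n hn] := invS_small (K * (2 / c) + 1) e0.
apply: le_trans (ltW hn); rewrite (le_trans (nrmT (T (u n)) _ _))//.
rewrite mulrDl mul1r lerD// -(linB lT) (le_trans (hK _))// -mulrA ler_pM2l//.
by rewrite nrmB.
Qed.
End Operators.

Section ClosedExtension.
Context (R : realType) (C : pzRingType) (V W : lmodType C).
Variables (NV : V -> R) (NW : W -> R).
Hypothesis NVD : forall x y, NV (x + y) <= NV x + NV y.
Hypothesis NVN : forall x, NV (- x) = NV x.
Hypothesis W_complete : forall (u : nat -> W) (K : R),
  (forall n m, (n <= m)%N -> NW (u m - u n) <= K / n.+1%:R) ->
  exists l, forall n, NW (u n - l) <= K / n.+1%:R.
Hypothesis NWN : forall x, NW (- x) = NW x.

(** Extension by continuity, stated for a relation D: Lipschitz, densely defined and closed imply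
    everywhere defined. The norms are abstract because it serves both the Hilbert norm, in [polar],
    and the norms of E and E + E, in [lift2]. *)
Lemma closed_dense_total (D : V -> W -> Prop) (K : R) : 0 <= K ->
  (forall x y x' y', D x y -> D x' y' -> NW (y' - y) <= K * NV (x' - x)) ->
  (forall x (e : R), 0 < e -> exists a b, D a b /\ NV (x - a) <= e) ->
  (forall x y, (forall e : R, 0 < e ->
     exists a b, [/\ D a b, NV (x - a) <= e & NW (y - b) <= e]) -> D x y) ->
  forall x, exists y, D x y.
Proof.
move=> K0 hK hd hc x.
have hu n : exists p : V * W, D p.1 p.2 /\ NV (x - p.1) <= n.+1%:R^-1.
  have e0 : 0 < (n.+1%:R^-1 : R) by rewrite invr_gt0.
  by have [a [b h]] := hd x _ e0; exists (a, b).
have [u hu'] := choice hu.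
have [n m nm|y hy] := @W_complete (fun n => (u n).2) (K * 2).
  have [Dn hn] := hu' n; have [Dm hm] := hu' m.
  rewrite (le_trans (hK _ _ _ _ Dn Dm))// -mulrA ler_wpM2l//.
  have -> : (u m).1 - (u n).1 = - (x - (u m).1) + (x - (u n).1).
    by rewrite opprB addrA subrK.
  rewrite (le_trans (NVD _ _))// NVN (_ : 2 = 1 + 1 :> R)// mulrDl !mul1r lerD//.
  by rewrite (le_trans hm)// lef_pV2 ?posrE// ler_nat.
exists y; apply: hc => e e0; have [n hn] := invS_small (K * 2 + 1) e0.
exists (u n).1, (u n).2; have [Dn hn'] := hu' n; split=> //.
  rewrite (le_trans hn')// (le_trans _ (ltW hn))// mulrDl mul1r lerDr.
  by rewrite divr_ge0// mulr_ge0.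
rewrite -NWN opprB (le_trans (hy n))// (le_trans _ (ltW hn))//.
by rewrite mulrDl lerDl mul1r invr_ge0.
Qed.
End ClosedExtension.

(** * Finite dimensional subspaces *)

Section Dimension.
Context (R : realType).
Implicit Types (V W : hspaceType R).

Definition onb V n (f : 'I_n -> V) := forall i j, ip (f i) (f j) = (i == j)%:R.

Definition onp V n (f : 'I_n -> V) (x : V) : V := \sum_i ip x (f i) *: f i.

(** M is the span of the orthonormal family f, written as the fixed space of the projection [onp f],
    so that membership in M is an equation. *)
Definition odim V (M : set V) n :=
  exists2 f : 'I_n -> V, onb f & M = [set x | x = onp f x].

Lemma nrm_sum V I (s : seq I) (P : pred I) (F : I -> V) :
  nrm (\sum_(i <- s | P i) F i) <= \sum_(i <- s | P i) nrm (F i).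
Proof.
elim/big_ind2: _ => [|a b c d h1 h2|//]; first by rewrite nrm0.
by rewrite (le_trans (nrmD _ _))// lerD.
Qed.

Lemma onb_nrm V n (f : 'I_n -> V) i : onb f -> nrm (f i) = 1.
Proof. by move=> of_; rewrite /nrm /rip of_ eqxx sqrtr1. Qed.

Lemma bdd_onp V n (f : 'I_n -> V) : bdd (onp f).
Proof.
split=> [c x y|].
  rewrite /onp scaler_sumr -big_split; apply: eq_bigr => i _ /=.
  by rewrite ipDl ipZl scalerDl scalerA.
exists (\sum_i nrm (f i) * nrm (f i)) => x; rewrite mulr_suml.
rewrite (le_trans (nrm_sum _ _ _))// ler_sum// => i _.
by rewrite nrmZ mulrAC ler_wpM2r ?nrm_ge0// mulrC cabs_ip.
Qed.

Lemma onb_comb V n (f : 'I_n -> V) (c : 'I_n -> R[i]) j : onb f ->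
  ip (\sum_i c i *: f i) (f j) = c j.
Proof.
move=> of_; rewrite ip_suml (bigD1 j)//= ipZl of_ eqxx mulr1 big1 ?addr0//.
by move=> i ij; rewrite ipZl of_ (negPf ij) mulr0.
Qed.

Lemma onp_comb V n (f : 'I_n -> V) (c : 'I_n -> R[i]) : onb f ->
  onp f (\sum_i c i *: f i) = \sum_i c i *: f i.
Proof. by move=> of_; apply: eq_bigr => j _; rewrite onb_comb. Qed.

Lemma onp_basis V n (f : 'I_n -> V) i : onb f -> onp f (f i) = f i.
Proof.
move=> of_; rewrite /onp (bigD1 i)//= of_ eqxx scale1r big1 ?addr0// => j ji.
by rewrite of_ eq_sym (negPf ji) scale0r.
Qed.

Lemma onb_free V n (f : 'I_n -> V) (c : 'I_n -> R[i]) : onb f ->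
  \sum_i c i *: f i = 0 -> forall i, c i = 0.
Proof. by move=> of_ h i; rewrite -(onb_comb c i of_) h ip0l. Qed.

Lemma onp_orth V n (f : 'I_n -> V) x i : onb f -> ip (x - onp f x) (f i) = 0.
Proof. by move=> of_; rewrite ipBl onb_comb// subrr. Qed.

Lemma odim_csub V (M : set V) n : odim M n -> csub M.
Proof.
move=> [f _ ->]; have -> : [set x | x = onp f x] = hker (fun x => x - onp f x).
  apply/seteqP; split=> x /= h; first by rewrite /hker/= -h subrr.
  by apply/eqP; rewrite -subr_eq0; apply/eqP.
by apply: csub_ker; apply: bdd_sub; [exact: bdd_id|exact: bdd_onp].
Qed.

Lemma prj_onp V n (f : 'I_n -> V) : onb f ->
  prj [set x | x = onp f x] = onp f.
Proof.
move=> of_; have od : odim [set x | x = onp f x] n by exists f.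
apply/funext => x; apply: (prj_uniq (odim_csub od)).
  exact/esym/(onp_comb (fun i => ip x (f i)) of_).
move=> y /= ->; rewrite /rip /onp ip_sumr big1// => i _.
by rewrite ipZr onp_orth// mulr0.
Qed.

(** If m < n, the n by m matrix of coefficients has a nonzero row vector in its left kernel, and
    this is a nontrivial relation between the f i. *)
Lemma free_le V n m (f : 'I_n -> V) (w : 'I_m -> V) :
  (forall c : 'I_n -> R[i], \sum_i c i *: f i = 0 -> forall i, c i = 0) ->
  (forall i, exists a : 'I_m -> R[i], f i = \sum_j a j *: w j) -> (n <= m)%N.
Proof.
move=> fr /choice[a ha]; rewrite leqNgt; apply/negP => mn.
pose A : 'M[R[i]]_(n, m) := \matrix_(i, j) a i j.
have : kermx A != 0.
  rewrite -mxrank_eq0 mxrank_ker subn_eq0 -ltnNge.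
  exact: leq_ltn_trans (rank_leq_col _) mn.
move=> /rowV0Pn[c /sub_kermxP cA c0].
have h : \sum_i c 0 i *: f i = 0.
  under eq_bigr do rewrite ha scaler_sumr.
  rewrite exchange_big big1// => j _ /=.
  have := congr1 (fun B : 'rV_m => B 0 j) cA; rewrite !mxE => e.
  rewrite (eq_bigr (fun i => (c 0 i * a i j) *: w j)); last by move=> i _; rewrite scalerA.
  rewrite -scaler_suml (_ : \sum_i _ = 0) ?scale0r//.
  by rewrite -[RHS]e; apply: eq_bigr => i _; rewrite mxE.
case/eqP: c0; apply/matrixP => i j; rewrite ord1 mxE; exact: fr h j.
Qed.

(** One Gram-Schmidt step: the normalised component of x orthogonal to the family is appended in the
    last place. *)
Lemma onb_extend V n (f : 'I_n -> V) (M : set V) x : subsp M -> onb f ->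
  (forall i, M (f i)) -> M x -> x != onp f x ->
  exists2 g : 'I_n.+1 -> V, onb g & forall i, M (g i).
Proof.
move=> sM of_ Mf Mx; rewrite -subr_eq0; set y := x - _ => y0.
have My : M y.
  by apply: subspB => //; apply: subsp_sum => // i _; case: sM => _ _; apply.
have yf i : ip y (f i) = 0 by exact: onp_orth.
pose e := ((nrm y)^-1)%:C *: y.
have Me : M e by case: sM => _ _; apply.
have ny := nrm_gt0 y0.
have ee : ip e e = 1.
  rewrite ipZl ipZr conjc_real ipxx -nrm_sqr -!rmorphM/=.
  rewrite (_ : _ * _ = 1)//; by field; rewrite gt_eqF.
have ef i : ip e (f i) = 0 by rewrite ipZl yf mulr0.
have fe i : ip (f i) e = 0 by rewrite ipC ef conjc0.
exists (fun i => if unlift ord_max i is Some j then f j else e).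
  move=> i j; case: (unliftP ord_max i) => [i' ->|->];
    case: (unliftP ord_max j) => [j' ->|->] /=.
  - by rewrite of_ (inj_eq lift_inj).
  - by rewrite fe eq_sym (negPf (neq_lift _ _)).
  - by rewrite ef (negPf (neq_lift _ _)).
  - by rewrite ee eqxx.
by move=> i; case: (unlift _ i).
Qed.

(** An orthonormal family in M of maximal length spans M, since a vector outside its span would
    extend it. *)
Lemma bounded_odim V (M : set V) m : subsp M ->
  (forall n (f : 'I_n -> V), onb f -> (forall i, M (f i)) -> (n <= m)%N) ->
  exists n, odim M n.
Proof.
move=> sM hb.
pose P n := `[< exists2 f : 'I_n -> V, onb f & forall i, M (f i) >].
have P0 : exists n, P n by exists 0; apply/asboolP; exists (fun=> 0) => -[].
have Pm n : P n -> (n <= m)%N by move=> /asboolP[f of_ Mf]; exact: hb of_ Mf.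
case: (ex_maxnP P0 Pm) => n /asboolP[f of_ Mf] hmax; exists n, f => //.
apply/seteqP; split=> x /=; last first.
  by move=> ->; apply: subsp_sum => // i _; case: sM => _ _; apply.
move=> Mx; apply/eqP; apply: contraT => /(onb_extend sM of_ Mf Mx)[g og Mg].
have /hmax : P n.+1 by apply/asboolP; exists g.
by rewrite ltnn.
Qed.

Lemma odim_in V (M : set V) n (f : 'I_n -> V) i : onb f ->
  M = [set x | x = onp f x] -> M (f i).
Proof. by move=> of_ -> /=; rewrite onp_basis. Qed.

Lemma free_inj V W n (f : 'I_n -> V) (T : V -> W) (M : set V) : subsp M ->
  onb f -> (forall i, M (f i)) -> linear T ->
  (forall x, M x -> T x = 0 -> x = 0) ->
  forall c : 'I_n -> R[i], \sum_i c i *: T (f i) = 0 -> forall i, c i = 0.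
Proof.
move=> sM of_ Mf lT iT c h; apply: (onb_free of_); apply: iT.
  by apply: subsp_sum => // i _; case: sM => _ _; apply.
by rewrite (lin_sum lT) -[RHS]h; apply: eq_bigr => i _; rewrite (linZ lT).
Qed.

Lemma odim_inj V W (M : set V) (N : set W) m (T : V -> W) : subsp M ->
  odim N m -> linear T -> (forall x, M x -> N (T x)) ->
  (forall x, M x -> T x = 0 -> x = 0) ->
  exists n, odim M n.
Proof.
move=> sM [g og Ng] lT MN iT; apply: (@bounded_odim _ _ m) => // n f of_ Mf.
apply: (@free_le _ _ _ (T \o f) g); first exact: (free_inj sM).
by move=> i; have := MN _ (Mf i); rewrite Ng => /= h; exists (fun j => ip (T (f i)) (g j)).
Qed.

Lemma odim_le V W (M : set V) (N : set W) n m (T : V -> W) :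
  odim M n -> odim N m -> linear T -> (forall x, M x -> N (T x)) ->
  (forall x, M x -> T x = 0 -> x = 0) -> (n <= m)%N.
Proof.
move=> oM [g og Ng] lT MN iT; have sM := (odim_csub oM).1.
have [f of_ Mf] := oM; have Mi i : M (f i) by exact: (odim_in i of_ Mf).
apply: (@free_le _ _ _ (T \o f) g); first exact: (free_inj sM).
by move=> i; have := MN _ (Mi i); rewrite {1}Ng => /= h; exists (fun j => ip (T (f i)) (g j)).
Qed.

Lemma odim_uniq V (M : set V) n m : odim M n -> odim M m -> n = m.
Proof.
move=> h1 h2; apply/eqP; rewrite eqn_leq.
by rewrite (@odim_le _ _ M M _ _ idfun)// (@odim_le _ _ M M _ _ idfun).
Qed.

(** Injections in both directions compare the dimensions both ways; T and S need not be inverse to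
    each other. *)
Lemma odim_iso V W (M : set V) (N : set W) n (T : V -> W) (S : W -> V) :
  subsp M -> odim N n -> linear T -> linear S ->
  (forall x, M x -> N (T x)) -> (forall x, M x -> T x = 0 -> x = 0) ->
  (forall x, N x -> M (S x)) -> (forall x, N x -> S x = 0 -> x = 0) ->
  odim M n.
Proof.
move=> sM oN lT lS MN iT NM iS; have [k ok] := odim_inj sM oN lT MN iT.
suff -> : n = k by [].
apply/eqP; rewrite eqn_leq.
by rewrite (odim_le oN ok lS)// (odim_le ok oN lT).
Qed.

Lemma odim_span V (M : set V) m (w : 'I_m -> V) : subsp M ->
  (forall x, M x -> exists a : 'I_m -> R[i], x = \sum_j a j *: w j) ->
  exists n, odim M n.
Proof.
move=> sM hw; apply: (@bounded_odim _ _ m) => // n f of_ Mf.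
apply: (free_le (f := f) (w := w)); first by move=> c; exact: onb_free.
by move=> i; exact: hw.
Qed.

Lemma odim_sub V (M N : set V) n : subsp M -> odim N n -> M `<=` N ->
  exists m, odim M m.
Proof. by move=> sM oN MN; exact: (@odim_inj _ _ M N n idfun). Qed.

Lemma subsp_image V W (T : V -> W) (M : set V) : linear T -> subsp M ->
  subsp (T @` M).
Proof.
move=> lT [M0 MD MZ]; split; first by exists 0 => //; exact: lin0.
  by move=> _ _ [x Mx <-] [y My <-]; exists (x + y); [exact: MD|exact: linD].
by move=> c _ [x Mx <-]; exists (c *: x); [exact: MZ|exact: linZ].
Qed.

Lemma odim_image V W (T : V -> W) (M : set V) n : linear T -> odim M n ->
  exists m, odim (T @` M) m.
Proof.
move=> lT oM; have [f of_ Mf] := oM.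
apply: (@odim_span _ _ n (T \o f)).
  by apply: subsp_image => //; exact: (odim_csub oM).1.
move=> _ [x + <-]; rewrite Mf /= => hx; exists (fun j => ip x (f j)).
by rewrite {1}hx (lin_sum lT); apply: eq_bigr => i _; rewrite (linZ lT).
Qed.

(** Let h j be preimages in M of an orthonormal basis g j of the image. Then x is the sum of the <T
    x, g j> h j, so the sum of the norms of the h j is an admissible constant. *)
Lemma odim_inv_bounded V W (T : V -> W) (M : set V) n : linear T -> odim M n ->
  (forall x, M x -> T x = 0 -> x = 0) ->
  exists2 C, 0 <= C & forall x, M x -> nrm x <= C * nrm (T x).
Proof.
move=> lT oM iT; have sM := (odim_csub oM).1.
have [m [g og TM]] := odim_image lT oM.
have /choice[h hh] : forall j, exists x, M x /\ T x = g j.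
  by move=> j; have [x Mx <-] : (T @` M) (g j) := odim_in j og TM; exists x.
exists (\sum_j nrm (h j)); first by apply: sumr_ge0 => j _; exact: nrm_ge0.
move=> x Mx; have : (T @` M) (T x) by exists x.
rewrite TM /= => e.
have xE : x = \sum_j ip (T x) (g j) *: h j.
  apply/eqP; rewrite -subr_eq0; apply/eqP; apply: iT.
    apply: subspB => //; apply: subsp_sum => // j _.
    by case: sM => _ _; apply; case: (hh j).
  rewrite (linB lT) (lin_sum lT) {1}e; apply/eqP; rewrite subr_eq0; apply/eqP.
  by apply: eq_bigr => j _; rewrite (linZ lT) (hh j).2.
rewrite {1}xE mulr_suml (le_trans (nrm_sum _ _ _))// ler_sum// => j _.
rewrite nrmZ mulrC ler_wpM2l ?nrm_ge0// (le_trans (cabs_ip _ _))//.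
by rewrite (onb_nrm j og) mulr1.
Qed.

Lemma odim_pair V W (M : set V) (N : set W) n m :
  odim M n -> odim N m -> odim (M `*` N) (n + m).
Proof.
move=> oM oN; have [f of_ Mf] := oM; have [g og Ng] := oN.
pose h (i : 'I_(n + m)) : V * W :=
  match fintype.split i with inl j => (f j, 0) | inr j => (0, g j) end.
have hl j : h (lshift m j) = (f j, 0) by rewrite /h (unsplitK (inl j)).
have hr j : h (rshift n j) = (0, g j) by rewrite /h (unsplitK (inr j)).
have oh : onb h.
  move=> i j; rewrite -(splitK i) -(splitK j).
  case: (fintype.split i) => i'; case: (fintype.split j) => j' /=; rewrite ?hl ?hr ip_pair /=.
  - by rewrite ip0l addr0 of_ (inj_eq (@lshift_inj _ _)).
  - by rewrite ip0l ip0r addr0 eq_lrshift.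
  - by rewrite ip0l ip0r addr0 eq_rlshift.
  - by rewrite ip0l add0r og (inj_eq (@rshift_inj _ _)).
have hE p : onp h p = (onp f p.1, onp g p.2).
  rewrite /onp big_split_ord /=.
  under eq_bigr do rewrite hl ip_pair /= ip0r addr0.
  under [X in _ + X]eq_bigr do rewrite hr ip_pair /= ip0r add0r.
  have lL : linear (fun x : V => (x, 0 : W)).
    by move=> c x y; apply/pair_equal_spec; rewrite /= scaler0 addr0.
  have lR : linear (fun x : W => (0 : V, x)).
    by move=> c x y; apply/pair_equal_spec; rewrite /= scaler0 addr0.
  rewrite (eq_bigr (fun i => (ip p.1 (f i) *: f i, 0 : W))); last first.
    by move=> i _; rewrite (linZ lL).
  rewrite -(lin_sum lL) (eq_bigr (fun i => (0 : V, ip p.2 (g i) *: g i))).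
    by rewrite -(lin_sum lR); apply/pair_equal_spec; rewrite /= addr0 add0r.
  by move=> i _; rewrite (linZ lR).
exists h => //; rewrite Mf Ng; apply/seteqP; split=> p /=.
  by move=> [h1 h2]; rewrite hE -h1 -h2; case: p {h1 h2}.
by rewrite hE => hp; split; [rewrite {1}hp|rewrite {1}hp].
Qed.
End Dimension.

(** * Stability of the index *)

Section PairStability.
Context (R : realType) (Z : hspaceType R).
Implicit Types (V U M : set Z).

Definition pgap (V W : set Z) (d : R) :=
  forall x, nrm (prj V x - prj W x) <= d * nrm x.

Lemma pgap_sym V W d : pgap V W d -> pgap W V d.
Proof. by move=> h x; rewrite nrmB. Qed.

Lemma pgap_trans V W U d d' : pgap V W d -> pgap W U d' -> pgap V U (d + d').
Proof.
by move=> h1 h2 x; rewrite mulrDl (le_trans (nrmT (prj W x) _ _))// lerD.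
Qed.

Lemma pgap_orth V W d : csub V -> csub W -> pgap V W d -> pgap (orth V) (orth W) d.
Proof.
move=> cV cW h x; rewrite !prj_orthc// (le_trans _ (h x))// nrmB.
by rewrite opprB [X in nrm X]addrC addrA subrK.
Qed.

Lemma subspD V U : subsp V -> subsp U -> subsp [set z | exists v u, [/\ V v, U u & z = v + u]].
Proof.
move=> [V0 VD VZ] [U0 UD UZ]; split.
- by exists 0, 0; rewrite addr0.
- move=> _ _ [v [u [hv hu ->]]] [v' [u' [hv' hu' ->]]].
  by exists (v + v'), (u + u'); split; [exact: VD|exact: UD|rewrite addrACA].
- move=> c _ [v [u [hv hu ->]]]; exists (c *: v), (c *: u).
  by split; [exact: VZ|exact: UZ|rewrite scalerDr].
Qed.

(** The complement of the sum of the two complements is V [&] U; taking complements once more yields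
    the closure of that sum. *)
Lemma orthI V U : csub V -> csub U ->
  orth (V `&` U) = hcl [set z | exists v u, [/\ orth V v, orth U u & z = v + u]].
Proof.
move=> cV cU; have cV' := csub_orth cV.1; have cU' := csub_orth cU.1.
rewrite -orth_hcl; last exact: subspD cV'.1 cU'.1.
congr orth; apply/seteqP; split=> x.
  by move=> [Vx Ux] _ [v [u [ov ou ->]]]; rewrite ripDr ripC ov// ripC ou// addr0.
move=> hx; split.
  rewrite -(orth_orth cV) => v ov; apply: hx; exists v, 0; split=> //.
    by case: cU'.1.
  by rewrite addr0.
rewrite -(orth_orth cU) => u ou; apply: hx; exists 0, u; split=> //.
  by case: cV'.1.
by rewrite add0r.
Qed.

Lemma prj_eq0_orth V x : csub V -> prj V x = 0 -> orth V x.
Proof. by move=> cV h y Vy; rewrite -[x]subr0 -h prj_orth. Qed.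

(* Enlarging [U] by [M] makes the pair transversal, a property stable under
   small perturbations of [V]; the inequality is then linear algebra. *)
Lemma pair_index_le V V' U (c d : R) n m n' m' : csub V -> csub V' -> csub U ->
  let M := orth V `&` orth U in
  0 < c -> 0 <= d -> d <= c / 2 -> d * (1 + 2 / c) <= 1 / 2 ->
  (forall z, orth U z -> orth M z -> c * nrm z <= nrm (prj V z)) ->
  pgap V V' d ->
  odim (V `&` U) n -> odim M m ->
  odim (V' `&` U) n' -> odim (orth V' `&` orth U) m' ->
  (n + m' <= n' + m)%N.
Proof.
move=> cV cV' cU M c0 d0 dc ds hc hd oN oM oA oC.
have cM := odim_csub oM; have cA := odim_csub oA.
have cUo := csub_orth cU.1; have cMo := csub_orth cM.1.
pose Q := orth U `&` orth M; have cQ : csub Q by exact: csubI.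
(* This is the sum of U and M (see [U2dec]); as a complement it is closed at once. *)
pose U2 := orth Q; have cU2 : csub U2 by exact: csub_orth cQ.1.
pose B := V' `&` U2; have cB : csub B by exact: csubI.
(* Passing from V to V' costs at most d <= c / 2 in the lower bound c. *)
have Qc z : Q z -> c / 2 * nrm z <= nrm (prj V' z).
  move=> [h1 h2]; have h3 := hc _ h1 h2; have := hd z.
  have := nrmT (prj V' z) (prj V z) 0; rewrite !subr0.
  have := nrm_ge0 z; move: (nrm z) (nrm (prj V z)) h3 (nrm (prj V' z)) => a b h3 e.
  by move: (nrm _) => f; nra.
(* A vector x of V and U killed by [prj B] is nearly w + u with w orthogonal to V' and u in Q. Here
   <x,u> = 0 because x lies in U, and <x,w> is at most d |x| |w| because x lies in V; as [Qc] bounds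
   u, and hence w, by x, the norm of x is forced to be 0. *)
have inj1 x : V x -> U x -> prj B x = 0 -> x = 0.
  move=> Vx Ux /(prj_eq0_orth cB); rewrite orthI// orth_orth// => hx.
  apply/eqP; apply: contraT => x0.
  have nx := nrm_gt0 x0.
  (* With error |x| / 4 and d (1 + 2 / c) <= 1 / 2, the two contributions to |x|^2 are at most 5/8
     and 1/4 of it, together less than 1. *)
  have [|z [w [u [ow Qu ->]]] hz] := hx (nrm x / 4); first by rewrite divr_gt0.
  set r := x - (w + u) in hz.
  have xE : x = w + u + r by rewrite /r addrC subrK.
  have e1 : rip x u = 0 by rewrite ripC; case: Qu => h _; exact: h.
  have e2 : rip x w = rip (prj V x - prj V' x) w.
    rewrite ripDl ripNl (prj_id cV Vx) (ripC (prj V' x)) ow ?subr0//.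
    exact: prj_in.
  have h1 : nrm x ^+ 2 <= d * nrm x * nrm w + nrm x * nrm r.
    have -> : nrm x ^+ 2 = rip x w + rip x u + rip x r.
      by rewrite nrm_sqr -!ripDr -xE.
    rewrite e1 addr0 e2 lerD ?rip_le//.
    by rewrite (le_trans (rip_le _ _))// ler_wpM2r ?nrm_ge0.
  have h2 : nrm w <= nrm x + nrm r + nrm u.
    have -> : w = x - r - u by rewrite xE addrK addrK.
    by rewrite (le_trans (nrmDB _ _))// lerD// nrmDB.
  have h3 : c / 2 * nrm u <= nrm x + nrm r.
    rewrite (le_trans (Qc _ Qu))//.
    have -> : prj V' u = prj V' (x - r).
      rewrite xE addrK (linD (prj_linear cV')) (prj_eq0 cV' ow) add0r//.
    by rewrite (le_trans (prj_nrm cV' _))// nrmDB.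
  have h3' : nrm u <= 2 / c * (nrm x + nrm r).
    rewrite mulrAC ler_pdivlMr//; lra.
  move: h1 h2 h3' hz ds nx; move: (nrm x) (nrm w) (nrm u) (nrm r) (nrm_ge0 r) (nrm_ge0 w).
  move: (2 / c) {h3} => k X W Y r0 r1 w1 h1 h2 h3 hz ds nx.
  have h4 : W <= (1 + k) * (X + r0) by lra.
  have h5 : d * W <= 5 / 8 * X.
    apply: (@le_trans _ _ (d * ((1 + k) * (X + r0)))); first by rewrite ler_wpM2l.
    rewrite mulrA (le_trans (ler_wpM2r _ ds))//; last by lra.
    by rewrite addr_ge0// ltW.
  have h6 : X ^+ 2 <= (5 / 8 + 1 / 4) * X ^+ 2 by nra.
  have X2 : 0 < X ^+ 2 by rewrite exprn_gt0.
  by lra.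
have U2dec y : U2 y -> U (y - prj M y).
  move=> Uy; rewrite -(orth_orth cU) => v ov.
  have -> : v = prj M v + (v - prj M v) by rewrite addrC subrK.
  rewrite ripDr prj_orth ?add0r; [|exact: cM|exact: prj_in].
  have Qv : Q (v - prj M v).
    split; last exact: prj_orthP.
    by apply: (subspB cUo.1) => //; case: (prj_in cM v).
  by rewrite ripDl ripNl Uy// ripC prj_orth ?subr0 ?oppr0//; exact: prj_in.
have oNC := odim_pair oN oC; have oAM := odim_pair oA oM.
pose A := V' `&` U.
(* The M-parts of y = [prj B x] and of w may be added without loss: they are orthogonal ([ab]
   below), because y is in V', y - [prj M y] is in U, and w is orthogonal to both. A vanishing sum
   thus has vanishing terms. *)
pose T (p : Z * Z) : Z * Z := (prj A (prj B p.1), prj M (prj B p.1) + prj M p.2).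
apply: (@odim_le _ _ _ _ _ _ _ T oNC oAM).
- move=> a [x w] [x' w']; rewrite /T /= !(prj_linear cB) !(prj_linear cA) !(prj_linear cM).
  by apply/pair_equal_spec; split=> //=; rewrite scalerDr addrACA.
- move=> p _; split => /=; first exact: (prj_in cA).
  have [_ MD _] := cM.1; apply: MD; exact: (prj_in cM).
move=> [x w] [[/= Vx Ux] [ow1 ow2]] [/=] hA hM.
set y := prj B x in hA hM.
have [By Uy] : B y by exact: prj_in.
have ab : rip (prj M y) (prj M w) = 0.
  rewrite -prj_sa// (prj_id cM); last exact: prj_in.
  have -> : prj M y = y - (y - prj M y) by rewrite opprB addrC subrK.
  by rewrite ripDl ripNl (ripC y) ow1// (ripC _ w) ow2 ?subrr//; exact: U2dec.
have a0 : prj M y = 0.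
  apply: rip_eq0; have /eqP := hM; rewrite addr_eq0 => /eqP h.
  by rewrite {2}h ripNr ab oppr0.
have b0 : prj M w = 0 by move: hM; rewrite a0 add0r.
have y0 : y = 0.
  rewrite -hA prj_id//; split=> //; have := U2dec _ Uy.
  by rewrite a0 subr0.
rewrite (inj1 x)//; congr (_, _).
have Qw : Q w by split=> //; exact: prj_eq0_orth.
have := Qc _ Qw; rewrite (prj_eq0 cV' ow1) nrm0 pmulr_rle0 ?divr_gt0// => h.
by apply: nrm_eq0; apply/eqP; rewrite eq_le h nrm_ge0.
Qed.

(** Write P and Q for the projections onto V and W. Then P - Q = P (1 - Q) - (1 - P) Q; the second
    term is bounded by d from the approximation of W by V, and the first is the adjoint of (1 - Q)
    P, bounded by d from that of V by W. *)
Lemma close_pgap V W d : csub V -> csub W -> 0 <= d ->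
  (forall v, V v -> exists2 w, W w & nrm (v - w) <= d * nrm v) ->
  (forall v, W v -> exists2 w, V w & nrm (v - w) <= d * nrm v) ->
  pgap V W (2 * d).
Proof.
have half (A B : set Z) : csub A -> csub B -> 0 <= d ->
    (forall v, A v -> exists2 w, B w & nrm (v - w) <= d * nrm v) ->
    bnd (fun x => prj A x - prj B (prj A x)) d.
  move=> cA cB d0 h x; have [w Bw hw] := h _ (prj_in cA x).
  set y := prj A x in hw *.
  apply: (@le_trans _ _ (nrm (y - w))); last first.
    by rewrite (le_trans hw)// ler_wpM2l// prj_nrm.
  have -> : y - prj B y = (y - w) - prj B (y - w).
    rewrite (linB (prj_linear cB)) (prj_id cB Bw) opprB addrA.
    by rewrite subrK.
  exact: prjC_nrm.
move=> cV cW d0 hVW hWV x.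
have h1 := half _ _ cV cW d0 hVW; have h2 := half _ _ cW cV d0 hWV.
have h3 : bnd (fun x => prj W x - prj V (prj W x)) d := h2.
have h4 : bnd (fun x => prj V x - prj V (prj W x)) d.
  apply: (bnd_dual d0 _ h1) => a b.
  rewrite ripDl ripNl !prj_sa// ripDr ripNr; congr (_ - _).
have -> : prj V x - prj W x =
    (prj V x - prj V (prj W x)) - (prj W x - prj V (prj W x)).
  by rewrite opprB addrA subrK.
by rewrite (le_trans (nrmDB _ _))// mulr_natl mulr2n mulrDl lerD.
Qed.
End PairStability.

(** * Fredholm relations, Moore-Penrose inverses and local constancy of the index *)

Section FredholmRelations.
Context (R : realType) (X : hspaceType R).
Implicit Types (V : set (X * X)) (T l : X -> X).

Definition vdom V : set X := [set x | exists y, V (x, y)].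
Definition vran V : set X := [set y | exists x, V (x, y)].
Definition vker V : set X := [set x | V (x, 0)].
Definition vcok V : set X := orth (vran V).

(* Graphs of Fredholm operators; by the open mapping theorem [fredX_bound] says
   that the range is closed. *)
Record fredX V : Prop := {
  fredX_csub : csub V ;
  fredX_fun : forall y, V (0, y) -> y = 0 ;
  fredX_dense : forall x, hcl (vdom V) x ;
  fredX_ker : exists n, odim (vker V) n ;
  fredX_cok : exists m, odim (vcok V) m ;
  fredX_bound : exists C, forall x y, V (x, y) ->
    exists2 x', V (x', y) & nrm x' <= C * nrm y
}.

Lemma subsp_vdom V : subsp V -> subsp (vdom V).
Proof.
move=> [V0 VD VZ]; split; first by exists 0.
  by move=> x x' [y hy] [y' hy']; exists (y + y'); exact: (VD _ _ hy hy').
by move=> c x [y hy]; exists (c *: y); exact: (VZ c _ hy).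
Qed.

Lemma subsp_vran V : subsp V -> subsp (vran V).
Proof.
move=> [V0 VD VZ]; split; first by exists 0.
  by move=> x x' [y hy] [y' hy']; exists (y + y'); exact: (VD _ _ hy hy').
by move=> c x [y hy]; exists (c *: y); exact: (VZ c _ hy).
Qed.

Lemma linear_inl : linear (fun x : X => (x, 0) : X * X).
Proof. by move=> c x y; apply/pair_equal_spec; rewrite /= scaler0 addr0. Qed.

Lemma linear_inr : linear (fun x : X => (0, x) : X * X).
Proof. by move=> c x y; apply/pair_equal_spec; rewrite /= scaler0 addr0. Qed.

Lemma bdd_inl : bdd (fun x : X => (x, 0) : X * X).
Proof. by split; [exact: linear_inl|exists 1 => x; rewrite mul1r nrm_pair0r]. Qed.

Lemma bdd_fst : bdd (fun p : X * X => p.1).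
Proof. by split=> [//|]; exists 1 => x; rewrite mul1r nrm_fst. Qed.

Lemma bdd_snd : bdd (fun p : X * X => p.2).
Proof. by split=> [//|]; exists 1 => x; rewrite mul1r nrm_snd. Qed.

Lemma csub_vker V : csub V -> csub (vker V).
Proof. by move=> cV; exact: (csub_preim bdd_inl cV). Qed.

Lemma csub_vcok V : csub V -> csub (vcok V).
Proof. by move=> cV; apply: csub_orth; apply: subsp_vran; exact: cV.1. Qed.

(** Preimages can be made orthogonal to the kernel without increasing their norm. They are then
    unique, hence linear in the image and controlled by it, so preimages of a convergent sequence
    converge. *)
Lemma vran_closed V : fredX V -> hcl (vran V) `<=` vran V.
Proof.
move=> fV y hy; have [C hC] := fredX_bound fV; have cV := fredX_csub fV.
have sV := cV.1.
pose K := `|C| + 1; have K0 : 0 < K by rewrite ltr_wpDl.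
have hK x y' : V (x, y') -> exists2 x', V (x', y') & nrm x' <= K * nrm y'.
  move=> /hC[x' h1 h2]; exists x' => //; rewrite (le_trans h2)// ler_wpM2r ?nrm_ge0//.
  by rewrite (le_trans (ler_norm C))// lerDl.
pose N := vker V; have cN : csub N := csub_vker cV.
have adjust x y' : V (x, y') -> V (x - prj N x, y').
  move=> h; have := subspB sV h (prj_in cN x).
  by congr V; apply/pair_equal_spec; rewrite /= subr0.
have hK' x y' : V (x, y') -> nrm (x - prj N x) <= K * nrm y'.
  move=> h; have [x' h1 h2] := hK _ _ h.
  have : N (x - x').
    by have := subspB sV h h1; congr V; apply/pair_equal_spec; rewrite /= subrr.
  move=> Nd; rewrite (le_trans _ h2)// (_ : x - prj N x = x' - prj N x').
    exact: prjC_nrm.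
  have := prj_id cN Nd; rewrite (linB (prj_linear cN)) => e.
  by apply/eqP; rewrite -subr_eq0 subrACA e subrr.
have hu n : exists p : X * X, [/\ V p, orth N p.1 & nrm (y - p.2) <= n.+1%:R^-1].
  have e0 : 0 < (n.+1%:R^-1 : R) by rewrite invr_gt0.
  have [y' [x hx] hy'] := hy _ e0; exists (x - prj N x, y'); split=> //.
    exact: adjust.
  exact: prj_orthP.
have [u hu'] := choice hu.
have uB n m : nrm ((u m).1 - (u n).1) <= K * nrm ((u m).2 - (u n).2).
  have [Vn on _] := hu' n; have [Vm om _] := hu' m.
  have h : V ((u m).1 - (u n).1, (u m).2 - (u n).2) by exact: (subspB sV Vm Vn).
  have := hK' _ _ h; rewrite (prj_eq0 cN) ?subr0//.
  exact: subspB (csub_orth cN.1).1 _ _.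
have u2 n : nrm ((u n).2 - y) <= 1 / n.+1%:R.
  by rewrite nrmB div1r; case: (hu' n).
have [|l hl] := @hcomplete R X (fun n => (u n).1) (K * 2).
  move=> n m nm; rewrite (le_trans (uB _ _))// -mulrA ler_pM2l//.
  rewrite (le_trans (nrmT y _ _))// (_ : 2 = 1 + 1 :> R)// mulrDl lerD//.
    by rewrite (le_trans (u2 m))// ler_invS.
  by rewrite nrmB.
exists l; apply: cV.2 => e e0; have [n hn] := invS_small (K * 2 + 1) e0.
exists (u n); first by case: (hu' n).
rewrite nrmB (le_trans _ (ltW hn))// (le_trans (nrm_pair_le _))//.
by rewrite mulrDl lerD//; [exact: hl|exact: u2].
Qed.

Lemma orth_vcok V : fredX V -> orth (vcok V) = vran V.
Proof.
move=> fV; have sR := subsp_vran (fredX_csub fV).1.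
rewrite orth_hcl//; apply/seteqP; split; first exact: vran_closed.
exact: subset_hcl.
Qed.

(* The closed operator whose Moore-Penrose inverse is [l]. *)
Definition mpg l : set (X * X) :=
  [set p | orth (hker l) p.2 /\ hker (adj l) (p.1 - l p.2)].

(** [l y] is the preimage, orthogonal to the kernel, of the component of y in the closed range.
    Single-valuedness of V gives the kernel of l, density of its domain the kernel of the
    adjoint. *)
Lemma fredX_mpg V : fredX V -> exists2 l, bdd l &
  [/\ V = mpg l, hker l = vcok V & hker (adj l) = vker V].
Proof.
move=> fV; have [C hC] := fredX_bound fV; have cV := fredX_csub fV.
have sV := cV.1; pose N := vker V; have cN : csub N := csub_vker cV.
pose M := vcok V; have cM : csub M := csub_vcok cV.
have cMo := csub_orth cM.1; have cNo := csub_orth cN.1.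
have adjust x y : V (x, y) -> V (x - prj N x, y).
  move=> h; have := subspB sV h (prj_in cN x).
  by congr V; apply/pair_equal_spec; rewrite /= subr0.
have uniq x x' y : V (x, y) -> V (x', y) -> orth N x -> orth N x' -> x = x'.
  move=> h h' o o'; apply/eqP; rewrite -subr_eq0; apply/eqP/rip_eq0.
  have od : orth N (x - x') by exact: (subspB cNo.1).
  apply: od; have := subspB sV h h'.
  by congr V; apply/pair_equal_spec; rewrite /= subrr.
have /choice[l hl] : forall y, exists x, orth N x /\ V (x, y - prj M y).
  move=> y; have : vran V (y - prj M y) by rewrite -orth_vcok//; exact: prj_orthP.
  move=> [x hx]; exists (x - prj N x); split; last exact: adjust.
  exact: prj_orthP.
have lV x y : V (x, y) -> y - prj M y = y.
  move=> h; rewrite (prj_eq0 cM) ?subr0//.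
  by move=> z oz; rewrite ripC oz//; exists x.
have ll : linear l.
  move=> c y y'; have [oy1 h1] := hl y; have [oy2 h2] := hl y'.
  have [oy3 h3] := hl (c *: y + y'); apply: (uniq _ _ _ h3) => //.
    have [_ VD VZ] := sV; have := VD _ _ (VZ c _ h1) h2; congr V.
    apply/pair_equal_spec; split=> //=.
    by rewrite (prj_linear cM) scalerBr opprD addrACA.
  by have [_ OD OZ] := cNo.1; apply: OD => //; exact: OZ.
have bl : bdd l.
  split=> //; exists `|C| => y; have [oy1 h1] := hl y.
  have [x' h2 h3] := hC _ _ h1; have h4 := adjust _ _ h2.
  rewrite (uniq _ _ _ h1 h4)//; last exact: prj_orthP.
  rewrite (le_trans (prjC_nrm cN _))// (le_trans h3)//.
  rewrite (@le_trans _ _ (`|C| * nrm (y - prj M y)))//.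
    by rewrite ler_wpM2r ?nrm_ge0// ler_norm.
  by rewrite ler_wpM2l// prjC_nrm.
have kl : hker l = M.
  apply/seteqP; split=> y; rewrite /hker /=.
    move=> h; have [_] := hl y; rewrite h => /(fredX_fun fV)/eqP.
    by rewrite subr_eq0 => /eqP ->; exact: (prj_in cM).
  move=> My; have [oy1] := hl y; rewrite (prj_id cM My) subrr => Nl.
  exact/rip_eq0/oy1.
have rl x y : V (x, y) -> orth N x -> l y = x.
  move=> h o; have [oy1] := hl y; rewrite (lV _ _ h) => h1; exact: uniq h1 h oy1 o.
have kal : hker (adj l) = N.
  rewrite -orth_ker_adj//; apply/seteqP; split=> x; last first.
    by move=> Nx _ [y _ <-]; rewrite ripC; case: (hl y) => o _; exact: o.
  move=> ox; have : x - prj N x = 0.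
    apply: (orth0_dense (fredX_dense fV)) => d [y hd].
    have -> : d = prj N d + (d - prj N d) by rewrite addrC subrK.
    rewrite ripDr prj_orth ?add0r//; last exact: (prj_in cN).
    have ld := rl _ _ (adjust _ _ hd) (prj_orthP cN d).
    rewrite ripDl ripNl ox; last by exists y.
    by rewrite ripC prj_orth ?oppr0 ?addr0//; exact: (prj_in cN).
  by move/eqP; rewrite subr_eq0 => /eqP ->; exact: (prj_in cN).
exists l => //; split=> //; apply/seteqP; split=> -[x y]; rewrite /mpg kl kal /=.
  move=> h; split; first by move=> z oz; rewrite ripC oz//; exists x.
  have [_] := hl y; rewrite (lV _ _ h) => h1.
  by have := subspB sV h h1; congr V; apply/pair_equal_spec; rewrite /= subrr.
move=> [oy Nx]; have [_] := hl y; rewrite (prj_eq0 cM oy) subr0 => h1.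
have [_ VD _] := sV; have := VD _ _ Nx h1; congr V.
by apply/pair_equal_spec; rewrite /= subrK add0r.
Qed.

Lemma vker_mpg l : bdd l -> vker (mpg l) = hker (adj l).
Proof.
move=> bl; apply/seteqP; split=> x; rewrite /vker /mpg /=.
  by rewrite (lin0 bl.1) subr0 => -[].
by move=> h; split; [move=> z _; rewrite rip0l|rewrite (lin0 bl.1) subr0].
Qed.

Lemma orth_range_adj l x y : bdd l -> hker (adj l) x -> rip (l y) x = 0.
Proof. by move=> bl h; rewrite adjP// h rip0r. Qed.

Lemma mpg_in l y : bdd l -> orth (hker l) y -> mpg l (l y, y).
Proof. by move=> bl oy; split=> //=; rewrite subrr; exact: (lin0 (adj_bdd bl).1). Qed.

Lemma vcok_mpg l : bdd l -> vcok (mpg l) = hker l.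
Proof.
move=> bl; have cM := csub_ker bl; rewrite -(orth_orth cM); congr orth.
apply/seteqP; split=> y; first by move=> [x []].
by move=> oy; exists (l y); exact: mpg_in.
Qed.

(** The domain of [mpg l] is the range of l, closed or not, plus the kernel of its adjoint, hence
    dense. The bound on preimages is the bound of l, so a range of l that is not closed is exactly
    what produces an unbounded operator. *)
Lemma mpg_fredX l : bdd l -> (exists n, odim (hker l) n) ->
  (exists n, odim (hker (adj l)) n) -> fredX (mpg l).
Proof.
move=> bl oM oN; have cM := csub_ker bl; have cN := csub_ker (adj_bdd bl).
have cMo := csub_orth cM.1.
have bP1 := csub_preim bdd_snd cMo.
have bP2 : csub [set p : X * X | hker (adj l) (p.1 - l p.2)].
  apply: (csub_preim _ cN); apply: (bdd_sub bdd_fst).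
  exact: (bdd_comp bl bdd_snd).
have [K hK] := bl.2.
split=> //; first exact: (csubI bP1 bP2).
- move=> y [/= oy]; rewrite sub0r => h.
  have h1 : l y = 0.
    apply: rip_eq0; apply: orth_range_adj => //.
    by rewrite -[l y]opprK; exact: (subspN cN.1).
  exact/rip_eq0/oy.
- have sd : subsp (vdom (mpg l)) by apply: subsp_vdom; exact: (csubI bP1 bP2).1.
  apply: dense_orth0 => // x ox.
  have Nx : hker (adj l) x.
    rewrite -orth_ker_adj// => _ [y _ <-].
    have -> : l y = l (y - prj (hker l) y).
      by rewrite (linB bl.1) (prj_in cM y : l _ = 0) subr0.
    apply: ox; exists (y - prj (hker l) y); apply: mpg_in => //; exact: prj_orthP.
  apply/rip_eq0/ox; exists 0; split=> /=; first by move=> z _; rewrite rip0l.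
  by rewrite (lin0 bl.1) subr0.
- by rewrite vker_mpg.
- by rewrite vcok_mpg.
- by exists K => x y [/= oy _]; exists (l y); [exact: mpg_in|exact: hK].
Qed.

(** The horizontal subspace: the kernel of V is V [&] U, and its cokernel is the intersection of the
    complements. *)
Let U : set (X * X) := [set p | p.2 = 0].

Let cU : csub U. Proof. exact: (csub_preim bdd_snd (csub0 X)). Qed.

Let orthU : orth U = [set p | p.1 = 0].
Proof.
apply/seteqP; split=> p hp.
  by apply: rip_eq0; have := hp (p.1, 0) erefl; rewrite rip_pair /= rip0r addr0.
by move=> q hq; rewrite rip_pair hp hq rip0l rip0r addr0.
Qed.

Let odimVU V n : csub V -> odim (vker V) n -> odim (V `&` U) n.
Proof.
move=> cV oN; apply: (odim_iso (T := fun p : X * X => p.1)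
    (S := fun x => (x, 0)) _ oN) => //.
- exact: (csubI cV cU).1.
- exact: linear_inl.
- by move=> [x y] [h]; rewrite /U /= => y0; rewrite y0 in h.
- by move=> [x y] [h]; rewrite /U /= => -> ->.
- by move=> x _ [].
Qed.

Let odimVUo V m : csub V -> odim (vcok V) m -> odim (orth V `&` orth U) m.
Proof.
move=> cV oM; rewrite orthU; apply: (odim_iso (T := fun p : X * X => p.2)
    (S := fun x => (0, x)) _ oM) => //.
- by rewrite -orthU; exact: (csubI (csub_orth cV.1) (csub_orth cU.1)).1.
- exact: linear_inr.
- move=> [x y] [oV /= x0] z [w hw]; have := oV _ hw.
  by rewrite rip_pair /= x0 rip0l add0r.
- by move=> [x y] [_ /= -> ->].
- move=> y oy; split=> // -[x z] hV; rewrite rip_pair /= rip0l add0r.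
  by apply: oy; exists x.
- by move=> x _ [].
Qed.

(** [pair_index_le] gives one inequality for V and U, and the opposite one for their complements,
    where kernel and cokernel change places. *)
Theorem index_locally_constant V n m : fredX V ->
  odim (vker V) n -> odim (vcok V) m ->
  exists2 d, 0 < d & forall V' n' m', fredX V' -> pgap V V' d ->
    odim (vker V') n' -> odim (vcok V') m' -> (n + m' = n' + m)%N.
Proof.
move=> fV oN oM; have cV := fredX_csub fV.
have [l bl [VE kl kal]] := fredX_mpg fV.
have [K K0 hK] := bdd_pos bl.
have [K' K'0 hK'] := bdd_pos (adj_bdd bl).
(* Lower bound for projections in both applications: z = (0, y) is tested against (l y, y) in V, and
   z = (x, 0) against (x, - adj l x) in the complement of V. The norms of these vectors are at most
   (1 + K) |z| and (1 + K') |z|. *)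
pose c := (1 + K + K')^-1; have c0 : 0 < c by rewrite invr_gt0; lra.
have key (x y : X) (S : set (X * X)) (v z : X * X) : csub S -> S v ->
    nrm z ^+ 2 = rip z v -> nrm v <= (1 + K + K') * nrm z ->
    c * nrm z <= nrm (prj S z).
  move=> cS Sv h1 h2.
  have [->|z0] := eqVneq z 0; first by rewrite nrm0 mulr0 nrm_ge0.
  have nz := nrm_gt0 z0; rewrite mulrC ler_pdivrMr; last lra.
  rewrite -(ler_pM2r nz) -expr2 h1.
  have -> : rip z v = rip (prj S z) v by rewrite prj_sa// prj_id.
  by rewrite (le_trans (rip_le _ _))// -mulrA ler_wpM2l ?nrm_ge0.
pose d := Num.min (c / 2) ((2 * (1 + 2 / c))^-1).
have h2c : 0 < 1 + 2 / c by rewrite ltr_wpDl// divr_gt0.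
have d0 : 0 < d by rewrite lt_min divr_gt0//= invr_gt0 mulr_gt0.
have d1 : d <= c / 2 by rewrite ge_min lexx.
have d2 : d * (1 + 2 / c) <= 1 / 2.
  have : d <= (2 * (1 + 2 / c))^-1 by rewrite ge_min lexx orbT.
  by rewrite invfM -ler_pdivlMr// div1r.
exists d => // V' n' m' fV' hd oN' oM'; have cV' := fredX_csub fV'.
have cVo := csub_orth cV.1; have cV'o := csub_orth cV'.1.
have cUo := csub_orth cU.1.
apply/eqP; rewrite eqn_leq; apply/andP; split.
  apply: (pair_index_le cV cV' cU c0 (ltW d0) d1 d2 _ hd).
  - rewrite orthU => -[x y] /= -> oy.
    have oy' : orth (hker l) y.
      move=> z; rewrite kl => oz; have := oy (0, z).
      rewrite rip_pair /= rip0l add0r; apply; split=> // -[a b] hab.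
      by rewrite rip_pair /= rip0l add0r; apply: oz; exists a.
    apply: (key 0 0 _ (l y, y)) => //; first by rewrite VE; exact: mpg_in.
      by rewrite nrm_sqr !rip_pair /= !rip0l.
    rewrite (le_trans (nrm_pair_le _))//= nrm_pair0l.
    by have := hK y; have := mulr_ge0 (ltW K'0) (nrm_ge0 y); nra.
  - exact: odimVU.
  - exact: odimVUo.
  - exact: odimVU.
  - exact: odimVUo.
have hd' := pgap_orth cV cV' hd.
rewrite addnC [leqRHS]addnC.
apply: (pair_index_le cVo cV'o cUo c0 (ltW d0) d1 d2 _ hd').
- rewrite (orth_orth cU) => -[x y]; rewrite {1}/U /= => -> ox.
  have ox' : orth (hker (adj l)) x.
    move=> z; rewrite kal => Nz; have := ox (z, 0).
    rewrite rip_pair /= rip0l addr0; apply; split=> //.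
    by rewrite (orth_orth cV).
  have Vo : orth V (x, - adj l x).
    move=> [a b]; rewrite VE => -[/= ob Na].
    rewrite rip_pair /= ripNl [rip (adj l x) b]ripC -(adjP b x bl).
    have := ox' _ Na; rewrite ripDr ripNr (ripC x (l b)) => /eqP.
    by rewrite subr_eq0 => /eqP ->; rewrite subrr.
  apply: (key 0 0 _ (x, - adj l x)) => //.
    by rewrite nrm_sqr !rip_pair /= !rip0l.
  rewrite (le_trans (nrm_pair_le _))//= nrm_pair0r nrmN.
  by have := hK' x; have := mulr_ge0 (ltW K0) (nrm_ge0 x); nra.
- exact: odimVUo.
- by rewrite (orth_orth cV) (orth_orth cU); exact: odimVU.
- exact: odimVUo.
- by rewrite (orth_orth cV') (orth_orth cU); exact: odimVU.
Qed.
End FredholmRelations.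

(** * Square roots, unitaries and polar decomposition *)

Section Limits.
Context (R : realType) (V : hspaceType R).
Implicit Types (u : nat -> V) (K : R).

Lemma lim_uniq u x y K K' : (forall n, nrm (u n - x) <= K / n.+1%:R) ->
  (forall n, nrm (u n - y) <= K' / n.+1%:R) -> x = y.
Proof.
move=> hx hy; apply/eqP; rewrite -subr_eq0; apply/eqP/nrm_small => e e0.
apply: (@limS_le _ (K + K')) => n.
rewrite (le_trans (nrmT (u n) _ _))// mulrDl -[leLHS]add0r lerD// ?(ltW e0)//.
by rewrite nrmB lerD.
Qed.
End Limits.

Section SquareRoot.
Context (R : realType) (V : hspaceType R).
Implicit Types (S T A : V -> V).

Definition selfadj T := forall x y, rip (T x) y = rip x (T y).
Definition posop T := forall x, 0 <= rip (T x) x.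

Lemma selfadj_adj T : bdd T -> selfadj T -> adj T = T.
Proof. by move=> bT sT; exact: adj_uniq. Qed.

Lemma selfadj_contraction T : linear T -> selfadj T -> posop T ->
  (forall x, rip (T x) x <= rip x x) -> bnd T 1.
Proof.
move=> lT sT pT hT x; rewrite mul1r nrm_le ?nrm_ge0// nrm_sqr.
have := pT (x - T x); rewrite (linB lT) !ripE.
have := hT (T x); have := hT x; rewrite (sT (T x) x).
by lra.
Qed.

Section Iteration.
Variable B : V -> V.
Hypotheses (bB : bdd B) (sB : selfadj B) (nB : bnd B 1).

Let h2 : R[i] := (2^-1 : R)%:C.

(** The recursion Y' = (B + Y^2) / 2 from Y = 0. Its limit solves L^2 = 2 L - B, so that (1 - L)^2 =
    1 - B. *)
Fixpoint sqit n (z : V) : V :=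
  if n is k.+1 then h2 *: (B z + sqit k (sqit k z)) else 0.

(** The same recursion for the scalar B = 1: it majorises the norms of [sqit] and of its
    increments. *)
Fixpoint sqq n : R := if n is k.+1 then (1 + sqq k ^+ 2) / 2 else 0.

(** The deficit r = 1 - [sqq n] obeys r' = r - r^2 / 2, which is increasing in r on [0, 1] and keeps
    r below 2 / (n + 2). This is where the rate of convergence comes from. *)
Let sqq_bound n : 0 <= sqq n <= 1 /\ 1 - sqq n <= 2 / n.+2%:R.
Proof.
elim: n => [|n [/andP[q0 q1] q2]] /=.
  by rewrite lexx ler01 subr0 divff ?pnatr_eq0.
split; first by apply/andP; split; nra.
set q := sqq n in q0 q1 q2 *; pose D : R := 2 / n.+2%:R.
have n2 : (n.+2%:R : R) = n%:R + 2 by rewrite -addn2 natrD.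
have n3 : (n.+3%:R : R) = n%:R + 3 by rewrite -addn3 natrD.
have n0 : 0 <= n%:R :> R by [].
rewrite -/D in q2.
have D1 : D <= 1 by rewrite /D n2 ler_pdivrMr; lra.
have h1 : 1 - (1 + q ^+ 2) / 2 <= D - D ^+ 2 / 2.
  have : 0 <= (D - (1 - q)) * (1 - (D + (1 - q)) / 2) by rewrite mulr_ge0//; lra.
  by lra.
apply: (le_trans h1); rewrite /D n2 n3 -subr_ge0.
have -> : 2 / (n%:R + 3) - (2 / (n%:R + 2) - (2 / (n%:R + 2)) ^+ 2 / 2) =
   2 / ((n%:R + 3) * (n%:R + 2) ^+ 2) :> R.
  by field; rewrite !gt_eqF//; lra.
by rewrite divr_ge0// mulr_ge0 ?sqr_ge0//; lra.
Qed.

Let h2half : cabs h2 = 1 / 2.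
Proof. by rewrite cabsR ger0_norm ?invr_ge0// div1r. Qed.

Let sqit_bdd n : bdd (sqit n).
Proof.
elim: n => [|n IH] /=; first by split=> [c x y|]; [rewrite scaler0 addr0|exists 0 => x; rewrite nrm0 mul0r].
apply: bdd_scale; apply: bdd_add => //; exact: bdd_comp.
Qed.

Let sqit_sa n : selfadj (sqit n).
Proof.
elim: n => [|n IH] x y /=; first by rewrite rip0l rip0r.
by rewrite !ripE sB !IH.
Qed.

Let sqit_bnd n : bnd (sqit n) (sqq n).
Proof.
elim: n => [|n IH] x /=; first by rewrite nrm0 mul0r.
have [/andP[q0 _] _] := sqq_bound n.
rewrite nrmZ h2half [leRHS](_ : _ = 1 / 2 * ((1 + sqq n ^+ 2) * nrm x)); last by field.
rewrite ler_wpM2l ?divr_ge0//.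
rewrite mulrDl (le_trans (nrmD _ _))// lerD ?nB//.
by rewrite (le_trans (IH _))// expr2 -mulrA ler_wpM2l.
Qed.

(** Y'^2 - Y^2 = Y' (Y' - Y) + (Y' - Y) Y is bounded by (q' - q) (q' + q), which is the
    corresponding difference of squares for the scalar recursion. *)
Let sqit_step n : bnd (fun x => sqit n.+1 x - sqit n x) (sqq n.+1 - sqq n) /\
  sqq n <= sqq n.+1.
Proof.
elim: n => [|n [IH IHq]].
  split; last by rewrite /= expr0n addr0 divr_ge0.
  move=> x /=; rewrite !subr0 addr0 nrmZ h2half expr0n addr0.
  by rewrite ler_wpM2l ?divr_ge0//; have := nB x; rewrite mul1r.
have [/andP[q0 q1] _] := sqq_bound n; have [/andP[q0' q1'] _] := sqq_bound n.+1.
split; last first.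
  rewrite /= ler_pM2r ?invr_gt0// lerD2l -/(sqq n.+1).
  by rewrite ler_pXn2r ?nnegrE.
move=> x; set Y := sqit n; set Y' := sqit n.+1.
have -> : sqit n.+2 x - sqit n.+1 x =
    h2 *: (Y' (Y' x - Y x) + (Y' (Y x) - Y (Y x))).
  have lY : Y' (Y' x - Y x) = Y' (Y' x) - Y' (Y x) by exact: (linB (sqit_bdd n.+1).1).
  rewrite lY addrA subrK scalerBr.
  have -> : sqit n.+2 x = h2 *: B x + h2 *: Y' (Y' x) by rewrite -scalerDr.
  have -> : sqit n.+1 x = h2 *: B x + h2 *: Y (Y x) by rewrite -scalerDr.
  by rewrite opprD addrACA subrr add0r.
rewrite nrmZ h2half (_ : sqq n.+2 - sqq n.+1 =
  1 / 2 * ((sqq n.+1 - sqq n) * (sqq n.+1 + sqq n))); last first.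
  by rewrite [sqq n.+2]/= -/(sqq n.+1) [X in _ - X = _]/= ; field.
rewrite -[leRHS]mulrA ler_wpM2l ?divr_ge0//.
set q' := sqq n.+1 in IH IHq q0' q1' *; set q := sqq n in IH IHq q0 q1 *.
have -> : (q' - q) * (q' + q) * nrm x = q' * ((q' - q) * nrm x) + (q' - q) * (q * nrm x).
  by ring.
rewrite (le_trans (nrmD _ _))// lerD//.
  by rewrite (le_trans (sqit_bnd n.+1 _))// ler_wpM2l//; exact: IH.
by rewrite (le_trans (IH _))// ler_wpM2l ?subr_ge0//; exact: sqit_bnd.
Qed.

Let sqit_cauchy n m : (n <= m)%N -> bnd (fun x => sqit m x - sqit n x) (sqq m - sqq n).
Proof.
move=> /subnKC <-; elim: (m - n)%N => [|k IH] x.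
  by rewrite addn0 !subrr nrm0 mul0r.
rewrite addnS (le_trans (nrmT (sqit (n + k) x) _ _))//.
have -> : sqq (n + k).+1 - sqq n = (sqq (n + k).+1 - sqq (n + k)) + (sqq (n + k) - sqq n).
  by rewrite addrA subrK.
by rewrite mulrDl lerD//; case: (sqit_step (n + k)).
Qed.

Lemma sqit_limit : exists L : V -> V,
  forall n z, nrm (sqit n z - L z) <= 2 * nrm z / n.+1%:R.
Proof.
have /choice[L hL] : forall z, exists l, forall n,
    nrm (sqit n z - l) <= 2 * nrm z / n.+1%:R.
  move=> z; apply: hcomplete => n m nm; rewrite (le_trans (sqit_cauchy nm z))//.
  rewrite mulrAC ler_wpM2r ?nrm_ge0//.
  have [/andP[_ q1] _] := sqq_bound m; have [_ q2] := sqq_bound n.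
  rewrite (@le_trans _ _ (1 - sqq n)) ?lerD2r// (le_trans q2)//.
  by rewrite ler_wpM2l// lef_pV2 ?posrE// ler_nat.
by exists L => n z; exact: hL.
Qed.

Lemma sqit_fixpoint : exists L : V -> V, [/\ bdd L, selfadj L, bnd L 1,
  forall z, L (L z) = (2 : R)%:C *: L z - B z &
  forall T, bdd T -> (forall x, T (B x) = B (T x)) -> forall x, T (L x) = L (T x)].
Proof.
have [L hL] := sqit_limit; exists L.
have bL : bnd L 1.
  move=> z; apply: (@limS_le _ (2 * nrm z)) => n.
  have -> : L z = sqit n z - (sqit n z - L z) by rewrite opprB addrC subrK.
  rewrite (le_trans (nrmDB _ _))// lerD// (le_trans (sqit_bnd n z))//.
  by rewrite ler_wpM2r ?nrm_ge0//; have [/andP[]] := sqq_bound n.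
have lL : linear L.
  move=> c x y; apply: (lim_uniq (u := fun n => sqit n (c *: x + y))
    (K' := cabs c * (2 * nrm x) + 2 * nrm y) (fun n => hL n _)) => n.
  rewrite (sqit_bdd n).1 opprD addrACA -scalerBr.
  rewrite (le_trans (nrmD _ _))// nrmZ mulrDl lerD ?hL//.
  by rewrite -mulrA ler_wpM2l ?cabs_ge0 ?hL.
have rL n x y : `|rip (sqit n x - L x) y| <= 2 * nrm x * nrm y / n.+1%:R.
  by rewrite (le_trans (rip_abs _ _))// mulrAC ler_wpM2r ?nrm_ge0.
split=> //; first by split=> //; exists 1.
- move=> x y; apply/eqP; rewrite -subr_eq0 -normr_le0.
  apply: (@limS_le _ (2 * nrm x * nrm y + 2 * nrm y * nrm x)) => n.
  have -> : rip (L x) y - rip x (L y) =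
      rip (sqit n y - L y) x - rip (sqit n x - L x) y.
    rewrite !ripDl !ripNl (sqit_sa n y x) [rip y _]ripC [rip (L y) x]ripC.
    by ring.
  by rewrite add0r mulrDl (le_trans (ler_normB _ _))// addrC lerD.
(* Both sides are limits of Y_n (Y_n z), which by the recursion equals 2 Y_(n+1) z - B z. *)
- move=> z; apply: (lim_uniq (u := fun n => sqit n (sqit n z))
    (K := 2 * nrm z + 2 * nrm (L z)) (K' := 2 * (2 * nrm z) + 2 * nrm (B z))) => n.
    rewrite (le_trans (nrmT (sqit n (L z)) _ _))// mulrDl lerD//.
    rewrite -(linB (sqit_bdd n).1) (le_trans (sqit_bnd n _))//.
    rewrite -[leRHS]mul1r ler_pM ?nrm_ge0//; by have [/andP[]] := sqq_bound n.
  have -> : sqit n (sqit n z) = (2 : R)%:C *: sqit n.+1 z - B z.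
    by rewrite /= scaleRA divff ?pnatr_eq0// scaleR1 addrC addrA addNr add0r.
  have -> : (2 : R)%:C *: sqit n.+1 z - B z - ((2 : R)%:C *: L z - B z) =
      (2 : R)%:C *: (sqit n.+1 z - L z) by rewrite opprB addrA subrK scalerBr.
  rewrite nrmZ cabsR ger0_norm// [leRHS]mulrDl -[leLHS]addr0 lerD ?divr_ge0 ?mulr_ge0 ?nrm_ge0//.
  rewrite -mulrA ler_wpM2l// (le_trans (hL _ _))// ler_invS ?mulr_ge0 ?nrm_ge0//.
- move=> T bT TB x; have [K K0 hK] := bdd_pos bT.
  have TY n : T (sqit n x) = sqit n (T x).
    elim: n x => [|n IH] x /=; first exact: (lin0 bT.1).
    by rewrite (linZ bT.1) (linD bT.1) TB !IH.
  apply: (lim_uniq (u := fun n => sqit n (T x)) (K := K * (2 * nrm x))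
    (K' := 2 * nrm (T x))) => n; last exact: hL.
  by rewrite -TY -(linB bT.1) (le_trans (hK _))// -mulrA ler_pM2l.
Qed.
End Iteration.

(** With K a bound of A, the operator B = 1 - A / K is a contraction, and S is the square root of K
    times 1 - L for the fixed point L of the iteration. The root commutes with all that commutes
    with A, since each iterate does. *)
Lemma sqrt_exists A : bdd A -> selfadj A -> posop A -> exists S,
  [/\ bdd S, selfadj S, posop S, forall x, S (S x) = A x &
  forall T, bdd T -> (forall x, T (A x) = A (T x)) -> forall x, T (S x) = S (T x)].
Proof.
move=> bA sA pA; have [K K0 hK] := bdd_pos bA.
pose B x := x - (K^-1)%:C *: A x.
have bB : bdd B by apply: bdd_sub; [exact: bdd_id|exact: bdd_scale].
have sB : selfadj B by move=> x y; rewrite !ripE sA.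
have pB : posop B.
  move=> x; rewrite ripDl ripNl ripZl subr_ge0 mulrC ler_pdivrMr//.
  rewrite (le_trans (rip_le _ _))// -nrm_sqr.
  have -> : nrm x ^+ 2 * K = K * nrm x * nrm x by ring.
  by rewrite ler_wpM2r ?nrm_ge0.
have nB : bnd B 1.
  apply: selfadj_contraction => //; first exact: bB.1.
  move=> x; rewrite ripDl ripNl ripZl lerBlDr lerDl mulr_ge0 ?pA//.
  by rewrite invr_ge0 ltW.
have [L [bL sL nL LL cL]] := sqit_fixpoint bB sB nB.
pose k := Num.sqrt K; pose S x := k%:C *: (x - L x).
have kk : k * k = K by rewrite -expr2 sqr_sqrtr ?ltW.
exists S; split.
- by apply: bdd_scale; apply: bdd_sub => //; exact: bdd_id.
- by move=> x y; rewrite !ripE sL.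
- move=> x; rewrite ripZl mulr_ge0 ?sqrtr_ge0// ripDl ripNl subr_ge0.
  rewrite (le_trans (rip_le _ _))// -nrm_sqr expr2 ler_wpM2r ?nrm_ge0//.
  by have := nL x; rewrite mul1r.
- move=> x; rewrite /S (linZ bL.1) -scalerBr scaleRA kk.
  rewrite (linB bL.1) LL.
  have -> : x - L x - (L x - ((2 : R)%:C *: L x - B x)) = (K^-1)%:C *: A x.
    have -> : (2 : R)%:C *: L x = L x + L x.
      by rewrite rmorphD/= rmorph1 scalerDl scale1r.
    have -> : L x - (L x + L x - B x) = B x - L x.
      by rewrite opprB addrCA opprD addNKr.
    by rewrite opprB addrA subrK /B opprB addrC subrK.
  by rewrite scaleRA divff ?gt_eqF// scaleR1.
- move=> T bT TA x; rewrite /S (linZ bT.1) (linB bT.1) cL// => y.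
  by rewrite /B (linB bT.1) (linZ bT.1) TA.
Qed.
End SquareRoot.

(** * Joining unitaries to the identity *)

Section UnitaryPaths.
Context (R : realType) (V : hspaceType R).
Implicit Types (w : V -> V).

(** Invertibility as a lower bound for the operator and its adjoint with one constant: a form that
    is checked pointwise along segments and is symmetric under adjoints. *)
Definition invop w := bdd w /\ exists2 c : R, 0 < c &
  (forall x, c * nrm x <= nrm (w x)) /\ (forall x, c * nrm x <= nrm (adj w x)).

Definition cvx (W : hspaceType R) (S T : V -> W) (a : R) (x : V) : W :=
  (1 - a)%:C *: S x + a%:C *: T x.

Lemma bdd_cvx (W : hspaceType R) (S T : V -> W) a : bdd S -> bdd T -> bdd (cvx S T a).
Proof. by move=> bS bT; apply: bdd_add; exact: bdd_scale. Qed.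

Definition unitary w := [/\ bdd w, forall x, adj w (w x) = x & forall x, w (adj w x) = x].

Definition iseg w w' := [/\ bdd w, bdd w' &
  forall a : R, 0 <= a <= 1 -> invop (cvx w w' a)].

Definition dgop (M : set V) (z : R[i]) (x : V) := prj M x + z *: (x - prj M x).

Section Dgop.
Variables (M : set V) (cM : csub M).

Lemma bdd_dgop z : bdd (dgop M z).
Proof.
apply: bdd_add; first exact: bdd_prj.
by apply: bdd_scale; exact: bdd_prjC.
Qed.

Lemma adj_dgop z : adj (dgop M z) = dgop M (conjc z).
Proof.
rewrite adj_add ?adj_scale; [|exact: bdd_prjC|exact: bdd_prj|by apply: bdd_scale; exact: bdd_prjC].
apply/funext => x; congr (_ + _ *: _).
  by rewrite (selfadj_adj (bdd_prj cM))//; move=> a b; exact: prj_sa.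
rewrite (selfadj_adj (bdd_prjC cM))// => a b.
by rewrite ripDl ripNl ripDr ripNr prj_sa.
Qed.

Lemma dgop_nrm z x :
  nrm (dgop M z x) ^+ 2 = nrm (prj M x) ^+ 2 + cabs z ^+ 2 * nrm (x - prj M x) ^+ 2.
Proof.
rewrite {1}/dgop pyth; first by rewrite nrmZ exprMn.
rewrite ripC; have [_ _ h] := (csub_orth cM.1).1.
by apply: (h z _ (prj_orthP cM x)); exact: prj_in.
Qed.

Lemma invop_dgop z : 0 < cabs z -> invop (dgop M z).
Proof.
move=> z0; split; first exact: bdd_dgop.
have key y : cabs y = cabs z ->
    forall x, Num.min 1 (cabs z) * nrm x <= nrm (dgop M y x).
  move=> yz x; set c := Num.min _ _.
  have c0 : 0 < c by rewrite lt_min ltr01.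
  have c1 : c <= 1 by rewrite ge_min lexx.
  have c2 : c <= cabs z by rewrite ge_min lexx orbT.
  rewrite -(ler_pXn2r (n := 2)) ?nnegrE ?nrm_ge0 ?mulr_ge0 ?nrm_ge0 ?(ltW c0)//.
  rewrite dgop_nrm exprMn (prj_pyth cM x) mulrDr yz lerD//.
    by rewrite ler_piMl ?sqr_ge0// expr_le1// ltW.
  by rewrite ler_wpM2r ?sqr_ge0// ler_pXn2r ?nnegrE ?(ltW c0) ?(ltW z0).
exists (Num.min 1 (cabs z)); first by rewrite lt_min ltr01.
split; first exact: key.
rewrite adj_dgop; apply: key; rewrite /cabs !normc_def.
by case: (z) => u v /=; rewrite sqrrN.
Qed.

Lemma iseg_dgop (z z' : R[i]) : (forall a : R, 0 <= a <= 1 ->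
    0 < cabs ((1 - a)%:C * z + a%:C * z')) -> iseg (dgop M z) (dgop M z').
Proof.
move=> h; split; [exact: bdd_dgop|exact: bdd_dgop|].
move=> a ha; have := invop_dgop (h a ha); congr invop.
have e (p r : V) : p + ((1 - a)%:C * z + a%:C * z') *: r =
    (1 - a)%:C *: (p + z *: r) + a%:C *: (p + z' *: r).
  rewrite !scalerDr addrACA -scalerDl -rmorphD/= subrK rmorph1 scale1r.
  by rewrite !scalerA -scalerDl.
by apply/funext => x; exact: e.
Qed.
End Dgop.

(* [|c|-c] with [c] the real part of [w] splits the space into the parts where
   [c >= 0] and [c <= 0]; there [w] is joined to [1] and [-1] by segments. *)
Lemma unitary_path w : unitary w -> exists w1 w2,
  [/\ iseg w w1, iseg w1 w2 & iseg w2 idfun].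
Proof.
move=> [bw ww ww']; have baw := adj_bdd bw.
pose c x := (2^-1 : R)%:C *: (w x + adj w x).
have bc : bdd c by apply: bdd_scale; exact: bdd_add.
have awE x y : rip (adj w x) y = rip x (w y) by rewrite adjP// adjK.
have sc : selfadj c.
  by move=> x y; rewrite !ripE adjP// awE [rip x _ + _]addrC.
have cx x : rip (c x) x = rip (w x) x.
  by rewrite !ripE awE (ripC x); lra.
have wc x : w (c x) = c (w x).
  by rewrite /c (linZ bw.1) (linD bw.1) ww ww'.
have awc x : adj w (c x) = c (adj w x).
  by rewrite /c (linZ baw.1) (linD baw.1) ww ww'.
have bcc : bdd (fun x => c (c x)) by exact: bdd_comp.
have [||a [ba sa pa aa ca]] := sqrt_exists bcc.
(* The root a = |c| commutes with w and its adjoint because its square does; hence the kernel M of a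
   - c and its complement are invariant under both. *)
- by move=> x y; rewrite !sc.
- by move=> x; rewrite sc rip_ge0.
pose q x := a x - c x; have bq : bdd q by exact: bdd_sub.
have wq x : w (q x) = q (w x).
  by rewrite /q (linB bw.1) wc ca// => y; rewrite !wc.
have awq x : adj w (q x) = q (adj w x).
  by rewrite /q (linB baw.1) awc ca// => y; rewrite !awc.
have acc x : c (a x) = a (c x) by apply: ca.
pose M := hker q; have cM : csub M := csub_ker bq.
have Mw x : M x -> M (w x) by rewrite /M /hker /= -wq => ->; exact: (lin0 bw.1).
have Maw x : M x -> M (adj w x).
  by rewrite /M /hker /= -awq => ->; exact: (lin0 baw.1).
have oMw x : orth M x -> orth M (w x).
  by move=> ox m Mm; rewrite adjP// ox//; exact: Maw.
have oMaw x : orth M x -> orth M (adj w x).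
  by move=> ox m Mm; rewrite awE ox//; exact: Mw.
have posM x : M x -> 0 <= rip (w x) x.
  move=> /eqP; rewrite /q subr_eq0 => /eqP h; rewrite -cx -h; exact: pa.
(* (a - c)(a + c) = 0 puts the range of the selfadjoint a + c inside M, so a + c vanishes on the
   complement of M. *)
have negM x : orth M x -> rip (w x) x <= 0.
  move=> ox; have h : a x + c x = 0.
    apply: rip_ext => y; rewrite rip0l ripDl sa sc -ripDr; apply: ox.
    rewrite /M /hker /q /= (linD ba.1) (linD bc.1) aa acc.
    by rewrite [X in X - _]addrC subrr.
  move/eqP: h; rewrite addrC addr_eq0 -cx => /eqP ->.
  by rewrite ripNl oppr_le0; exact: pa.
pose J := dgop M (-1).
have bJ : bdd J by exact: bdd_dgop.
have J_nrm x : nrm (J x) = nrm x.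
  apply/eqP; rewrite -(eqrXn2 (n := 2)) ?nrm_ge0// dgop_nrm// cabsN.
  by rewrite cabsR normr1 expr1n mul1r -prj_pyth.
have J_pos v x : linear v -> (forall x, M x -> M (v x)) ->
    (forall x, orth M x -> orth M (v x)) ->
    (forall x, rip (v x) x = rip (w x) x) -> 0 <= rip (v x) (J x).
  move=> lv vM vo vw; have Mx := prj_in cM x; have ox := prj_orthP cM x.
  have -> : v x = v (prj M x) + v (x - prj M x).
    by rewrite -(linD lv) addrC subrK.
  rewrite /J /dgop scaleN1r ripDl !ripDr !ripNr.
  rewrite (ripC (v (prj M x)) (x - _)) (ox _ (vM _ Mx)) (vo _ ox _ Mx).
  by rewrite oppr0 addr0 add0r !vw subr_ge0 (le_trans (negM _ ox))// posM.
have key v a' x : bdd v -> (forall x, nrm (v x) = nrm x) ->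
    (forall x, 0 <= rip (v x) (J x)) -> 0 <= a' <= 1 ->
    (if a' == 0 then 1 else a') * nrm x <= nrm (cvx v J a' x).
  move=> bv nv pv /andP[a0 a1]; have [->|an0] := eqVneq a' 0.
    by rewrite /cvx subr0 rmorph1 scale1r scale0r addr0 nv mul1r.
  have [->|x0] := eqVneq x 0.
    by rewrite nrm0 mulr0 nrm_ge0.
  rewrite -(ler_pM2r (nrm_gt0 x0)) -[X in _ <= _ * X]J_nrm.
  rewrite (le_trans _ (rip_le _ _))// /cvx ripDl !ripZl -nrm_sqr J_nrm.
  by rewrite -mulrA -expr2 lerDr mulr_ge0// subr_ge0.
have nw x : nrm (w x) = nrm x by rewrite /nrm adjP// ww.
have naw x : nrm (adj w x) = nrm x by rewrite /nrm awE ww'.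
have pw x : 0 <= rip (w x) (J x) by apply: J_pos => //; exact: bw.1.
have paw x : 0 <= rip (adj w x) (J x).
  by apply: J_pos => //; [exact: baw.1|move=> y; rewrite awE ripC].
(* The direct segment from -1 to 1 passes through 0; the detour through 'i avoids it. *)
exists J, (dgop M 'i); split.
- split=> // t ht; split; first exact: bdd_cvx.
  exists (if t == 0 then 1 else t).
    by case: eqVneq => // t0; rewrite lt0r t0; case/andP: ht.
  split=> x; first exact: key.
  have -> : adj (cvx w J t) = cvx (adj w) J t; last exact: key.
  rewrite adj_add ?adj_scale//; [|exact: bdd_scale|exact: bdd_scale].
  apply/funext => y; rewrite !conjc_real adj_dgop//.
  have -> : conjc (-1) = -1 :> R[i] by rewrite rmorphN rmorph1.
  by [].
- apply: iseg_dgop => // t /andP[t0 t1].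
  rewrite -[X in X < _]sqrtr0.
  rewrite -(ltr_pXn2r (n := 2)) ?nnegrE ?cabs_ge0 ?sqrtr0// expr0n/=.
  rewrite cabs_sqr /= !(mul0r, mulr0, mulr1, mulrN1, subr0, add0r, addr0, oppr0).
  by nra.
have -> : idfun = dgop M 1.
  by apply/funext => x; rewrite /dgop scale1r addrC subrK.
apply: iseg_dgop => // t /andP[t0 t1].
rewrite -(ltr_pXn2r (n := 2)) ?nnegrE ?cabs_ge0// expr0n/=.
rewrite cabs_sqr /= !(mul0r, mulr0, mulr1, mulrN1, subr0, add0r, addr0, oppr0).
by nra.
Qed.
End UnitaryPaths.

(** * Polar decomposition *)

Section Polar.
Context (R : realType) (X : hspaceType R).
Implicit Types (l v T : X -> X).

Lemma selfadj_form0 T : linear T -> selfadj T -> (forall x, rip (T x) x = 0) ->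
  forall x, T x = 0.
Proof.
move=> lT sT h x; apply: rip_ext => y; rewrite rip0l.
have := h (x + y); rewrite (linD lT) !ripE !h (sT y x) (ripC y).
by lra.
Qed.

(** S is the root of l followed by its adjoint, so |S x| = |l x|. Hence S x + m -> l x, for m in the
    kernel of l, is well defined and isometric off that kernel; its domain is dense because the
    complement of the range of S is the kernel of S. The map v is its continuous extension. *)
Lemma polar l : bdd l -> exists S v, [/\ bdd S, selfadj S, posop S & hker S = hker l] /\
  [/\ bdd v, forall x, l x = v (S x), hker v = hker l,
      hker (adj v) = hker (adj l) &
      forall x, adj v (v x) = x - prj (hker l) x].
Proof.
move=> bl; have bal := adj_bdd bl; have cM := csub_ker bl.
have [|||S [bS sS pS SS _]] := @sqrt_exists R X (fun x => adj l (l x)).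
- exact: bdd_comp.
- by move=> x y; rewrite [LHS]ripC -adjP// -adjP// ripC.
- by move=> x; rewrite ripC -adjP// rip_ge0.
have Sl x : nrm (S x) = nrm (l x).
  by rewrite /nrm -[in LHS]sS SS ripC -adjP.
have kS : hker S = hker l.
  apply/seteqP; split=> x; rewrite /hker /= => h; apply: nrm_eq0.
    by rewrite -Sl h nrm0.
  by rewrite Sl h nrm0.
pose M := hker l; have cM' : csub M := cM.
pose G : set (X * X) := [set p | exists x m, [/\ M m, p.1 = S x + m & p.2 = l x]].
have sG : subsp G.
  have [M0 MD MZ] := cM.1; split.
  - by exists 0, 0; rewrite (lin0 bS.1) (lin0 bl.1) addr0.
  - move=> [a b] [a' b'] [x [m [hm /= -> ->]]] [x' [m' [hm' /= -> ->]]].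
    exists (x + x'), (m + m'); rewrite (linD bS.1) (linD bl.1).
    by split=> //=; [exact: MD|rewrite addrACA].
  - move=> c [a b] [x [m [hm /= -> ->]]].
    exists (c *: x), (c *: m); rewrite (linZ bS.1) (linZ bl.1).
    by split=> //=; [exact: MZ|rewrite scalerDr].
pose D := hcl G; have cD : csub D := csub_hcl sG.
(* The range of the selfadjoint S is orthogonal to its kernel, so projecting off M recovers S x from
   S x + m. *)
have SM x : orth M (S x) by rewrite /M -kS => m hm; rewrite sS hm rip0r.
have GE p : G p -> nrm p.2 = nrm (p.1 - prj M p.1).
  move=> [x [m [hm -> ->]]]; rewrite (linD (prj_linear cM)) (prj_id cM hm).
  by rewrite (prj_eq0 cM (SM x)) add0r addrK Sl.
have DE p : D p -> nrm p.2 = nrm (p.1 - prj M p.1).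
  move=> hp; have apx (e : R) : 0 < e -> exists2 q, G q &
      nrm (p.2 - q.2) <= e /\ nrm ((p.1 - prj M p.1) - (q.1 - prj M q.1)) <= e.
    move=> e0; have [q Gq hq] := hp e e0; exists q => //; split.
      exact: le_trans (nrm_snd (p - q)) hq.
    rewrite subrACA -(linB (prj_linear cM)) (le_trans (prjC_nrm cM _))//.
    exact: le_trans (nrm_fst (p - q)) hq.
  have tri (a b : X) : nrm a <= nrm b + nrm (a - b).
    by rewrite -[in leLHS](subrK b a) addrC nrmD.
  apply/eqP; rewrite eq_le; apply/andP; split; apply/ler_addgt0Pl => e e0;
    have e2 : 0 < e / 2 by rewrite divr_gt0.
    have [q Gq [h1 h2]] := apx _ e2; rewrite (le_trans (tri _ q.2))// GE//.
    by have := tri (q.1 - prj M q.1) (p.1 - prj M p.1); rewrite nrmB in h2; lra.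
  have [q Gq [h1 h2]] := apx _ e2.
  rewrite (le_trans (tri _ (q.1 - prj M q.1)))// -GE//.
  by have := tri q.2 p.2; rewrite nrmB in h1; lra.
have Dtot : forall x, exists y, D (x, y).
  apply: (@closed_dense_total R _ X X (@nrm R X) (@nrm R X) (@nrmD R X) (@nrmN R X)
    (@hcomplete R X) (@nrmN R X) (fun x y => D (x, y)) 1) => //.
  - move=> x y x' y' h h'; have := DE _ (subspB cD.1 h' h) => /= ->.
    by rewrite mul1r prjC_nrm.
  - move=> x e e0.
    have sd : subsp (vdom G) by exact: subsp_vdom.
    have : hcl (vdom G) x.
      apply: dense_orth0 => // z oz.
      have zS : S z = 0.
        apply: rip_ext => y; rewrite rip0l sS; apply: oz; exists (l y).
        by exists y, 0; rewrite addr0; split=> //; case: cM.1.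
      have Mz : M z by rewrite /M -kS.
      apply/rip_eq0/oz; exists 0; exists 0, z.
      by rewrite (lin0 bS.1) add0r (lin0 bl.1).
    move=> /(_ _ e0)[a [b hab] ha]; exists a, b; split=> //.
    exact: subset_hcl.
  - move=> x y h; apply: cD.2 => e e0.
    have e2 : 0 < e / 2 by rewrite divr_gt0.
    have [a [b [hab h1 h2]]] := h _ e2; exists (a, b) => //.
    by rewrite (le_trans (nrm_pair_le _))// (splitr e) lerD.
have /choice[v hv] := Dtot.
have Duniq x y y' : D (x, y) -> D (x, y') -> y = y'.
  move=> h h'; have := DE _ (subspB cD.1 h h') => /=.
  rewrite subrr (lin0 (prj_linear cM')) subrr nrm0 => /nrm_eq0/eqP.
  by rewrite subr_eq0 => /eqP.
have [_ DD DZ] := cD.1.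
have lv : linear v.
  move=> c x y; apply: (Duniq (c *: x + y)) => //.
  exact: (DD _ _ (DZ c _ (hv x)) (hv y)).
have vn x : nrm (v x) = nrm (x - prj M x) by exact: (DE _ (hv x)).
have bv : bdd v.
  by split=> //; exists 1 => x; rewrite vn mul1r prjC_nrm.
have vS x : l x = v (S x).
  apply: (Duniq (S x)) => //; apply: subset_hcl; exists x, 0.
  by rewrite addr0; split=> //; case: cM.1.
have bal' := adj_bdd bv.
exists S, v; split=> //; split=> //.
- apply/seteqP; split=> x; rewrite /hker /=.
    move=> h; have := vn x; rewrite h nrm0 => /esym/nrm_eq0/eqP.
    by rewrite subr_eq0 => /eqP ->; exact: (prj_in cM).
  by move=> Mx; apply: nrm_eq0; rewrite vn (prj_id cM) ?subrr ?nrm0.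
- apply/seteqP; split=> y.
    rewrite -!orth_ker_adj// => h _ [x _ <-]; apply: h; exists (S x) => //.
  rewrite -!orth_ker_adj// => h.
  have sl := subsp_range bl.1.
  have cO := csub_orth (csub_orth sl).1.
  move=> _ [x _ <-]; rewrite ripC.
  suff : orth (orth (range l)) (v x) by apply.
  rewrite orth_hcl// => e e0; have [[a b] [z [m [hm /= ha hb]]] hq] := hv x e e0.
  by exists b; [exists z|exact: le_trans (nrm_snd ((x, v x) - (a, b))) hq].
move=> x; apply/eqP; rewrite -subr_eq0; apply/eqP; move: x.
(* Both sides are selfadjoint, and their quadratic forms agree because |v x| is the norm of the
   component of x off the kernel. *)
apply: (@selfadj_form0 (fun x => adj v (v x) - (x - prj M x))).
- have bb : bdd (fun x => adj v (v x) - (x - prj M x)).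
    by apply: bdd_sub; [exact: bdd_comp|exact: bdd_prjC].
  exact: bb.1.
- move=> x y; rewrite !ripE prj_sa//; congr (_ - _).
  by rewrite ripC -!adjP// ripC.
move=> x; rewrite ripDl ripNl ripC -adjP// -nrm_sqr vn nrm_sqr.
suff -> : rip (x - prj M x) x = rip (x - prj M x) (x - prj M x) by rewrite subrr.
by rewrite [RHS]ripDr ripNr (prj_orth cM' x (prj_in cM' x)) subr0.
Qed.
End Polar.

(** * Connecting Fredholm operators of equal index *)

Section Connection.
Context (R : realType) (X : hspaceType R).
Implicit Types (l v w T F : X -> X) (V W : set (X * X)).

(** Lipschitz paths, for which concatenation is an estimate on each half and no limit at the
    junction. *)
Definition hconn V W := exists (g : R -> set (X * X)) (C : R),
  [/\ g 0 = V, g 1 = W, forall a, 0 <= a <= 1 -> fredX (g a) &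
   forall a b, 0 <= a <= 1 -> 0 <= b <= 1 -> pgap (g a) (g b) (C * `|a - b|)].

Lemma hconn_sym V W : hconn V W -> hconn W V.
Proof.
move=> [g [C [g0 g1 gf gC]]]; exists (fun a => g (1 - a)), C; split.
- by rewrite subr0.
- by rewrite subrr.
- by move=> a ha; apply: gf; lra.
- move=> a b ha hb x; have -> : `|a - b| = `|(1 - a) - (1 - b)|.
    by rewrite distrC; congr `|_|; ring.
  by apply: gC; lra.
Qed.

Lemma hconn_trans U V W : hconn U V -> hconn V W -> hconn U W.
Proof.
move=> [g [C [g0 g1 gf gC]]] [h [D [h0 h1 hf hD]]].
pose k a := if a <= 2^-1 then g (2 * a) else h (2 * a - 1).
(* Each half is run through at double speed; the sum of absolute values is a nonnegative constant
   good for both. *)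
pose K := 2 * (`|C| + `|D|).
have kg a b : 0 <= a -> a <= b -> b <= 2^-1 -> pgap (k a) (k b) (K * (b - a)).
  move=> a0 ab b1; rewrite /k (le_trans ab b1) b1 => x.
  have := gC (2 * a) (2 * b) _ _ x.
  rewrite -mulrBr normrM (ger0_norm (x := 2))// distrC (ger0_norm (x := b - a)) ?subr_ge0//.
  move=> hx; apply: (le_trans (hx _ _)); [lra|lra|].
  rewrite ler_wpM2r ?nrm_ge0// mulrA ler_wpM2r ?subr_ge0// /K mulrC ler_wpM2l//.
  by have := ler_norm C; have := normr_ge0 D; lra.
have k2 : k 2^-1 = V by rewrite /k lexx divff ?pnatr_eq0.
have kh a b : 2^-1 <= a -> a <= b -> b <= 1 -> pgap (k a) (k b) (K * (b - a)).
  have kE c : 2^-1 <= c -> k c = h (2 * c - 1).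
    rewrite le_eqVlt => /orP[/eqP <-|hc]; first by rewrite k2 divff ?pnatr_eq0// subrr.
    by rewrite /k leNgt hc.
  move=> a0 ab b1; rewrite !kE// ?(le_trans a0 ab)// => x.
  have := hD (2 * a - 1) (2 * b - 1) _ _ x.
  have -> : `|2 * a - 1 - (2 * b - 1)| = 2 * (b - a).
    by rewrite distrC ger0_norm; lra.
  move=> hx; apply: (le_trans (hx _ _)); [lra|lra|].
  rewrite ler_wpM2r ?nrm_ge0// mulrA ler_wpM2r ?subr_ge0// /K mulrC ler_wpM2l//.
  by have := ler_norm D; have := normr_ge0 C; lra.
have kk a b : 0 <= a -> a <= b -> b <= 1 -> pgap (k a) (k b) (K * (b - a)).
  move=> a0 ab b1; have [hb|/ltW hb] := leP b 2^-1; first exact: kg.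
  have [ha|/ltW ha] := leP a 2^-1; last exact: kh.
  have -> : K * (b - a) = K * (2^-1 - a) + K * (b - 2^-1) by ring.
  by apply: (@pgap_trans _ _ _ (k 2^-1)); [exact: kg|exact: kh].
exists k, K; split.
- by rewrite /k invr_ge0 ler0n mulr0.
- by rewrite /k leNgt invf_lt1// ltr1n/= mulr1 (_ : 2 - 1 = 1 :> R)//; ring.
- move=> a ha; rewrite /k; case: leP => h2; [apply: gf|apply: hf]; lra.
- move=> a b /andP[a0 a1] /andP[b0 b1]; have [ab|/ltW ba] := leP a b.
    by rewrite distrC ger0_norm ?subr_ge0//; exact: kk.
  by apply: pgap_sym; rewrite ger0_norm ?subr_ge0//; exact: kk.
Qed.

Definition graphX T : set (X * X) := [set p | p.2 = T p.1].

(** Closed range, in the form that [fredX_bound] takes for a graph. *)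
Definition lowb T := exists C, forall x, exists2 x', T x' = T x & nrm x' <= C * nrm (T x).

(** The bound for the adjoint is a field of its own, which makes the class stable under adjoints at
    once. *)
Record bfred T : Prop := {
  bfred_bdd : bdd T ;
  bfred_ker : exists n, odim (hker T) n ;
  bfred_cok : exists n, odim (hker (adj T)) n ;
  bfred_low : lowb T ;
  bfred_lowadj : lowb (adj T)
}.

Lemma bfred_adj T : bfred T -> bfred (adj T).
Proof.
by move=> [bT kT cT h1 h2]; split; rewrite ?adjK//; exact: adj_bdd.
Qed.

Lemma csub_graphX T : bdd T -> csub (graphX T).
Proof.
move=> bT; have -> : graphX T = hker (fun p : X * X => p.2 - T p.1).
  apply/seteqP; split=> p; rewrite /hker /graphX /=.
    by move=> ->; rewrite subrr.
  by move/eqP; rewrite subr_eq0 => /eqP.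
apply: csub_ker; apply: bdd_sub; first exact: bdd_snd.
exact: (bdd_comp bT (bdd_fst X)).
Qed.

Lemma vker_graphX T : vker (graphX T) = hker T.
Proof. by apply/seteqP; split=> x /esym. Qed.

Lemma vcok_graphX T : bdd T -> vcok (graphX T) = hker (adj T).
Proof.
move=> bT; rewrite -orth_ker_adj//; congr orth.
by apply/seteqP; split=> y; [move=> [x hx]; exists x => //; exact: esym hx|move=> [x _ <-]; exists x].
Qed.

Lemma bfred_fredX T : bfred T -> fredX (graphX T).
Proof.
move=> [bT kT cT [C hC] _]; split.
- exact: csub_graphX.
- by move=> y; rewrite /graphX /= (lin0 bT.1).
- by move=> x; apply: subset_hcl; exists (T x).
- by rewrite vker_graphX.
- by rewrite vcok_graphX.
- exists C => x y; rewrite /graphX /= => ->; have [x' h1 h2] := hC x.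
  by exists x'.
Qed.

Definition seg T T' := [/\ bdd T, bdd T' & forall a : R, 0 <= a <= 1 -> bfred (cvx T T' a)].

Lemma cvx_diff T T' a b x :
  cvx T T' a x - cvx T T' b x = (a - b)%:C *: (T' x - T x).
Proof.
rewrite /cvx opprD addrACA -!scalerBl -!rmorphB/= addrC scalerBr -scaleNr.
by congr (_ + _ *: _); rewrite -rmorphN/=; congr (_%:C); ring.
Qed.

Lemma cvx0 T T' : cvx T T' 0 = T.
Proof. by apply/funext => x; rewrite /cvx subr0 rmorph1 rmorph0 scale1r scale0r addr0. Qed.

Lemma cvx1 T T' : cvx T T' 1 = T'.
Proof. by apply/funext => x; rewrite /cvx subrr rmorph1 rmorph0 scale1r scale0r add0r. Qed.

Lemma adj_cvx T T' a : bdd T -> bdd T' -> adj (cvx T T' a) = cvx (adj T) (adj T') a.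
Proof.
move=> bT bT'; rewrite adj_add ?adj_scale//; [|exact: bdd_scale|exact: bdd_scale].
by apply/funext => y; rewrite !conjc_real.
Qed.

Lemma seg_adj T T' : seg T T' -> seg (adj T) (adj T').
Proof.
move=> [bT bT' h]; split; [exact: adj_bdd|exact: adj_bdd|].
by move=> a /h hf; rewrite -adj_cvx//; exact: bfred_adj.
Qed.

(** Points of the two graphs over the same x differ by (c - d)(T' x - T x); the factor 2 is that of
    [close_pgap]. *)
Lemma seg_hconn T T' : seg T T' -> hconn (graphX T) (graphX T').
Proof.
move=> [bT bT' h]; have [K K0 hK] := bdd_pos (bdd_sub bT' bT).
exists (fun a => graphX (cvx T T' a)), (2 * K); split.
- by rewrite cvx0.
- by rewrite cvx1.
- by move=> a /h; exact: bfred_fredX.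
move=> a b ha hb; rewrite -mulrA.
have half (c d : R) (p : X * X) : graphX (cvx T T' c) p ->
    exists2 q, graphX (cvx T T' d) q & nrm (p - q) <= K * `|c - d| * nrm p.
  case: p => x y; rewrite {1}/graphX /= => ->; exists (x, cvx T T' d x) => //.
  rewrite (_ : _ - _ = (0, cvx T T' c x - cvx T T' d x)); last first.
    by apply/pair_equal_spec; rewrite /= subrr.
  rewrite nrm_pair0l cvx_diff nrmZ cabsR -mulrA mulrCA ler_wpM2l//.
  rewrite (le_trans (hK _))// ler_pM2l//.
  exact: (nrm_fst (x, cvx T T' c x)).
apply: close_pgap.
- by apply: csub_graphX; exact: bdd_cvx.
- by apply: csub_graphX; exact: bdd_cvx.
- by rewrite mulr_ge0// ltW.
- by move=> v; exact: half.
- by move=> v; rewrite distrC; exact: half.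
Qed.

(** Chains of segments rather than paths: induction on the chain transfers them to adjoints
    ([bconn_adj]) and to graphs ([bconn_hconn]). *)
Inductive bconn : (X -> X) -> (X -> X) -> Prop :=
| bconn_seg T T' : seg T T' -> bconn T T'
| bconn_sym T T' : bconn T T' -> bconn T' T
| bconn_trans T T' T'' : bconn T T' -> bconn T' T'' -> bconn T T''.

Lemma bconn_adj T T' : bconn T T' -> bconn (adj T) (adj T').
Proof.
elim=> [S S' h|S S' _ h|S S' S'' _ h1 _ h2].
- by apply: bconn_seg; exact: seg_adj.
- exact: bconn_sym.
- exact: bconn_trans h1 h2.
Qed.

Lemma bconn_hconn T T' : bconn T T' -> hconn (graphX T) (graphX T').
Proof.
elim=> [S S' h|S S' _ h|S S' S'' _ h1 _ h2].
- exact: seg_hconn.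
- exact: hconn_sym.
- exact: hconn_trans h1 h2.
Qed.

Lemma invop_inv w : invop w -> exists w', [/\ bdd w',
  forall x, w (w' x) = x & forall x, w' (w x) = x].
Proof.
move=> [bw [c c0 [h1 h2]]]; have lw := bw.1.
have inj x : w x = 0 -> x = 0.
  move=> e; apply: nrm_eq0; apply/eqP; rewrite eq_le nrm_ge0 andbT.
  by rewrite -(pmulr_rle0 _ c0); have := h1 x; rewrite e nrm0.
have sur : forall y, exists x, w x = y.
  apply: (bounded_below_surj bw c0 h1) => y e.
  apply: nrm_eq0; apply/eqP; rewrite eq_le nrm_ge0 andbT.
  by rewrite -(pmulr_rle0 _ c0); have := h2 y; rewrite e nrm0.
have [w' hw'] := choice sur; exists w'; split=> //.
  split=> [a x y|].
    apply/eqP; rewrite -subr_eq0; apply/eqP/inj.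
    by rewrite (linB lw) lw !hw' subrr.
  exists c^-1 => y; have := h1 (w' y); rewrite hw' mulrC -ler_pdivlMr//.
  by rewrite mulrC.
move=> x; apply/eqP; rewrite -subr_eq0; apply/eqP/inj.
by rewrite (linB lw) hw' subrr.
Qed.

Lemma bfred_comp T w : bfred T -> invop w -> bfred (fun x => T (w x)).
Proof.
move=> [bT [n kT] [m cT] [C hC] [D hD]] iw; have [bw [c c0 [h1 h2]]] := iw.
have [w' [[lw' [K' hK']] ww' w'w]] := invop_inv iw.
have aTw : adj (fun x => T (w x)) = fun y => adj w (adj T y) by exact: adj_comp.
have injw x : adj w x = 0 -> x = 0.
  move=> e; apply: nrm_eq0; apply/eqP; rewrite eq_le nrm_ge0 andbT.
  by rewrite -(pmulr_rle0 _ c0); have := h2 x; rewrite e nrm0.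
have bTw : bdd (fun x => T (w x)) by exact: bdd_comp.
split=> //.
- apply: (odim_inj (T := w) (csub_ker bTw).1 kT bw.1) => // x _ h.
  by rewrite -(w'w x) h (lin0 lw').
- exists m; rewrite (_ : hker _ = hker (adj T))// aTw.
  apply/seteqP; split=> y; rewrite /hker /=; first by move/injw.
  by move=> ->; exact: (lin0 (adj_bdd bw).1).
- exists (`|K'| * `|C|) => x; have [x1 e1 e2] := hC (w x).
  exists (w' x1); first by rewrite ww'.
  rewrite (le_trans (hK' _))// -mulrA (@le_trans _ _ (`|K'| * nrm x1))//.
    by rewrite ler_wpM2r ?nrm_ge0// ler_norm.
  rewrite ler_wpM2l// (le_trans e2)// ler_wpM2r ?nrm_ge0// ler_norm//.
- exists (`|D| * c^-1) => y; have [y1 e1 e2] := hD y.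
  rewrite aTw; exists y1; first by rewrite e1.
  rewrite (le_trans e2)// -mulrA (@le_trans _ _ (`|D| * nrm (adj T y)))//.
    by rewrite ler_wpM2r ?nrm_ge0// ler_norm.
  by rewrite ler_wpM2l// mulrC ler_pdivlMr// mulrC.
Qed.

Lemma seg_comp T w w' : bfred T -> iseg w w' ->
  seg (fun x => T (w x)) (fun x => T (w' x)).
Proof.
move=> fT [bw bw' h]; have bT := bfred_bdd fT.
split; [exact: bdd_comp|exact: bdd_comp|] => a /h iw.
have := bfred_comp fT iw; congr bfred; apply/funext => x.
by rewrite /cvx (linD bT.1) !(linZ bT.1).
Qed.

Lemma bconn_unitary T w : bfred T -> unitary w -> bconn (fun x => T (w x)) T.
Proof.
move=> fT /unitary_path[w1 [w2 [h1 h2 h3]]].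
apply: bconn_trans (bconn_seg (seg_comp fT h1)) _.
exact: bconn_trans (bconn_seg (seg_comp fT h2)) (bconn_seg (seg_comp fT h3)).
Qed.
End Connection.

(** * Partial isometries and operators of equal index *)

Section PartialIsometries.
Context (R : realType) (X : hspaceType R).
Implicit Types (l v w T F : X -> X) (V W : set (X * X)).

(** For orthonormal f and g, the partial isometry that carries f j to g j. *)
Definition dyad n (f g : 'I_n -> X) (x : X) : X := \sum_j ip x (f j) *: g j.

Lemma bdd_dyad n (f g : 'I_n -> X) : bdd (dyad f g).
Proof.
split=> [c x y|].
  rewrite /dyad scaler_sumr -big_split; apply: eq_bigr => i _ /=.
  by rewrite ipDl ipZl scalerDl scalerA.
exists (\sum_i nrm (f i) * nrm (g i)) => x; rewrite mulr_suml.
rewrite (le_trans (nrm_sum _ _ _))// ler_sum// => i _.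
by rewrite nrmZ mulrAC ler_wpM2r ?nrm_ge0// mulrC cabs_ip.
Qed.

Lemma adj_dyad n (f g : 'I_n -> X) : adj (dyad f g) = dyad g f.
Proof.
apply: adj_uniq; first exact: bdd_dyad.
move=> x y; rewrite /rip /dyad ip_suml ip_sumr; congr complex.Re.
apply: eq_bigr => i _; rewrite ipZl ipZr mulrC; congr (_ * _).
by rewrite [LHS]ipC.
Qed.

Lemma dyad_comp n (f g h : 'I_n -> X) x : onb g ->
  dyad g h (dyad f g x) = dyad f h x.
Proof. by move=> og; apply: eq_bigr => i _; rewrite onb_comb. Qed.

Lemma dyad_eq0 n (f g : 'I_n -> X) x : (forall i, ip x (f i) = 0) ->
  dyad f g x = 0.
Proof. by move=> h; apply: big1 => i _; rewrite h scale0r. Qed.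

Lemma lin_dyad_eq0 n (f g : 'I_n -> X) T x : linear T ->
  (forall i, T (g i) = 0) -> T (dyad f g x) = 0.
Proof.
by move=> lT h; rewrite (lin_sum lT) big1// => i _; rewrite (linZ lT) h scaler0.
Qed.

Lemma ip_range_adj T y z : bdd T -> T z = 0 -> ip (adj T y) z = 0.
Proof. by move=> bT h; rewrite ipC -adj_ip// h ip0l conjc0. Qed.

Definition piso T := [/\ bdd T,
  forall x, adj T (T x) = x - prj (hker T) x &
  forall x, T (adj T x) = x - prj (hker (adj T)) x].

Lemma piso_adj T : piso T -> piso (adj T).
Proof. by move=> [bT h1 h2]; split; rewrite ?adjK//; exact: adj_bdd. Qed.

Lemma piso_half T : bdd T -> (forall x, adj T (T x) = x - prj (hker T) x) ->
  piso T.
Proof.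
move=> bT h; split=> // x; have baT := adj_bdd bT; have cN := csub_ker baT.
have cM := csub_ker bT.
have oM y : prj (hker T) (adj T y) = 0.
  by apply: (prj_eq0 cM) => m hm; rewrite ripC -adjP// hm rip0l.
rewrite (_ : prj (hker (adj T)) x = x - T (adj T x)); first by rewrite opprB addrC subrK.
apply: (prj_uniq cN).
  by rewrite /hker /= (linB baT.1) h oM subr0 subrr.
move=> y hy; rewrite opprB addrC subrK adjP// hy rip0r//.
Qed.

(** Two partial isometries with orthogonal initial spaces and orthogonal final spaces. Each relation
    is listed with its adjoint, so that the notion passes to adjoints. *)
Record compat T F : Prop := {
  compat_bdd : bdd T ; compat_bddF : bdd F ;
  compat1 : forall x, T (adj T (T x)) = T x ;
  compat1a : forall x, adj T (T (adj T x)) = adj T x ;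
  compat2 : forall x, F (adj F (F x)) = F x ;
  compat2a : forall x, adj F (F (adj F x)) = adj F x ;
  compat3 : forall x, T (adj F x) = 0 ;
  compat3a : forall x, adj T (F x) = 0 ;
  compat4 : forall x, F (adj T x) = 0 ;
  compat4a : forall x, adj F (T x) = 0
}.

Lemma compat_adj T F : compat T F -> compat (adj T) (adj F).
Proof. by case=> bT bF *; split; rewrite ?adjK//; exact: adj_bdd. Qed.

Lemma cvx_add T F (a : R) x : cvx T (fun x => T x + F x) a x = T x + a%:C *: F x.
Proof.
by rewrite /cvx scalerDr addrA -scalerDl -rmorphD/= subrK rmorph1 scale1r.
Qed.

Lemma compat_pyth T F (a : R) x : compat T F ->
  nrm (T x + a%:C *: F x) ^+ 2 = nrm (T x) ^+ 2 + a ^+ 2 * nrm (F x) ^+ 2.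
Proof.
move=> h; rewrite pyth ?nrmZ ?cabsR ?exprMn ?real_normK ?num_real//.
by rewrite ripZr (adjP _ _ (compat_bdd h)) (compat3a h) rip0r mulr0.
Qed.

Lemma compat_ker T F (a : R) x : compat T F -> T x + a%:C *: F x = 0 -> T x = 0.
Proof.
move=> h e; have := compat_pyth a x h; rewrite e nrm0 expr0n/= => e2.
apply: nrm_eq0; apply/eqP; rewrite -sqrf_eq0; apply/eqP.
by have := sqr_ge0 (nrm (T x)); have := mulr_ge0 (sqr_ge0 a) (sqr_ge0 (nrm (F x))); lra.
Qed.

(** [adj T (T x) + adj F (F x)] has the same image as x. By [compat_pyth] the image controls T x,
    and F x up to 1 / |a|; at a = 0, where F x is not controlled, [adj T (T x)] alone is taken. *)
Lemma compat_lowb T F (a : R) : compat T F -> lowb (fun x => T x + a%:C *: F x).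
Proof.
move=> h; have bT := compat_bdd h; have bF := compat_bddF h.
have [K K0 hK] := bdd_pos (adj_bdd bT); have [L L0 hL] := bdd_pos (adj_bdd bF).
have hT x : nrm (T x) <= nrm (T x + a%:C *: F x).
  rewrite -(ler_pXn2r (n := 2)) ?nnegrE ?nrm_ge0// compat_pyth// lerDl.
  by rewrite mulr_ge0 ?sqr_ge0.
have [->|a0] := eqVneq a 0.
  exists K => x; exists (adj T (T x)); rewrite !rmorph0 !scale0r !addr0.
    by rewrite (compat1 h).
  exact: hK.
have hF x : `|a| * nrm (F x) <= nrm (T x + a%:C *: F x).
  rewrite -(ler_pXn2r (n := 2)) ?nnegrE ?mulr_ge0 ?nrm_ge0// compat_pyth// exprMn.
  by rewrite real_normK ?num_real// lerDr sqr_ge0.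
have na : 0 < `|a| by rewrite normr_gt0.
exists (K + L / `|a|) => x; exists (adj T (T x) + adj F (F x)).
  rewrite (linD bT.1) (linD bF.1) (compat1 h) (compat3 h) addr0.
  by rewrite (compat4 h) add0r (compat2 h).
rewrite mulrDl (le_trans (nrmD _ _))// lerD//.
  by rewrite (le_trans (hK _))// ler_pM2l.
rewrite (le_trans (hL _))// -mulrA ler_pM2l// mulrC ler_pdivlMr// mulrC.
exact: hF.
Qed.

Lemma compat_seg T F : compat T F -> (exists n, odim (hker T) n) ->
  (exists n, odim (hker (adj T)) n) -> seg T (fun x => T x + F x).
Proof.
move=> h [n kT] [m cT]; have bT := compat_bdd h; have bF := compat_bddF h.
have ha := compat_adj h.
split=> //; first exact: bdd_add.
move=> a _; have -> : cvx T (fun x => T x + F x) a = fun x => T x + a%:C *: F x.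
  by apply/funext => x; rewrite cvx_add.
have bS : bdd (fun x => T x + a%:C *: F x) by apply: bdd_add => //; exact: bdd_scale.
have aE : adj (fun x => T x + a%:C *: F x) = fun x => adj T x + a%:C *: adj F x.
  rewrite adj_add ?adj_scale//; last exact: bdd_scale.
  by rewrite conjc_real.
split=> //.
- apply: (odim_sub (csub_ker bS).1 kT) => x; exact: compat_ker.
- apply: (odim_sub (csub_ker (adj_bdd bS)).1 cT) => x; rewrite aE; exact: compat_ker.
- exact: compat_lowb.
- by rewrite aE; exact: compat_lowb.
Qed.

Definition coiso T := bdd T /\ forall x, T (adj T x) = x.

Lemma coiso_ker T k (f : 'I_k -> X) x : coiso T -> onb f ->
  hker T = [set x | x = onp f x] -> adj T (T x) + onp f x = x.
Proof.
move=> [bT TT] of_ kf; have cN := csub_ker bT.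
rewrite -(prj_onp of_) -kf (prj_uniq (m := x - adj T (T x)) cN).
- by rewrite addrC subrK.
- by rewrite /hker /= (linB bT.1) TT subrr.
move=> y hy; rewrite opprB addrC subrK ripC -adjP// hy rip0l//.
Qed.

(** w is [adj T] after T', plus the unitary from the kernel of T' to that of T that matches the two
    bases. T kills the second term and undoes [adj T] in the first. *)
Lemma coiso_unitary T T' k : coiso T -> coiso T' -> odim (hker T) k ->
  odim (hker T') k -> exists2 w, unitary w & T' = fun x => T (w x).
Proof.
move=> cT cT' [f of_ kf] [f' of' kf'].
have [bT TT] := cT; have [bT' TT'] := cT'.
pose W (S S' : X -> X) (g g' : 'I_k -> X) x := adj S (S' x) + dyad g' g x.
have Tf i : T (f i) = 0 by have : hker T (f i) := odim_in i of_ kf.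
have Tf' i : T' (f' i) = 0 by have : hker T' (f' i) := odim_in i of' kf'.
have key S S' g g' x : coiso S -> coiso S' -> onb g -> onb g' ->
    hker S = [set x | x = onp g x] -> (forall i, S' (g' i) = 0) ->
    W S S' g g' (W S' S g' g x) = x.
  move=> cS cS' og og' kg Sg'; have [bS SS] := cS; have [bS' SS'] := cS'.
  rewrite /W (linD bS'.1) SS' (lin_dyad_eq0 _ _ bS'.1 Sg') addr0.
  rewrite (linD (bdd_dyad _ _).1) dyad_comp//.
  rewrite (dyad_eq0 g) ?add0r; last by move=> i; apply: ip_range_adj.
  exact: (coiso_ker _ cS og kg).
have bW : bdd (W T T' f f').
  apply: bdd_add; last exact: bdd_dyad.
  by apply: bdd_comp => //; exact: adj_bdd.
have aW : adj (W T T' f f') = W T' T f' f.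
  have baT := adj_bdd bT.
  rewrite adj_add; [|exact: bdd_comp|exact: bdd_dyad].
  by rewrite adj_dyad adj_comp// adjK.
exists (W T T' f f').
  by split=> // x; rewrite aW; exact: key.
apply/funext => x; rewrite /W (linD bT.1) TT.
by rewrite (lin_dyad_eq0 _ _ bT.1 Tf) addr0.
Qed.

(** The dyad F carries the first m vectors of a basis of the kernel onto a basis of the cokernel.
    Adding it fills the cokernel, and the remaining k vectors span the new kernel. *)
Lemma piso_coiso T m k : piso T -> odim (hker T) (m + k) ->
  odim (hker (adj T)) m ->
  exists T1, [/\ coiso T1, odim (hker T1) k, bfred T1 & bconn T T1].
Proof.
move=> [bT TaT TTa] oN oM; have baT := adj_bdd bT.
have [f of_ Nf] := oN; have [g og Mg] := oM.
have cN := csub_ker bT; have cM := csub_ker baT.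
have Tf i : T (f i) = 0 by have : hker T (f i) := odim_in i of_ Nf.
have Tg i : adj T (g i) = 0 by have : hker (adj T) (g i) := odim_in i og Mg.
pose fl j := f (lshift k j); pose fr j := f (rshift m j).
have ofl : onb fl by move=> i j; rewrite /fl of_ (inj_eq (@lshift_inj _ _)).
have ofr : onb fr by move=> i j; rewrite /fr of_ (inj_eq (@rshift_inj _ _)).
pose F := dyad fl g; have bF : bdd F by exact: bdd_dyad.
have aF : adj F = dyad g fl by exact: adj_dyad.
have cTF : compat T F.
  split=> //; rewrite ?aF.
  - by move=> x; rewrite TaT (linB bT.1) (prj_in cN x : T _ = 0) subr0.
  - by move=> x; rewrite TTa (linB baT.1) (prj_in cM x : adj T _ = 0) subr0.
  - by move=> x; rewrite /F !dyad_comp.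
  - by move=> x; rewrite /F !dyad_comp.
  - by move=> x; apply: lin_dyad_eq0 => [|i]; [exact: bT.1|exact: Tf].
  - by move=> x; apply: lin_dyad_eq0; first exact: baT.1.
  - move=> x; apply: dyad_eq0 => i; apply: ip_range_adj => //; exact: Tf.
  - move=> x; apply: dyad_eq0 => i; rewrite -(adjK bT); exact: ip_range_adj.
have sT : seg T (fun x => T x + F x) by apply: compat_seg => //; [exists (m + k)|exists m].
exists (fun x => T x + F x); split.
- split=> [|x]; first exact: bdd_add.
  rewrite adj_add// aF (linD bT.1) (linD bF.1) TTa.
  rewrite (lin_dyad_eq0 _ _ bT.1 (fun i => Tf _)) addr0.
  rewrite (_ : F (adj T x) = 0) ?add0r; last exact: compat4 cTF x.
  by rewrite /F dyad_comp// Mg (prj_onp og) subrK.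
- exists fr => //; apply/seteqP; split=> x; rewrite /hker /=.
    move=> h; have Tx : T x = 0.
      by apply: (compat_ker (a := 1) cTF); rewrite rmorph1 scale1r.
    have Fx : F x = 0 by rewrite -h Tx add0r.
    have : hker T x by [].
    rewrite Nf /= {1 2}/onp big_split_ord /= big1 ?add0r// => i _.
    by rewrite (onb_free og Fx i) scale0r.
  move=> h; have Tx : T x = 0 by rewrite h (lin_dyad_eq0 _ _ bT.1 (fun i => Tf _)).
  rewrite Tx add0r {1}h; apply: (lin_dyad_eq0 _ _ bF.1) => i.
  by apply: dyad_eq0 => j; rewrite /fr /fl of_ eq_rlshift.
- by have [_ _ /(_ 1)] := sT; rewrite cvx1; apply; rewrite ler01 lexx.
- exact: bconn_seg.
Qed.

Lemma bconn_piso T T' m m' k : piso T -> piso T' ->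
  odim (hker T) (m + k) -> odim (hker (adj T)) m ->
  odim (hker T') (m' + k) -> odim (hker (adj T')) m' -> bconn T T'.
Proof.
move=> pT pT' oN oM oN' oM'.
have [T1 [c1 k1 f1 h1]] := piso_coiso pT oN oM.
have [T2 [c2 k2 f2 h2]] := piso_coiso pT' oN' oM'.
have [w uw e] := coiso_unitary c1 c2 k1 k2.
apply: bconn_trans h1 _; apply: bconn_sym; apply: bconn_trans h2 _.
by rewrite e; exact: bconn_unitary.
Qed.

(** [bconn_piso] covers nonnegative index; for negative index the adjoints are joined instead. *)
Lemma bconn_piso_index T T' n m n' m' : piso T -> piso T' ->
  odim (hker T) n -> odim (hker (adj T)) m ->
  odim (hker T') n' -> odim (hker (adj T')) m' -> (n + m' = n' + m)%N ->
  bconn T T'.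
Proof.
move=> pT pT' oN oM oN' oM' e.
have [mn|/ltnW nm] := leqP m n.
  have nE : n = (m + (n - m))%N by rewrite subnKC.
  have n'E : n' = (m' + (n - m))%N.
    by lia.
  rewrite nE in oN; rewrite n'E in oN'.
  exact: (bconn_piso pT pT' oN oM oN' oM').
have mE : m = (n + (m - n))%N by rewrite subnKC.
have m'E : m' = (n' + (m - n))%N.
  by lia.
rewrite mE in oM; rewrite m'E in oM'.
have [bT _ _] := pT; have [bT' _ _] := pT'.
rewrite -(adjK bT) -(adjK bT'); apply: bconn_adj.
apply: (bconn_piso (piso_adj pT) (piso_adj pT') oM _ oM' _); by rewrite adjK.
Qed.

(** The Moore-Penrose inverse of a partial isometry is its adjoint. *)
Lemma mpg_piso v : piso v -> mpg v = graphX (adj v).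
Proof.
move=> [bv avv vav]; have bav := adj_bdd bv; have cM := csub_ker bv.
apply/seteqP; split=> -[x y]; rewrite /mpg /graphX /=.
  move=> [oy /eqP]; rewrite (linB bav.1) subr_eq0 => /eqP ->.
  by rewrite avv (prj_eq0 cM oy) subr0.
move=> ->; have oy : orth (hker v) (adj v x).
  by move=> z hz; rewrite ripC -adjP// hz rip0l.
split=> //; rewrite /hker /= (linB bav.1) avv (prj_eq0 cM oy) subr0 subrr//.
Qed.

(** The kernel of (1 - a) l + a v and that of its adjoint do not depend on a. The graphs of the
    Moore-Penrose inverses therefore have constant kernel and cokernel, and only their first
    coordinate moves. *)
Lemma hconn_polar V : fredX V -> exists v, [/\ piso v, hker v = vcok V,
  hker (adj v) = vker V & hconn V (graphX (adj v))].
Proof.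
move=> fV; have [l bl [VE kl kal]] := fredX_mpg fV.
have [S [v [[bS sS pS kS] [bv vS kv kav avv]]]] := polar bl.
have cM := csub_ker bl; have bav := adj_bdd bv.
have pv : piso v by apply: piso_half => // x; rewrite kv.
exists v; rewrite kv kl kav kal; split=> //; rewrite -mpg_piso// VE.
pose L := cvx l v; have bL a : bdd (L a) by exact: bdd_cvx.
have aL a : adj (L a) = cvx (adj l) (adj v) a by exact: adj_cvx.
have alE y : adj l y = S (adj v y).
  rewrite (_ : l = fun x => v (S x)); last exact/funext.
  by rewrite adj_comp// (selfadj_adj bS).
(* Positivity of S makes (1 - a) S + a positive definite for a > 0. The vectors u and u' differ
   because the kernel of l has to be projected off on one side. *)
have form0 a u u' : 0 <= a <= 1 -> a != 0 -> rip (S u') u = rip (S u) u ->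
    rip u' u = rip u u -> (1 - a) * rip (S u') u + a * rip u' u = 0 -> u = 0.
  move=> /andP[a0 a1] an0 -> -> h; apply: rip_eq0; apply/eqP.
  rewrite -(mulrI_eq0 _ (lregP an0)) eq_le mulr_ge0 ?rip_ge0// andbT.
  by rewrite -h lerDr mulr_ge0 ?pS// subr_ge0.
have kL a : 0 <= a <= 1 -> hker (L a) = hker l.
  move=> ha; apply/seteqP; split=> x; rewrite /hker /L /cvx /=; last first.
    move=> h; have : hker v x by rewrite kv.
    by rewrite /hker /= => ->; rewrite h !scaler0 addr0.
  have [->|a0] := eqVneq a 0.
    by rewrite subr0 rmorph1 rmorph0 scale1r scale0r addr0.
  rewrite vS -!(linZ bv.1) -(linD bv.1) => h.
  have Mz : hker l ((1 - a)%:C *: S x + a%:C *: x) by rewrite -kv.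
  have ox := prj_orthP cM x; set x1 := x - _ in ox.
  have SP : S (prj (hker l) x) = 0.
    suff : hker S (prj (hker l) x) by [].
    by rewrite kS; exact: (prj_in cM).
  have Sx1 : S x1 = S x by rewrite (linB bS.1) SP subr0.
  suff x10 : x1 = 0.
    by move: x10 => /eqP; rewrite subr_eq0 => /eqP ->; rewrite -vS; exact: (prj_in cM).
  apply: (form0 a x1 x) => //; first by rewrite Sx1.
    by rewrite /x1 [RHS]ripDr ripNr [rip _ (prj _ _)]prj_orth ?subr0 1?ripC//; exact: (prj_in cM).
  by have := ox _ Mz; rewrite ripC ripDl !ripZl.
have kaL a : 0 <= a <= 1 -> hker (adj (L a)) = hker (adj l).
  move=> ha; rewrite aL; apply/seteqP; split=> y; rewrite /hker /cvx /=; last first.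
    move=> h; have : hker (adj v) y by rewrite kav.
    by rewrite /hker /= => ->; rewrite h !scaler0 addr0.
  have [->|a0] := eqVneq a 0.
    by rewrite subr0 rmorph1 rmorph0 scale1r scale0r addr0.
  rewrite alE => h; rewrite (_ : adj v y = 0) ?(lin0 bS.1)//.
  apply: (form0 a (adj v y) (adj v y)) => //.
  by rewrite -!ripZl -ripDl h rip0l.
have [K K0 hK] := bdd_pos (bdd_sub bv bl).
exists (fun a => mpg (L a)), (2 * K); split.
- by rewrite /L cvx0.
- by rewrite /L cvx1.
- move=> a ha; apply: mpg_fredX => //; rewrite ?kL ?kaL// ?kl ?kal.
    exact: fredX_cok.
  exact: fredX_ker.
move=> a b ha hb; rewrite -mulrA.
have fm c : 0 <= c <= 1 -> csub (mpg (L c)).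
  move=> hc; apply: fredX_csub; apply: mpg_fredX => //; rewrite ?kL ?kaL// ?kl ?kal.
    exact: fredX_cok.
  exact: fredX_ker.
(* The condition on y is the same for all parameters, so y is kept and x is moved by the difference
   of the two values at y. *)
have half (c d : R) (p : X * X) : 0 <= c <= 1 -> 0 <= d <= 1 -> mpg (L c) p ->
    exists2 q, mpg (L d) q & nrm (p - q) <= K * `|c - d| * nrm p.
  move=> hc hd; case: p => x y; rewrite /mpg kL// kaL//= => -[oy h].
  exists (x - L c y + L d y, y); first by rewrite kL// kaL//= addrK.
  rewrite (_ : _ - _ = (L c y - L d y, 0)); last first.
    apply/pair_equal_spec; rewrite /= subrr; split=> //.
    by rewrite opprD addrA opprB addrCA subrr addr0.
  rewrite nrm_pair0r cvx_diff nrmZ cabsR -mulrA mulrCA ler_wpM2l//.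
  by rewrite (le_trans (hK _))// ler_pM2l//; exact: (nrm_snd (x, y)).
apply: close_pgap => //; [exact: fm|exact: fm|by rewrite mulr_ge0// ltW| |].
- by move=> p; exact: half.
- by move=> p; rewrite distrC; exact: half.
Qed.

Theorem same_index_hconn V V' n m n' m' : fredX V -> fredX V' ->
  odim (vker V) n -> odim (vcok V) m -> odim (vker V') n' -> odim (vcok V') m' ->
  (n + m' = n' + m)%N -> hconn V V'.
Proof.
move=> fV fV' oN oM oN' oM' e.
have [v [pv kv kav hv]] := hconn_polar fV.
have [v' [pv' kv' kav' hv']] := hconn_polar fV'.
apply: (hconn_trans hv); apply: hconn_sym; apply: (hconn_trans hv').
apply: hconn_sym; apply: bconn_hconn.
have [bv _ _] := pv; have [bv' _ _] := pv'.
apply: (bconn_piso_index (piso_adj pv) (piso_adj pv') (n := n) (m := m) (n' := n') (m' := m')) => //;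
  rewrite ?adjK ?kv ?kv' ?kav ?kav'//.
Qed.
End PartialIsometries.

(** * Closed range from a bound on a subspace of finite codimension *)

Section LowerBound.
Context (R : realType) (X : hspaceType R).

(** The part V0 of V over the kernel of f has closed range W and bounded preimages by hypothesis.
    Its complement V1 in V is finite-dimensional, and there the norm bound is automatic once the
    vectors with image in W are split off. *)
Lemma finite_codim_bound (V : set (X * X)) (f : X -> X) (F : set X) k (C0 : R) :
  csub V -> bdd f -> odim F k -> (forall x, F (f x)) -> 0 <= C0 ->
  (forall x y, V (x, y) -> f x = 0 -> nrm x <= C0 * nrm y) ->
  exists C, forall x y, V (x, y) -> exists2 x', V (x', y) & nrm x' <= C * nrm y.
Proof.
move=> cV bf oF Ff C00 hC0; have sV := cV.1.
pose V0 := V `&` [set p : X * X | f p.1 = 0].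
have cV0 : csub V0.
  by apply: csubI => //; apply: (csub_ker (T := fun p : X * X => f p.1)); exact: (bdd_comp bf (bdd_fst X)).
pose W : set X := [set y | exists x, V0 (x, y)].
have sW : subsp W by exact: subsp_vran cV0.1.
have cW : csub W.
  split=> // y hy.
  have hu n : exists p : X * X, V0 p /\ nrm (y - p.2) <= n.+1%:R^-1.
    have e0 : 0 < (n.+1%:R^-1 : R) by rewrite invr_gt0.
    by have [y' [x hx] hy'] := hy _ e0; exists (x, y').
  have [u hu'] := choice hu.
  have uB n m : nrm ((u m).1 - (u n).1) <= C0 * nrm ((u m).2 - (u n).2).
    have [Vn _] := hu' n; have [Vm _] := hu' m.
    have [h1 h2] := subspB cV0.1 Vm Vn.
    exact: hC0 h1 h2.
  have u2 n : nrm ((u n).2 - y) <= 1 / n.+1%:R.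
    by rewrite nrmB div1r; case: (hu' n).
  have [|l hl] := @hcomplete R X (fun n => (u n).1) (C0 * 2).
    move=> n m nm; rewrite (le_trans (uB _ _))// -mulrA ler_wpM2l//.
    rewrite (le_trans (nrmT y _ _))// (_ : 2 = 1 + 1 :> R)// mulrDl lerD//.
      by rewrite (le_trans (u2 m))// ler_invS.
    by rewrite nrmB.
  exists l; apply: cV0.2 => e e0; have [n hn] := invS_small (C0 * 2 + 1) e0.
  exists (u n); first by case: (hu' n).
  rewrite nrmB (le_trans _ (ltW hn))// (le_trans (nrm_pair_le _))//.
  by rewrite mulrDl lerD//; [exact: hl|exact: u2].
pose V1 := V `&` orth V0.
have cV1 : csub V1 by apply: csubI => //; exact: csub_orth cV0.1.
have [d oV1] : exists d, odim V1 d.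
  apply: (odim_inj (T := fun p : X * X => f p.1) cV1.1 oF) => //.
    by move=> c p q; rewrite -bf.1.
  by move=> p [h1 h2] h3; apply/rip_eq0/h2.
pose Q (p : X * X) := p.2 - prj W p.2.
have bQ : bdd Q by apply: (bdd_comp (bdd_prjC cW) (bdd_snd X)).
(* Vectors of V1 whose image lies in W already: they can be exchanged for elements of V0 with the
   same image. On the rest, V2, the image modulo W determines the vector. *)
pose K := V1 `&` hker Q.
have cK : csub K by apply: csubI => //; exact: csub_ker.
pose V2 := V1 `&` orth K.
have cV2 : csub V2 by apply: csubI => //; exact: csub_orth cK.1.
have [d2 oV2] : exists d, odim V2 d by apply: (odim_sub cV2.1 oV1) => p [].
have [C1 C10 hC1] : exists2 C, 0 <= C & forall p, V2 p -> nrm p <= C * nrm (Q p).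
  apply: (odim_inv_bounded bQ.1 oV2) => p [h1 h2] h3.
  by apply/rip_eq0/h2.
exists (C0 * (1 + C1) + C1) => x y hxy.
pose p0 := prj V0 (x, y); pose p1 := (x, y) - p0.
have Vp0 : V0 p0 by exact: (prj_in cV0).
have Vp1 : V1 p1.
  split; last exact: prj_orthP.
  by apply: (subspB sV) => //; case: Vp0.
pose k1 := prj K p1; pose q := p1 - k1.
have Kk : K k1 by exact: (prj_in cK).
have Vq : V2 q.
  split; last exact: prj_orthP.
  by apply: (subspB cV1.1) => //; case: Kk.
have [w Vw] : W k1.2.
  have [_ /eqP] := Kk; rewrite /Q subr_eq0 => /eqP ->; exact: (prj_in cW).
(* The component k1 is replaced by the element (w, k1.2) of V0. The image is unchanged, and r now
   obeys the bound with C0, q the one with C1. *)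
pose r := p0 + (w, k1.2).
have Vr : V0 r by have [_ h _] := cV0.1; exact: h.
have rq2 : r.2 + q.2 = y.
  have -> : r.2 = p0.2 + k1.2 by [].
  have -> : q.2 = y - p0.2 - k1.2 by [].
  by move: p0.2 k1.2 => a b; rewrite addrC -(addrA y) -opprD subrK.
exists (r + q).1.
  have : V (r + q) by have [_ h _] := sV; apply: h; [case: Vr|case: Vq => -[]].
  by rewrite [r + q]surjective_pairing /= rq2.
have Qq : Q q = Q (0, y).
  have Wr : W r.2 by exists r.1; rewrite -surjective_pairing.
  have Py : prj W y = r.2 + prj W q.2.
    by rewrite -{1}rq2 (linD (prj_linear cW) r.2 q.2) (prj_id cW Wr).
  have -> : Q (0, y) = y - prj W y by [].
  rewrite Py -[in RHS]rq2.
  have e (a b c : X) : b - c = a + b - (a + c) by rewrite opprD addrACA subrr add0r.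
  exact: e.
have hq : nrm q <= C1 * nrm y.
  rewrite (le_trans (hC1 _ Vq))// Qq ler_wpM2l// /Q /=; exact: prjC_nrm.
have hr : nrm r.1 <= C0 * ((1 + C1) * nrm y).
  have Vr' : V (r.1, r.2) by rewrite -surjective_pairing; case: Vr.
  have fr : f r.1 = 0 by case: Vr.
  rewrite (le_trans (hC0 _ _ Vr' fr))// ler_wpM2l//; have -> : r.2 = y - q.2 by rewrite -rq2 addrK.
  rewrite (le_trans (nrmDB _ _))// mulrDl mul1r lerD//.
  exact: le_trans (nrm_snd q) hq.
rewrite (le_trans (nrmD _ _))// mulrDl -mulrA lerD//.
exact: le_trans (nrm_fst q) hq.
Qed.
End LowerBound.

(** * Hilbert modules and their corners *)

Section NormFacts.
Context (R : realType) (V : normedModType R[i]).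
Implicit Types (x y : V).

Lemma rnormE x : `|x| = (rnorm x)%:C.
Proof. by rewrite /rnorm RRe_real ?normr_real. Qed.

Lemma rnorm_ge0 x : 0 <= rnorm x.
Proof. by rewrite -lecR -rnormE normr_ge0. Qed.

Lemma rnormD x y : rnorm (x + y) <= rnorm x + rnorm y.
Proof. by rewrite -lecR rmorphD/= -!rnormE ler_normD. Qed.

Lemma rnormN x : rnorm (- x) = rnorm x.
Proof. by rewrite /rnorm normrN. Qed.

Lemma rnormB x y : rnorm (x - y) = rnorm (y - x).
Proof. by rewrite -rnormN opprB. Qed.

Lemma rnormT z x y : rnorm (x - y) <= rnorm (x - z) + rnorm (z - y).
Proof. by have := rnormD (x - z) (z - y); rewrite addrA subrK. Qed.

Lemma rnormZ c x : rnorm (c *: x) = cabs c * rnorm x.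
Proof. by apply: complexI; rewrite -rnormE normrZ cabsE rnormE rmorphM. Qed.

Lemma rnorm_eq0 x : rnorm x = 0 -> x = 0.
Proof. by move=> h; apply/eqP; rewrite -normr_eq0 rnormE h. Qed.

Lemma rnorm0 : rnorm (0 : V) = 0.
Proof. by rewrite /rnorm normr0. Qed.

Lemma rnorm_sum I (s : seq I) (P : pred I) (F : I -> V) :
  rnorm (\sum_(i <- s | P i) F i) <= \sum_(i <- s | P i) rnorm (F i).
Proof.
elim/big_ind2: _ => [|a b c d h1 h2|//]; first by rewrite rnorm0.
by rewrite (le_trans (rnormD _ _))// lerD.
Qed.

Lemma posC (e : R[i]) : 0 < e -> e = (complex.Re e)%:C /\ 0 < complex.Re e.
Proof.
move=> e0; have er := RRe_real (gtr0_real e0).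
by split; [rewrite er|rewrite -ltcR er].
Qed.

Lemma nbhs_rnorm x (A : set V) :
  nbhs x A <-> exists2 e : R, 0 < e & forall y, rnorm (x - y) < e -> A y.
Proof.
split.
  move=> /nbhs_ballP[e /= /posC[eE e0] he]; exists (complex.Re e) => // y hy.
  by apply: he; rewrite -ball_normE /= rnormE eE ltcR.
move=> [e e0 he]; apply/nbhs_ballP; exists e%:C; first by rewrite /= ltcR.
by move=> y; rewrite -ball_normE /= rnormE ltcR; exact: he.
Qed.

Lemma closure_rnorm (A : set V) x : closure A x <->
  forall e : R, 0 < e -> exists2 y, A y & rnorm (x - y) < e.
Proof.
split=> [h e e0|h B /nbhs_rnorm[e e0 he]].
  have [|y [Ay hy]] := h [set y | rnorm (x - y) < e].
    by apply/nbhs_rnorm; exists e.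
  by exists y.
by have [y Ay hy] := h _ e0; exists y; split=> //; exact: he.
Qed.

Lemma dense_rnorm (A : set V) : dense A <->
  forall x (e : R), 0 < e -> exists2 y, A y & rnorm (x - y) < e.
Proof.
split=> [h x e e0|h O [x Ox] oO].
  have [||y [hy Ay]] := h (ball x e%:C); last first.
  - by exists y => //; move: hy; rewrite -ball_normE /= rnormE ltcR.
  - by apply: ball_open; rewrite ltcR.
  - by exists x; apply: ballxx; rewrite ltcR.
have /nbhs_rnorm[e e0 he] := open_nbhs_nbhs (conj oO Ox).
by have [y Ay hy] := h x _ e0; exists y; split=> //; exact: he.
Qed.

Lemma closure_rnorm2 (A : set (V * V)) (x : V * V) : closure A x <->
  forall e : R, 0 < e -> exists2 y, A y & rnorm (x.1 - y.1) < e /\ rnorm (x.2 - y.2) < e.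
Proof.
split=> [h e e0|h B].
  have [|y [Ay hy]] := h [set y | rnorm (x.1 - y.1) < e /\ rnorm (x.2 - y.2) < e].
    exists ([set a | rnorm (x.1 - a) < e], [set a | rnorm (x.2 - a) < e]) => //=.
    by split; apply/nbhs_rnorm; exists e.
  by exists y.
move=> [[B1 B2] /= [/nbhs_rnorm[e e0 he] /nbhs_rnorm[d d0 hd]] hB].
have m0 : 0 < Num.min e d by rewrite lt_min e0.
have [y Ay [h1 h2]] := h _ m0; exists y; split=> //; apply: hB; split=> /=.
  by apply: he; rewrite (lt_le_trans h1)// ge_min lexx.
by apply: hd; rewrite (lt_le_trans h2)// ge_min lexx orbT.
Qed.
End NormFacts.

Lemma rcomplete (R : realType) (V : completeNormedModType R[i]) (u : nat -> V) (K : R) :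
  (forall n m, (n <= m)%N -> rnorm (u m - u n) <= K / n.+1%:R) ->
  exists l, forall n, rnorm (u n - l) <= K / n.+1%:R.
Proof.
move=> hu.
have cu : cauchy (u @ \oo).
  apply: cauchy_exP => _/posnumP[e]; have [eE e0] := posC (gt0 e).
  have [n hn] := invS_small K e0; exists (u n).
  exists n => // m /= nm; rewrite -ball_normE /= rnormE eE ltcR rnormB.
  exact: le_lt_trans (hu _ _ nm) hn.
have /cauchy_cvg cv := cu.
exists (lim (u @ \oo)) => n; apply/ler_addgt0Pl => e e0.
have /cv[N _ hN] : nbhs (lim (u @ \oo)) [set y | rnorm (lim (u @ \oo) - y) < e].
  by apply/nbhs_rnorm; exists e.
have := hN (maxn n N) (leq_maxr _ _) => /= hm.
rewrite (le_trans (rnormT (u (maxn n N)) _ _))// addrC lerD//.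
  by rewrite rnormB ltW.
by rewrite rnormB hu// leq_maxl.
Qed.

(** * Rank one and compact operators on H *)

Section HilbertSpace.
Context (R : realType) (H : hilbertType R).

(* An alias, so that a variable [H : hilbertType R] can carry an [hspaceType]
   instance. *)
Definition hsp : Type := H.
HB.instance Definition _ := GRing.Lmodule.copy hsp H.

Let hsp_nrm (x : H) : Num.sqrt (complex.Re (hdot x x)) = rnorm x.
Proof.
rewrite -hdot_norm rnormE -rmorphXn/= sqrtr_sqr ger0_norm//.
exact: rnorm_ge0.
Qed.

Let hsp_ge0 (x : hsp) : 0 <= complex.Re (hdot (x : H) x).
Proof. by rewrite -hdot_norm rnormE -rmorphXn/= sqr_ge0. Qed.

Let hsp_eq0 (x : hsp) : complex.Re (hdot (x : H) x) = 0 -> x = 0.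
Proof.
rewrite -hdot_norm rnormE -rmorphXn/= => /eqP; rewrite sqrf_eq0 => /eqP.
exact: rnorm_eq0.
Qed.

Let hsp_complete (u : nat -> hsp) (K : R) :
  (forall n m, (n <= m)%N ->
    Num.sqrt (complex.Re (hdot (u m - u n : H) (u m - u n))) <= K / n.+1%:R) ->
  exists l : hsp, forall n,
    Num.sqrt (complex.Re (hdot (u n - l : H) (u n - l))) <= K / n.+1%:R.
Proof.
move=> h; have [n m nm|l hl] := @rcomplete R H u K.
  by rewrite -hsp_nrm; exact: h.
by exists l => n; rewrite hsp_nrm; exact: hl.
Qed.

HB.instance Definition _ := Lmodule_isHspace.Build R hsp
  (@hdotDl R H) (@hdotZl R H) (@hdotC R H) hsp_ge0 hsp_eq0 hsp_complete.

Lemma nrm_hsp (h : H) : nrm (h : hsp) = rnorm h.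
Proof. exact: hsp_nrm. Qed.

Lemma ip_hsp (h k : H) : ip (h : hsp) k = hdot h k.
Proof. by []. Qed.

Lemma real_complex_continuous : continuous (fun r : R => r%:C : R[i]^o).
Proof.
move=> r A /nbhs_rnorm[e e0 he].
apply/nbhs_ballP; exists e => // s; rewrite -ball_normE /= => hs.
apply: he; have := cabsR (r - s); rewrite /cabs rmorphB /rnorm => ->; exact: hs.
Qed.

Definition theta_fun (a b : H) (z : H) : H := hdot z b *: a.

(** The real and imaginary parts of <z,b> are at most |b| on the unit ball, so its image lies in the
    image of a compact square. *)
Lemma theta_compact (a b : H) : theta_fun a b \in @compact_op R H.
Proof.
apply/compact_opP; split=> [c x y|].
  by rewrite /theta_fun hdotDl hdotZl scalerDl scalerA.
pose r := rnorm b; pose I := `[(- r), r]%classic : set R.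
pose f (p : R * R) : H := (p.1)%:C *: a + (p.2)%:C *: ('i *: a).
apply: (@precompact_subset _ _ (f @` (I `*` I))).
  move=> _ [z hz <-]; exists (complex.Re (hdot z b), complex.Im (hdot z b)).
    have hc : cabs (hdot z b) <= r.
      rewrite (le_trans (@cabs_ip R hsp z b))// !nrm_hsp.
      rewrite -[leRHS]mul1r ler_wpM2r ?rnorm_ge0//.
      by rewrite -lecR -rnormE; exact: hz.
    split; rewrite /I /= in_itv /= -ler_norml.
      by rewrite (le_trans (Re_le_cabs _)).
    have -> : complex.Im (hdot z b) = complex.Re (- 'i * hdot z b).
      by rewrite mulNr ReN ReI opprK.
    by rewrite (le_trans (Re_le_cabs _))// cabsM cabsN cabsi mul1r.
  by rewrite /f /theta_fun scalerA -scalerDl /= mulrC -complexE.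
apply: compact_precompact; first exact: norm_hausdorff.
apply: continuous_compact; last by apply: compact_setX; exact: segment_compact.
apply: continuous_subspaceT => p; apply: cvgD.
  apply: cvgZr_tmp; apply: (continuous_comp (f := fst) (g := fun r : R => r%:C : R[i]^o)).
    exact: cvg_fst.
  exact: real_complex_continuous.
apply: cvgZr_tmp; apply: (continuous_comp (f := snd) (g := fun r : R => r%:C : R[i]^o)).
  exact: cvg_snd.
exact: real_complex_continuous.
Qed.

Definition theta (a b : H) : kop H := Kop (theta_compact a b).

Lemma kop_ext (a b : kop H) : (forall z, a z = b z) -> a = b.
Proof. by move=> h; apply: val_inj; apply/funext. Qed.

Lemma kop_linear (a : kop H) : linear (a : H -> H).
Proof. by have /compact_opP[] := kfunP a. Qed.

Lemma hdot_ext (x y : H) : (forall z, hdot x z = hdot y z) -> x = y.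
Proof.
by move=> h; apply: (@rip_ext R hsp x y) => z; rewrite /rip !ip_hsp h.
Qed.

Lemma kop_form_ext (a b : kop H) :
  (forall h k, hdot (a h) k = hdot (b h) k) -> a = b.
Proof. by move=> h; apply: kop_ext => z; apply: hdot_ext => k. Qed.
End HilbertSpace.

Section CompactOperatorFacts.
Context (R : realType) (H : hilbertType R).
Implicit Types (a b : kop H) (h k z : H).

Lemma kop_net a (e : R) : 0 < e -> exists n (w : 'I_n -> H),
  forall h, rnorm h <= 1 -> exists j, rnorm (a h - w j) <= e.
Proof.
move=> e0; have /compact_opP[_] := kfunP a; rewrite precompactE compact_cover => cA.
have [p _|p _|D _ hD] := cA _ setT (fun p : H => ball p e%:C).
- by apply: ball_open; rewrite ltcR.
- by exists p => //; apply: ballxx; rewrite ltcR.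
pose s := finmap.enum_fset D.
exists (size s), (fun j => nth 0 s j) => h hh.
have [|p Dp] := hD (a h).
  apply: subset_closure; exists h => //=.
  by rewrite rnormE (_ : 1 = 1%:C)// lecR.
rewrite -ball_normE /= rnormE ltcR => hp.
have ps : p \in s by [].
have ps' : (index p s < size s)%N by rewrite index_mem.
by exists (Ordinal ps'); rewrite /= nth_index// rnormB ltW.
Qed.

Lemma kop_scale (a : kop H) (c : R[i]) h : a (c *: h) = c *: a h.
Proof. exact: (linZ (kop_linear a)). Qed.

Lemma kop0 (a : kop H) : a 0 = 0. Proof. exact: (lin0 (kop_linear a)). Qed.

(** A finite 1-net of the image of the unit ball bounds that image by 1 plus the sum of the norms of
    the net. *)
Lemma bdd_kop a : bdd (a : hsp H -> hsp H).
Proof.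
split; first exact: kop_linear.
have [n [w hw]] := kop_net a ltr01.
exists (1 + \sum_j rnorm (w j)) => h; rewrite !nrm_hsp.
have [->|h0] := eqVneq h 0.
  by rewrite kop0 !rnorm0 mulr0.
have nh : 0 < rnorm h.
  by rewrite lt0r rnorm_ge0 andbT; apply/eqP => /rnorm_eq0/eqP; rewrite (negPf h0).
have [|j hj] := hw (((rnorm h)^-1)%:C *: h).
  by rewrite rnormZ cabsR ger0_norm ?invr_ge0 ?rnorm_ge0// mulVf ?gt_eqF.
rewrite -ler_pdivrMr// mulrC.
have -> : (rnorm h)^-1 * rnorm (a h) = rnorm (a (((rnorm h)^-1)%:C *: h)).
  by rewrite kop_scale rnormZ cabsR ger0_norm ?invr_ge0 ?rnorm_ge0.
rewrite -[X in rnorm X](subrK (w j)) (le_trans (rnormD _ _))// lerD//.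
by rewrite (bigD1 j)//= lerDl sumr_ge0// => i _; exact: rnorm_ge0.
Qed.

(** Kept as a map on H rather than an element of [kop H]: it occurs only applied to vectors, as an
    argument of [theta] or [hat]. *)
Definition kadj a : H -> H := adj (a : hsp H -> hsp H).

Lemma kadjP a h k : hdot (a h) k = hdot h (kadj a k).
Proof. exact: (@adj_ip R (hsp H) (hsp H) a h k (bdd_kop a)). Qed.

Lemma hdotCC h k : hdot k h = conjc (hdot h k). Proof. exact: hdotC. Qed.

Lemma hdotZr (c : R[i]) h k : hdot h (c *: k) = conjc c * hdot h k.
Proof. exact: (@ipZr R (hsp H)). Qed.

Lemma hdot0l h : hdot 0 h = 0. Proof. exact: (@ip0l R (hsp H)). Qed.

Lemma hdotDr h k z : hdot h (k + z) = hdot h k + hdot h z.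
Proof. exact: (@ipDr R (hsp H)). Qed.

Lemma thetaE h k z : theta h k z = hdot z k *: h. Proof. by []. Qed.

Lemma theta_adj h k y z : hdot (theta h k y) z = hdot y (theta k h z).
Proof. by rewrite !thetaE hdotZl hdotZr -hdotC mulrC. Qed.

Lemma kmul_theta_l a h k : kmul a (theta h k) = theta (a h) k.
Proof. by apply: kop_ext => z /=; rewrite /theta_fun kop_scale. Qed.

Lemma kmul_theta_r a h k : kmul (theta h k) a = theta h (kadj a k).
Proof. by apply: kop_ext => z /=; rewrite /theta_fun kadjP. Qed.

Lemma kopD_E a b h : (a + b) h = a h + b h. Proof. by []. Qed.
Lemma kopZ_E (c : R[i]) a h : (c *: a) h = c *: a h. Proof. by []. Qed.
Lemma kop0_E h : (0 : kop H) h = 0. Proof. by []. Qed.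
Lemma kmul_theta h k y z : kmul (theta h k) (theta y z) = hdot y k *: theta h z.
Proof. by apply: kop_ext => w; rewrite kopZ_E /= /theta_fun hdotZl scalerA mulrC. Qed.

Lemma opnorm_le a (C : R) : 0 <= C ->
  (forall h k, cabs (hdot (a h) k) <= C * rnorm h * rnorm k) ->
  opnorm (@rnorm R H) a <= C.
Proof.
move=> C0 hC; apply: sup_le_ub.
  by exists (rnorm (a 0)), 0 => //=; rewrite rnorm0.
move=> _ [h /= hh <-].
have [->|a0] := eqVneq (rnorm (a h)) 0; first by [].
have na : 0 < rnorm (a h) by rewrite lt0r a0 rnorm_ge0.
rewrite -(ler_pM2r na) -expr2.
have -> : rnorm (a h) ^+ 2 = cabs (hdot (a h) (a h)).
  rewrite -hdot_norm rnormE -rmorphXn/= cabsR ger0_norm//.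
  by rewrite exprn_ge0// rnorm_ge0.
rewrite (le_trans (hC _ _))// ler_wpM2r ?rnorm_ge0//.
by rewrite -[leRHS]mulr1 ler_wpM2l.
Qed.

Lemma opnorm_ge a h : rnorm (a h) <= opnorm (@rnorm R H) a * rnorm h.
Proof.
have [K K0 hK] := bdd_pos (bdd_kop a).
have ub : has_ubound [set rnorm (a x) | x in [set x | rnorm x <= 1]].
  exists K => _ [x /= hx <-]; have := hK x; rewrite !nrm_hsp => /le_trans; apply.
  by rewrite -[leRHS]mulr1 ler_wpM2l// ltW.
have [->|h0] := eqVneq h 0; first by rewrite kop0 !rnorm0 mulr0.
have nh : 0 < rnorm h.
  by rewrite lt0r rnorm_ge0 andbT; apply/eqP => /rnorm_eq0/eqP; rewrite (negPf h0).
rewrite -ler_pdivrMr//; apply: ub_le_sup => //.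
exists (((rnorm h)^-1)%:C *: h) => /=.
  by rewrite rnormZ cabsR ger0_norm ?invr_ge0 ?rnorm_ge0// mulVf ?gt_eqF.
by rewrite kop_scale rnormZ cabsR ger0_norm ?invr_ge0 ?rnorm_ge0// mulrC.
Qed.

Lemma opnorm_ge0 a : 0 <= opnorm (@rnorm R H) a.
Proof.
have [K K0 hK] := bdd_pos (bdd_kop a).
have ub : has_ubound [set rnorm (a x) | x in [set x | rnorm x <= 1]].
  exists K => _ [x /= hx <-]; have := hK x; rewrite !nrm_hsp => /le_trans; apply.
  by rewrite -[leRHS]mulr1 ler_wpM2l// ltW.
by rewrite -(rnorm0 H) -(kop0 a); apply: ub_le_sup => //; exists 0; rewrite //= rnorm0.
Qed.
End CompactOperatorFacts.

Section ModuleFacts.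
Context (R : realType) (H : hilbertType R) (E : hilbertKModType H).
Implicit Types (x y z : E) (a b : kop H).

Lemma kact0r a : kact a (0 : E) = 0.
Proof. by have := kactZr 0 a (0 : E); rewrite !scale0r. Qed.

Lemma kactNr a x : kact a (- x) = - kact a x.
Proof. by rewrite -scaleN1r kactZr scaleN1r. Qed.

Lemma kactBr a x y : kact a (x - y) = kact a x - kact a y.
Proof. by rewrite kactDr kactNr. Qed.

Lemma kip_adjC x y h k : hdot (kip x y h) k = conjc (hdot (kip y x k) h).
Proof. by rewrite kip_adj hdotCC. Qed.

Lemma kipDr x y z : kip x (y + z) = kip x y + kip x z.
Proof.
apply: kop_form_ext => h k.
by rewrite kip_adj kipDl kopD_E hdotDr -!kip_adj -hdotDl.
Qed.

Lemma kipZr (c : R[i]) x y : kip x (c *: y) = conjc c *: kip x y.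
Proof.
apply: kop_form_ext => h k.
by rewrite kip_adj kipZl kopZ_E hdotZr -kip_adj -hdotZl.
Qed.

Lemma kip0r x : kip x 0 = 0.
Proof. by have := kipZr 0 x (0 : E); rewrite conjc0 !scale0r. Qed.

Lemma kipNr x y : kip x (- y) = - kip x y.
Proof. by rewrite -scaleN1r kipZr rmorphN rmorph1 scaleN1r. Qed.

Lemma kipMr a x y h : kip x (kact a y) h = kip x y (kadj a h).
Proof.
apply: hdot_ext => k; rewrite kip_adj kipM /= hdotCC kadjP -hdotCC -kip_adj//.
Qed.

Lemma kip_act_thetar x y h k (z : H) : kip x (kact (theta h k) y) z = kip x y (theta k h z).
Proof.
by apply: hdot_ext => w; rewrite kip_adj kipM /= -[theta_fun _ _ _]/(theta h k _)
  hdotCC theta_adj -hdotCC -kip_adj.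
Qed.

Lemma rnorm_sqr x : rnorm x ^+ 2 = opnorm (@rnorm R H) (kip x x).
Proof. by apply: complexI; rewrite rmorphXn/= -rnormE kip_norm. Qed.

Lemma kip_eq0 x : kip x x = 0 -> x = 0.
Proof.
move=> h; apply: rnorm_eq0; apply/eqP; rewrite -sqrf_eq0 eq_le sqr_ge0 andbT.
rewrite rnorm_sqr h opnorm_le// => y z.
rewrite kop0_E hdot0l !mul0r.
by rewrite -[cabs 0]/(complex.Re `|0|) normr0.
Qed.

End ModuleFacts.

(** * The corner of a unit vector *)

Record unitv (R : realType) (H : hilbertType R) := Unitv {
  uv :> H ; uvP : hdot uv uv = 1 }.

Section Corner.
Context (R : realType) (H : hilbertType R) (E : hilbertKModType H) (u : unitv H).

(* With e = [theta u u], a minimal projection, [corner E u] is the Hilbert space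
   eE, in which <p, q> is a multiple of e; that scalar is [cip p q]. *)
Definition cornerP : {pred E} := [pred x | kact (theta u u) x == x].

Lemma cornerP_submod : submod_closed cornerP.
Proof.
split; first by rewrite inE kact0r.
by move=> c x y; rewrite !inE kactDr kactZr => /eqP -> /eqP ->.
Qed.

HB.instance Definition _ :=
  GRing.isSubmodClosed.Build R[i] E cornerP cornerP_submod.

Record corner := Corner { cval :> E ; cvalP : cval \in cornerP }.
HB.instance Definition _ := [isSub for cval].
HB.instance Definition _ := [Choice of corner by <:].
HB.instance Definition _ := [SubChoice_isSubLmodule of corner by <:].

Lemma cvalD (p q : corner) : cval (p + q) = cval p + cval q. Proof. by []. Qed.
Lemma cvalB (p q : corner) : cval (p - q) = cval p - cval q. Proof. by []. Qed.
Lemma cvalZ (c : R[i]) (p : corner) : cval (c *: p) = c *: cval p. Proof. by []. Qed.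
Lemma cval0 : cval (0 : corner) = 0. Proof. by []. Qed.

Lemma cval_inj : injective cval. Proof. exact: val_inj. Qed.

Lemma cval_sum I (s : seq I) (P : pred I) (F : I -> corner) :
  cval (\sum_(i <- s | P i) F i) = \sum_(i <- s | P i) cval (F i).
Proof. exact: (big_morph cval cvalD cval0). Qed.

Lemma cval_fix (p : corner) : kact (theta u u) (cval p) = cval p.
Proof. by apply/eqP; have := cvalP p; rewrite inE. Qed.

Definition cip (p q : corner) : R[i] := hdot (kip (cval p) (cval q) u) u.

Lemma kip_corner (p q : corner) : kip (cval p) (cval q) = cip p q *: theta u u.
Proof.
apply: kop_ext => z; rewrite kopZ_E -{1}(cval_fix p) -{1}(cval_fix q).
rewrite kipM /= -[theta_fun _ _ _]/(theta u u _) kip_act_thetar !thetaE.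
by rewrite kop_scale hdotZl scalerA mulrC.
Qed.

Let cipDl x y z : cip (x + y) z = cip x z + cip y z.
Proof. by rewrite /cip cvalD kipDl kopD_E hdotDl. Qed.

Let cipZl (c : R[i]) x y : cip (c *: x) y = c * cip x y.
Proof. by rewrite /cip cvalZ kipZl kopZ_E hdotZl. Qed.

Let cipC x y : cip y x = conjc (cip x y).
Proof. by rewrite /cip kip_adjC. Qed.

(** The inner product <p,p> in the module is the scalar [cip p p] times [theta u u], an operator of
    norm 1. The corner therefore carries the norm of E. *)
Let cip_nrm p : Num.sqrt (complex.Re (cip p p)) = rnorm (cval p).
Proof.
have h0 : 0 <= complex.Re (cip p p).
  by have := kip_ge0 (cval p) u; rewrite /cip lecE /= => /andP[_].
have i0 : complex.Im (cip p p) = 0.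
  by have := kip_ge0 (cval p) u; rewrite /cip lecE /= => /andP[/eqP].
have cE : cip p p = (complex.Re (cip p p))%:C by rewrite [LHS]complexE i0 mulr0 addr0.
have u1 : rnorm (uv u) = 1.
  rewrite -nrm_hsp /nrm /rip ip_hsp uvP sqrtr1 //.
rewrite -[RHS]ger0_norm ?rnorm_ge0// -sqrtr_sqr rnorm_sqr; congr Num.sqrt.
apply/eqP; rewrite eq_le; apply/andP; split.
  have := opnorm_ge (kip (cval p) (cval p)) u; rewrite u1 mulr1; apply: le_trans.
  rewrite kip_corner kopZ_E thetaE uvP scale1r rnormZ u1 mulr1 {2}cE cabsR.
  exact: ler_norm.
apply: opnorm_le => // h k; rewrite kip_corner kopZ_E hdotZl cabsM {1}cE cabsR.
rewrite ger0_norm// -mulrA ler_wpM2l// thetaE hdotZl cabsM.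
rewrite (@le_trans _ _ ((rnorm h * rnorm (uv u)) * (rnorm (uv u) * rnorm k)))//.
  by rewrite ler_pM ?cabs_ge0// -!nrm_hsp; exact: (@cabs_ip R (hsp H)).
by rewrite u1 mulr1 mul1r.
Qed.

Let cip_ge0 x : 0 <= complex.Re (cip x x).
Proof. by have := kip_ge0 (cval x) u; rewrite /cip lecE /= => /andP[_]. Qed.

Let cip_eq0 x : complex.Re (cip x x) = 0 -> x = 0.
Proof.
move=> h; apply: cval_inj; apply: rnorm_eq0.
by rewrite -cip_nrm h sqrtr0.
Qed.

Lemma theta_unit_act (h : H) (x : E) : kact (theta u h) x \in cornerP.
Proof. by rewrite inE -kactM kmul_theta uvP scale1r. Qed.

(* The vectors [hat x h] are the coordinates of [x] in eE, and [kip] is recovered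
   from them ([hat_form]); operators on eE act on E coordinatewise. *)
Definition hat (x : E) (h : H) : corner := Corner (theta_unit_act h x).

Lemma rnorm_theta_act (h k : H) (x : E) :
  rnorm (kact (theta h k) x) <= rnorm h * rnorm k * rnorm x.
Proof.
rewrite -(ler_pXn2r (n := 2)) ?nnegrE ?mulr_ge0 ?rnorm_ge0// rnorm_sqr.
apply: opnorm_le => [|y z]; first by rewrite sqr_ge0.
rewrite kipM /= -[theta_fun _ _ _]/(theta h k _) kip_act_thetar !thetaE.
rewrite kop_scale !hdotZl !cabsM.
have cs (a b : H) : cabs (hdot a b) <= rnorm a * rnorm b.
  by rewrite -!nrm_hsp; exact: (@cabs_ip R (hsp H)).
have kk : cabs (hdot (kip x x k) k) <= rnorm x ^+ 2 * rnorm k ^+ 2.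
  rewrite (le_trans (cs _ _))// (expr2 (rnorm k)) mulrA ler_wpM2r ?rnorm_ge0//.
  by rewrite rnorm_sqr opnorm_ge.
rewrite (@le_trans _ _ (rnorm y * rnorm h * (rnorm x ^+ 2 * rnorm k ^+ 2) * (rnorm h * rnorm z)))//.
  by rewrite ler_pM ?mulr_ge0 ?cabs_ge0// ler_pM ?cabs_ge0// .
by rewrite !exprMn le_eqVlt; apply/orP; left; apply/eqP; ring.
Qed.

(** A limit in E of elements of the corner stays in it, because the corner is the fixed space of the
    bounded map given by the action of [theta u u]. *)
Let cip_complete (v : nat -> corner) (K : R) :
  (forall n m, (n <= m)%N ->
    Num.sqrt (complex.Re (cip (v m - v n) (v m - v n))) <= K / n.+1%:R) ->
  exists l, forall n,
    Num.sqrt (complex.Re (cip (v n - l) (v n - l))) <= K / n.+1%:R.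
Proof.
move=> hv; have [n m nm|l hl] := @rcomplete R E (fun n => cval (v n)) K.
  by rewrite -cvalB -cip_nrm; exact: hv.
have lP : l \in cornerP.
  rewrite inE; apply/eqP/eqP; rewrite -subr_eq0; apply/eqP/rnorm_eq0/eqP.
  rewrite eq_le rnorm_ge0 andbT; apply: (@limS_le _ ((rnorm (uv u) * rnorm (uv u) + 1) * K)) => n.
  rewrite add0r (le_trans (rnormT (cval (v n)) _ _))// -mulrA mulrDl mul1r lerD//.
  rewrite -{1}cval_fix -kactBr (le_trans (rnorm_theta_act _ _ _))//.
  by rewrite ler_wpM2l ?mulr_ge0 ?rnorm_ge0// rnormB.
by exists (Corner lP) => n; rewrite cip_nrm cvalB; exact: hl.
Qed.

HB.instance Definition _ := Lmodule_isHspace.Build R corner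
  cipDl cipZl cipC cip_ge0 cip_eq0 cip_complete.

Lemma nrm_corner (p : corner) : nrm p = rnorm (cval p).
Proof. exact: cip_nrm. Qed.

Lemma ip_corner (p q : corner) : ip p q = hdot (kip (cval p) (cval q) u) u.
Proof. by []. Qed.

Lemma rnorm_uv : rnorm (uv u) = 1.
Proof. by rewrite -nrm_hsp /nrm /rip ip_hsp uvP sqrtr1. Qed.

Lemma cval_hat x h : cval (hat x h) = kact (theta u h) x. Proof. by []. Qed.

Lemma hat_form (x y : E) (a b : H) : ip (hat x a) (hat y b) = hdot (kip x y b) a.
Proof.
rewrite ip_corner !cval_hat kipM /= -[theta_fun _ _ _]/(theta u a _).
by rewrite kip_act_thetar !thetaE uvP scale1r hdotZl uvP mulr1.
Qed.

Lemma hat_linear h : linear (hat^~ h).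
Proof. by move=> c x y; apply: cval_inj; rewrite /= kactDr kactZr. Qed.

Lemma hatD x y h : hat (x + y) h = hat x h + hat y h.
Proof. exact: (linD (hat_linear h)). Qed.

Lemma hatB x y h : hat (x - y) h = hat x h - hat y h.
Proof. exact: (linB (hat_linear h)). Qed.

Lemma hatZ c x h : hat (c *: x) h = c *: hat x h.
Proof. exact: (linZ (hat_linear h)). Qed.

Lemma hat0 h : hat 0 h = 0.
Proof. exact: (lin0 (hat_linear h)). Qed.

Lemma hat_sum I (s : seq I) (P : pred I) (F : I -> E) h :
  hat (\sum_(i <- s | P i) F i) h = \sum_(i <- s | P i) hat (F i) h.
Proof. exact: (lin_sum (hat_linear h)). Qed.

Lemma hat_cval (p : corner) h : hat (cval p) h = hdot u h *: p.
Proof.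
apply: cval_inj; rewrite cval_hat -{1}(cval_fix p) -kactM kmul_theta kactZl.
by rewrite cval_fix.
Qed.

Lemma hat_cval_unit (p : corner) : hat (cval p) u = p.
Proof. by rewrite hat_cval uvP scale1r. Qed.

Lemma hat_theta (a b : H) (x : E) h : hat (kact (theta a b) x) h = hdot a h *: hat x b.
Proof. by apply: cval_inj; rewrite /= -kactM kmul_theta kactZl. Qed.

Lemma hat_act (a : kop H) x h : hat (kact a x) h = hat x (kadj a h).
Proof. by apply: cval_inj; rewrite /= -kactM kmul_theta_r. Qed.

Lemma hat_argD x h k : hat x (h + k) = hat x h + hat x k.
Proof.
apply: cval_inj; rewrite /= -kactDl; congr kact; apply: kop_ext => z.
by rewrite kopD_E !thetaE hdotDr scalerDl.
Qed.

Lemma hat_argZ c x h : hat x (c *: h) = conjc c *: hat x h.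
Proof.
apply: cval_inj; rewrite /= -kactZl; congr kact; apply: kop_ext => z.
by rewrite kopZ_E !thetaE hdotZr scalerA.
Qed.

Lemma hat_arg_sum x n (c : 'I_n -> R[i]) (f : 'I_n -> H) :
  hat x (\sum_i c i *: f i) = \sum_i conjc (c i) *: hat x (f i).
Proof.
elim: n c f => [|n IH] c f.
  rewrite !big_ord0; have := hat_argZ 0 x 0; rewrite conjc0 !scale0r//.
by rewrite !big_ord_recl hat_argD hat_argZ IH.
Qed.

Lemma nrm_hat_le x h : nrm (hat x h) <= rnorm x * rnorm h.
Proof.
rewrite nrm_corner (le_trans (rnorm_theta_act _ _ _))//.
by rewrite rnorm_uv mul1r mulrC.
Qed.

(** With [nrm_hat_le]: the norm of x is the operator norm of the conjugate linear map h ->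
    [hat x h]. *)
Lemma rnorm_le_hat x (C : R) : 0 <= C ->
  (forall h, nrm (hat x h) <= C * rnorm h) -> rnorm x <= C.
Proof.
move=> C0 hC; rewrite -(ler_pXn2r (n := 2)) ?nnegrE ?rnorm_ge0// rnorm_sqr.
apply: opnorm_le => [|h k]; first by rewrite sqr_ge0.
rewrite -hat_form (le_trans (cabs_ip _ _))//.
have -> : C ^+ 2 * rnorm h * rnorm k = (C * rnorm k) * (C * rnorm h) by ring.
by rewrite ler_pM ?nrm_ge0.
Qed.

Lemma hat_ext x y : (forall h, hat x h = hat y h) -> x = y.
Proof.
move=> h; apply/eqP; rewrite -subr_eq0; apply/eqP/rnorm_eq0/eqP.
rewrite eq_le rnorm_ge0 andbT; apply: rnorm_le_hat => // k.
by rewrite hatB h subrr nrm0 mul0r.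
Qed.

Lemma kip_hat_ext x y z w :
  (forall a b, ip (hat x a) (hat y b) = ip (hat z a) (hat w b)) -> kip x y = kip z w.
Proof. by move=> h; apply: kop_form_ext => b a; rewrite -!hat_form. Qed.
End Corner.

(** * Truncation to finitely many coordinates, lifting of operators and relations *)

Section Approximation.
Context (R : realType) (H : hilbertType R) (E : hilbertKModType H) (u : unitv H).
Local Notation X := (corner E u).
Local Notation hat := (hat u).
Implicit Types (x y : E).

Lemma subsp_span (V : hspaceType R) n (w : 'I_n -> V) :
  subsp [set x | exists c : 'I_n -> R[i], x = \sum_j c j *: w j].
Proof.
split.
- by exists (fun=> 0); rewrite big1// => j _; rewrite scale0r.
- move=> _ _ [c ->] [d ->]; exists (fun j => c j + d j).
  by rewrite -big_split; apply: eq_bigr => j _; rewrite scalerDl.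
- move=> a _ [c ->]; exists (fun j => a * c j).
  by rewrite scaler_sumr; apply: eq_bigr => j _; rewrite scalerA.
Qed.

(** The projection off S is a contraction that kills the net, so it sends the image of the unit ball
    into the ball of radius e; homogeneity does the rest. *)
Lemma kop_net_prj (a : kop H) (S : set (hsp H)) n (w : 'I_n -> H) (e : R) :
  csub S -> (forall j, S (w j)) ->
  (forall h, rnorm h <= 1 -> exists j, rnorm (a h - w j) <= e) ->
  forall h : hsp H, nrm ((a h : hsp H) - prj S (a h)) <= e * nrm h.
Proof.
move=> cS Sw hw h.
have [->|h0] := eqVneq h 0.
  by rewrite (kop0 a) (lin0 (prj_linear cS)) subr0 nrm0 mulr0.
have nh := nrm_gt0 h0.
pose h' : hsp H := ((nrm h)^-1)%:C *: h.
have [|j hj] := hw h'.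
  by rewrite -nrm_hsp nrmZ cabsR ger0_norm ?invr_ge0 ?nrm_ge0// mulVf ?gt_eqF.
have hE : h = (nrm h)%:C *: h' by rewrite scaleRA divff ?gt_eqF// scaleR1.
have key : nrm ((a h' : hsp H) - prj S (a h')) <= e.
  rewrite (le_trans _ hj)// -nrm_hsp.
  rewrite (_ : (a h' : hsp H) - prj S (a h') = (a h' - w j : hsp H) - prj S (a h' - w j : hsp H)).
    exact: prjC_nrm.
  by rewrite (linB (prj_linear cS)) (prj_id cS (Sw j)) opprB addrA subrK.
rewrite {1 2}hE (linZ (kop_linear a)) (linZ (prj_linear cS)) -scalerBr nrmZ cabsR.
by rewrite ger0_norm ?nrm_ge0// mulrC ler_wpM2r ?nrm_ge0.
Qed.

Lemma kop_onb_approx (a b : kop H) (e : R) : 0 < e ->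
  exists n (f : 'I_n -> hsp H), [/\ onb f,
    forall h : hsp H, nrm ((a h : hsp H) - onp f (a h)) <= e * nrm h &
    forall h : hsp H, nrm ((b h : hsp H) - onp f (b h)) <= e * nrm h].
Proof.
move=> e0; have [n1 [w1 hw1]] := kop_net a e0; have [n2 [w2 hw2]] := kop_net b e0.
pose w (j : 'I_(n1 + n2)) : hsp H :=
  match fintype.split j with inl i => w1 i | inr i => w2 i end.
pose S := [set x | exists c : 'I_(n1 + n2) -> R[i], x = \sum_j c j *: w j].
have sS : subsp S by exact: subsp_span.
have [n oS] : exists n, odim S n by exact: (odim_span sS (w := w)).
have [f of_ Sf] := oS; have cS := odim_csub oS.
have Sw j : S (w j).
  exists (fun i => (i == j)%:R); rewrite (bigD1 j)//= eqxx scale1r big1 ?addr0//.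
  by move=> i /negPf ->; rewrite scale0r.
have pE : prj S = onp f by rewrite Sf; exact: prj_onp.
exists n, f; split=> //; rewrite -pE.
  apply: (kop_net_prj (w := w1) cS) => // j.
  by have := Sw (lshift n2 j); rewrite /w (unsplitK (inl j)).
apply: (kop_net_prj (w := w2) cS) => // j.
by have := Sw (rshift n1 j); rewrite /w (unsplitK (inr j)).
Qed.

(** For orthonormal f, the action of the projection onto the span of f. By [frankE] it is built from
    the finitely many coordinates [hat x (f i)]. *)
Definition frank n (f : 'I_n -> H) x : E := \sum_i kact (theta (f i) (f i)) x.

Lemma frankE n (f : 'I_n -> H) x :
  frank f x = \sum_i kact (theta (f i) u) (cval (hat x (f i))).
Proof.
by apply: eq_bigr => i _; rewrite cval_hat -kactM kmul_theta uvP scale1r.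
Qed.

Lemma hat_frank n (f : 'I_n -> H) x h :
  hat (frank f x) h = hat x (onp (f : 'I_n -> hsp H) h : H).
Proof.
rewrite /frank hat_sum /onp hat_arg_sum; apply: eq_bigr => i _.
by rewrite hat_theta ip_hsp -hdotCC.
Qed.

(** For k orthogonal to the f i, |hat x k|^2 = <<x,x> k, k> only sees the component of <x,x> k off
    the span. An error e^2 for <x,x> thus becomes e for x. *)
Lemma frank_approx1 x (e : R) n (f : 'I_n -> hsp H) : 0 <= e -> onb f ->
  (forall h : hsp H, nrm ((kip x x h : hsp H) - onp f (kip x x h)) <= e ^+ 2 * nrm h) ->
  rnorm (x - frank f x) <= e.
Proof.
move=> e0 of_ hf; apply: (rnorm_le_hat (u := u)) => // h.
have -> : hat (x - frank f x) h = hat x ((h : hsp H) - onp f h : hsp H).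
  rewrite hatB hat_frank; have := hat_argD u x ((h : hsp H) - onp f h : hsp H) (onp f h).
  by rewrite [X in hat x X](_ : _ = h) ?subrK// => ->; rewrite addrK.
set k : hsp H := (h : hsp H) - onp f h.
have nk : nrm k <= rnorm h.
  rewrite -nrm_hsp /k -(prj_onp of_); apply: prjC_nrm.
  by apply: (@odim_csub _ _ _ n); exists f.
rewrite nrm_le ?mulr_ge0 ?rnorm_ge0// /rip hat_form -/(rip (kip x x k : hsp H) k).
have -> : rip (kip x x k : hsp H) k = rip ((kip x x k : hsp H) - onp f (kip x x k)) k.
  rewrite ripDl ripNl [X in _ - X](_ : _ = 0) ?subr0//.
  rewrite /rip /onp ip_suml big1// => i _.
  by rewrite ipZl [ip (f i) k]ipC (onp_orth _ _ of_ : ip k (f i) = 0) conjc0 mulr0.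
rewrite (le_trans (rip_le _ _))// (le_trans (ler_wpM2r (nrm_ge0 _) (hf _)))//.
rewrite exprMn -mulrA ler_wpM2l ?sqr_ge0// expr2 ler_pM ?nrm_ge0//.
Qed.

Lemma frank_approx x y (e : R) : 0 < e ->
  exists n (f : 'I_n -> hsp H), [/\ onb f, rnorm (x - frank f x) <= e &
    rnorm (y - frank f y) <= e].
Proof.
move=> e0; have e2 : 0 < e ^+ 2 by rewrite exprn_gt0.
have [n [f [of_ h1 h2]]] := kop_onb_approx (kip x x) (kip y y) e2.
by exists n, f; split=> //; apply: frank_approx1 => //; exact: ltW.
Qed.

Definition hat2 (p : E * E) h : X * X := (hat p.1 h, hat p.2 h).

Lemma linear_hat2 h : linear (hat2^~ h).
Proof.
by move=> c p q; apply/pair_equal_spec; split; rewrite /= hatD hatZ.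
Qed.

Lemma nrm_hat2_le (p : E * E) h : nrm (hat2 p h) <= (rnorm p.1 + rnorm p.2) * rnorm h.
Proof.
rewrite (le_trans (nrm_pair_le _))// mulrDl lerD// ; exact: nrm_hat_le.
Qed.

(** For a truncated p the lift is a finite sum over the coordinates, and the coordinate formula
    bounds it by a multiple of the norm of p; it then extends by continuity. *)
Lemma lift2 (T : X * X -> X) : bdd T ->
  exists L : E * E -> E, forall p h, hat (L p) h = T (hat2 p h).
Proof.
move=> bT; have lT := bT.1; have [K K0 hK] := bdd_pos bT.
suff /choice[L hL] : forall p : E * E, exists y, forall h, hat y h = T (hat2 p h).
  by exists L.
pose N (p : E * E) := rnorm p.1 + rnorm p.2.
apply: (@closed_dense_total R R[i] (E * E)%type E N (@rnorm R E) _ _ (@rcomplete R E)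
  (@rnormN R E) (fun p y => forall h, hat y h = T (hat2 p h)) K (ltW K0)).
- move=> p q; rewrite /N addrACA lerD//; exact: rnormD.
- by move=> p; rewrite /N !rnormN.
- move=> p y p' y' hy hy'; apply: (rnorm_le_hat (u := u)) => [|h].
    by rewrite mulr_ge0 ?(ltW K0)// /N addr_ge0 ?rnorm_ge0.
  rewrite hatB hy hy' -(linB lT) -(linB (linear_hat2 h)) (le_trans (hK _))//.
  by rewrite -mulrA ler_pM2l// nrm_hat2_le.
- move=> p e e0; have e2 : 0 < e / 2 by rewrite divr_gt0.
  have [n [f [of_ h1 h2]]] := frank_approx p.1 p.2 e2.
  exists (frank f p.1, frank f p.2).
  exists (\sum_i kact (theta (f i) u) (cval (T (hat2 p (f i))))); split; last first.
    by rewrite /N /= (splitr e) lerD.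
  move=> h; rewrite hat_sum.
  have fE x : hat (frank f x) h = \sum_i hdot (f i) h *: hat x (f i).
    by rewrite /frank hat_sum; apply: eq_bigr => i _; rewrite hat_theta.
  have -> : hat2 (frank f p.1, frank f p.2) h = \sum_i hdot (f i) h *: hat2 p (f i).
    rewrite [RHS]surjective_pairing; apply/pair_equal_spec; rewrite !fE; split.
      by rewrite (lin_sum (bdd_fst X).1).
    by rewrite (lin_sum (bdd_snd X).1).
  rewrite (lin_sum lT); apply: eq_bigr => i _.
  by rewrite hat_theta hat_cval_unit (linZ lT).
- move=> p y hpy h; apply/eqP; rewrite -subr_eq0; apply/eqP/nrm_small => e e0.
  pose c := (1 + K) * (rnorm h + 1).
  have h1 : 0 < rnorm h + 1 by rewrite ltr_wpDl// rnorm_ge0.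
  have c0 : 0 < c by rewrite mulr_gt0//; lra.
  have [p' [y' [hD hp hy]]] := hpy _ (divr_gt0 e0 c0).
  have -> : hat y h - T (hat2 p h) = hat (y - y') h - T (hat2 (p - p') h).
    by rewrite hatB (linB (linear_hat2 h)) (linB lT) hD subrACA subrr subr0.
  apply: (@le_trans _ _ (e / c * rnorm h + K * (e / c * rnorm h))).
    rewrite (le_trans (nrmDB _ _))// lerD//.
      by rewrite (le_trans (nrm_hat_le _ _ _))// ler_wpM2r ?rnorm_ge0.
    rewrite (le_trans (hK _))// ler_pM2l// (le_trans (nrm_hat2_le _ _))//.
    by rewrite ler_wpM2r ?rnorm_ge0.
  have -> : e / c * rnorm h + K * (e / c * rnorm h) = e / c * ((1 + K) * rnorm h) by ring.
  rewrite mulrAC ler_pdivrMr// ler_pM2l// /c ler_pM2l; lra.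
Qed.

Lemma lift1 (l : X -> X) : bdd l ->
  exists L : E -> E, forall x h, hat (L x) h = l (hat x h).
Proof.
move=> bl; have [L hL] := lift2 (bdd_comp bl (bdd_fst X)).
by exists (fun x => L (x, 0)) => x h; rewrite hL.
Qed.

Section Lifted.
Variables (l : X -> X) (L : E -> E).
Hypotheses (bl : bdd l) (hL : forall x h, hat (L x) h = l (hat x h)).

Lemma lift_linear : linear L.
Proof.
move=> c x y; apply: (hat_ext (u := u)) => h.
by rewrite hL !hatD !hatZ !hL bl.1.
Qed.

Lemma lift_bounded : exists2 K : R, 0 <= K & forall x, rnorm (L x) <= K * rnorm x.
Proof.
have [K K0 hK] := bdd_pos bl; exists K; first exact: ltW.
move=> x; apply: (rnorm_le_hat (u := u)) => [|h].
  by rewrite mulr_ge0 ?(ltW K0) ?rnorm_ge0.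
by rewrite hL (le_trans (hK _))// -mulrA ler_pM2l// nrm_hat_le.
Qed.

Lemma lift_adjointable : adjointable L.
Proof.
split; first exact: lift_linear.
  have [K K0 hK] := lift_bounded; exists K%:C => x.
  by rewrite !rnormE -rmorphM/= lecR.
have [S hS] := lift1 (adj_bdd bl); exists S => x y.
by apply: (kip_hat_ext (u := u)) => a b; rewrite hL hS adj_ip.
Qed.
End Lifted.

Lemma adjointable_bounded (T : E -> E) : adjointable T ->
  exists2 K : R, 0 <= K & forall x, rnorm (T x) <= K * rnorm x.
Proof.
move=> [_ [M hM] _].
exists `|complex.Re M| => // x.
have := hM x; rewrite !rnormE lecE mulrC => /andP[_]; rewrite ReZ /= mulrC => /le_trans; apply.
by rewrite ler_wpM2r ?rnorm_ge0// ler_norm.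
Qed.

(* [res] and [hatset] are mutually inverse between the closed K(H)-linear
   relations on E and the closed linear relations on the corner. *)
Definition res (t : set (E * E)) : set (X * X) := [set p | t (cval p.1, cval p.2)].

Definition hatset (V : set (X * X)) : set (E * E) := [set p | forall h, V (hat2 p h)].

Lemma closed_rnorm (t : set (E * E)) : closed t <->
  (forall p, (forall e : R, 0 < e -> exists2 q, t q &
     rnorm (p.1 - q.1) < e /\ rnorm (p.2 - q.2) < e) -> t p).
Proof.
split=> [ct p h|h p].
  by apply: ct; apply/closure_rnorm2.
by move/closure_rnorm2; exact: h.
Qed.

Lemma csub_res (t : set (E * E)) : klinear t -> closed t -> csub (res t).
Proof.
move=> [t0 tD tZ _ _] /closed_rnorm ct; split; first split=> //.
- by move=> p q hp hq; exact: (tD _ _ hp hq).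
- by move=> c p hp; exact: (tZ c _ hp).
move=> p hp; apply: ct => e e0; have e2 : 0 < e / 2 by rewrite divr_gt0.
have [q tq hq] := hp _ e2; exists (cval q.1, cval q.2) => //=.
have hlt : e / 2 < e by rewrite ltr_pdivrMr// ltr_pMr// ltr1n.
rewrite -!cvalB -!nrm_corner; split; apply: le_lt_trans hlt; apply: le_trans hq.
  exact: (nrm_fst (p - q)).
exact: (nrm_snd (p - q)).
Qed.

Lemma hat_res (t : set (E * E)) p h : klinear t -> t p -> res t (hat2 p h).
Proof. by move=> [_ _ _ ta _]; case: p => x y; exact: ta. Qed.

(** A truncation of p is a sum of module multiples of its coordinates, hence lies in t as soon as
    the coordinates do. Truncations approach p, and t is closed. *)
Lemma hatset_res (t : set (E * E)) : klinear t -> closed t -> hatset (res t) = t.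
Proof.
move=> kt /closed_rnorm ct; have [t0 tD tZ ta _] := kt.
apply/seteqP; split=> p hp; last by move=> h; exact: hat_res.
apply: ct => e e0; have e2 : 0 < e / 2 by rewrite divr_gt0.
have hlt : e / 2 < e by rewrite ltr_pdivrMr// ltr_pMr// ltr1n.
have [n [f [of_ h1 h2]]] := frank_approx p.1 p.2 e2.
exists (frank f p.1, frank f p.2); last by split; exact: le_lt_trans hlt.
have -> : (frank f p.1, frank f p.2) =
    \sum_i (kact (theta (f i) u) (cval (hat p.1 (f i))), kact (theta (f i) u) (cval (hat p.2 (f i)))).
  rewrite !frankE [RHS]surjective_pairing; apply/pair_equal_spec; split.
    by rewrite (lin_sum (T := fun q : E * E => q.1)).
  by rewrite (lin_sum (T := fun q : E * E => q.2)).
apply: big_ind => // i _; apply: ta; exact: hp.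
Qed.

Lemma hat2_cval (p : X * X) h : hat2 (cval p.1, cval p.2) h = hdot u h *: p.
Proof. by apply/pair_equal_spec; rewrite !hat_cval. Qed.

Lemma closed_hatset (V : set (X * X)) : csub V -> closed (hatset V).
Proof.
move=> cV; apply/closed_rnorm => p hp h; apply: cV.2 => e e0.
have h1 : 0 < 2 * (rnorm h + 1) by rewrite mulr_gt0// ltr_wpDl// rnorm_ge0.
have [q hq [h2 h3]] := hp _ (divr_gt0 e0 h1); exists (hat2 q h) => //.
rewrite -(linB (linear_hat2 h)) (le_trans (nrm_hat2_le _ _))//.
apply: (@le_trans _ _ ((e / (2 * (rnorm h + 1)) + e / (2 * (rnorm h + 1))) * rnorm h)).
  by rewrite ler_wpM2r ?rnorm_ge0// lerD//= ltW.
have -> : (e / (2 * (rnorm h + 1)) + e / (2 * (rnorm h + 1))) * rnorm h = e * rnorm h / (rnorm h + 1).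
  by field; rewrite gt_eqF// ltr_wpDl// rnorm_ge0.
by rewrite ler_pdivrMr ?ltr_wpDl ?rnorm_ge0// ler_pM2l// lerDl.
Qed.
End Approximation.

(** * Comparison of the gap, the dimension and the Fredholm property *)

Section GapTransfer.
Context (R : realType) (H : hilbertType R) (E : hilbertKModType H) (u : unitv H).
Local Notation X := (corner E u).
Local Notation hat := (hat u).
Local Notation hat2 := (hat2 u).
Implicit Types (V W : set (X * X)) (p q : E * E).

Lemma kip2_hat p q a b : hdot (kip2 p q b) a = ip (hat2 p a) (hat2 q b).
Proof. by rewrite ip_pair /= !hat_form; exact: hdotDl. Qed.

Lemma norm2_ge p h : nrm (hat2 p h) <= norm2 p * rnorm h.
Proof.
rewrite nrm_le ?mulr_ge0 ?sqrtr_ge0 ?rnorm_ge0//.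
rewrite exprMn sqr_sqrtr ?opnorm_ge0// /rip -kip2_hat.
rewrite (le_trans (ler_norm _))// (le_trans (Re_le_cabs _))//.
rewrite (le_trans (@cabs_ip R (hsp H) _ _))// !nrm_hsp expr2 mulrA.
by rewrite ler_wpM2r ?rnorm_ge0// opnorm_ge.
Qed.

Lemma norm2_le p (C : R) : 0 <= C -> (forall h, nrm (hat2 p h) <= C * rnorm h) ->
  norm2 p <= C.
Proof.
move=> C0 hC; rewrite /norm2 -[leRHS]ger0_norm// -sqrtr_sqr ler_wsqrtr//.
apply: opnorm_le => [|h k]; first by rewrite sqr_ge0.
rewrite kip2_hat (le_trans (cabs_ip _ _))//.
have -> : C ^+ 2 * rnorm h * rnorm k = (C * rnorm k) * (C * rnorm h) by ring.
by rewrite ler_pM ?nrm_ge0.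
Qed.

Lemma norm2_cval (z : X * X) : norm2 (cval z.1, cval z.2) = nrm z.
Proof.
apply/eqP; rewrite eq_le; apply/andP; split.
  apply: norm2_le => [|h]; first exact: nrm_ge0.
  rewrite hat2_cval nrmZ mulrC ler_wpM2l ?nrm_ge0//.
  rewrite (le_trans (@cabs_ip R (hsp H) _ _))// !nrm_hsp.
  by rewrite rnorm_uv mul1r.
have := norm2_ge (cval z.1, cval z.2) u.
by rewrite hat2_cval uvP scale1r rnorm_uv mulr1.
Qed.

(** The projection onto V, lifted coordinatewise by [lift2], shows that the projection in E + E
    exists, so the default of [xget] is not met; uniqueness on the corner identifies its
    coordinates. *)
Lemma orth_proj_hat V p h : csub V ->
  hat2 (orth_proj (hatset V) p) h = prj V (hat2 p h).
Proof.
move=> cV; have bP := bdd_prj cV.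
have ex : exists q, hatset V q /\ forall r, hatset V r -> kip2 (p - q) r = 0.
  have [L1 hL1] := lift2 (bdd_comp (bdd_fst X) bP).
  have [L2 hL2] := lift2 (bdd_comp (bdd_snd X) bP).
  have hq k : hat2 (L1 p, L2 p) k = prj V (hat2 p k).
    by rewrite [RHS]surjective_pairing /hat2 /= hL1 hL2.
  exists (L1 p, L2 p); split=> [k|r hr]; first by rewrite hq; exact: prj_in.
  apply: kop_form_ext => b a; rewrite kip2_hat kop0_E hdot0l.
  rewrite (linB (linear_hat2 u a)) hq.
  apply: (orth_ip cV.1 (prj_orthP cV _)); exact: hr.
have [h1 h2] := xgetPex 0 ex; apply/esym/(prj_uniq cV); first exact: h1.
move=> v Vv; set q := xget _ _ in h1 h2 *.
have hv : hatset V (cval v.1, cval v.2).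
  by have [_ _ VZ] := cV.1; move=> k; rewrite hat2_cval; exact: VZ.
have := kip2_hat (p - q) (cval v.1, cval v.2) h u.
rewrite h2// kop0_E hdot0l hat2_cval uvP scale1r (linB (linear_hat2 u h)).
by rewrite /rip => <-.
Qed.

Lemma gap_le V W (d : R) : csub V -> csub W -> 0 <= d -> pgap V W d ->
  gap (hatset V) (hatset W) <= d.
Proof.
move=> cV cW d0 hd; apply: sup_le_ub.
  exists (norm2 (orth_proj (hatset V) 0 - orth_proj (hatset W) 0)), 0 => //=.
  apply: norm2_le => // h.
  by rewrite (lin0 (linear_hat2 u h)) nrm0 mul1r rnorm_ge0.
move=> _ [p /= hp <-]; apply: norm2_le => // h.
rewrite (linB (linear_hat2 u h)) !orth_proj_hat// (le_trans (hd _))//.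
rewrite ler_wpM2l// (le_trans (norm2_ge _ _))//.
by rewrite -[leRHS]mul1r ler_wpM2r ?rnorm_ge0.
Qed.

Lemma pgap_gap V W : csub V -> csub W -> pgap V W (gap (hatset V) (hatset W)).
Proof.
move=> cV cW z; have [->|z0] := eqVneq z 0.
  by rewrite !(lin0 (prj_linear _))// subrr nrm0 mulr0.
have nz := nrm_gt0 z0.
have h2 : pgap V W 2.
  by move=> x; rewrite (le_trans (nrmDB _ _))// (_ : 2 = 1 + 1 :> R)// mulrDl
    mul1r lerD// prj_nrm.
pose D (p : E * E) := orth_proj (hatset V) p - orth_proj (hatset W) p.
have Dh p h : hat2 (D p) h = prj V (hat2 p h) - prj W (hat2 p h).
  by rewrite (linB (linear_hat2 u h)) !orth_proj_hat.
(* [opnorm] is a supremum that defaults to 0 on unbounded sets; the bound 2 for a difference of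
   projections rules this out. *)
have ub : has_ubound [set norm2 (D p) | p in [set p | norm2 p <= 1]].
  exists 2 => _ [p /= hp <-]; apply: norm2_le => // h.
  rewrite Dh (le_trans (h2 _))// ler_wpM2l// (le_trans (norm2_ge _ _))//.
  by rewrite -[leRHS]mul1r ler_wpM2r ?rnorm_ge0.
pose y : X * X := ((nrm z)^-1)%:C *: z.
have ny : nrm y = 1.
  by rewrite nrmZ cabsR ger0_norm ?invr_ge0 ?nrm_ge0// mulVf ?gt_eqF.
rewrite -ler_pdivrMr//.
have -> : nrm (prj V z - prj W z) / nrm z = nrm (prj V y - prj W y).
  rewrite !(linZ (prj_linear _))// -scalerBr nrmZ cabsR ger0_norm ?invr_ge0 ?nrm_ge0//.
  by rewrite mulrC.
apply: (@le_trans _ _ (norm2 (D (cval y.1, cval y.2)))).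
  have := norm2_ge (D (cval y.1, cval y.2)) u.
  by rewrite Dh hat2_cval uvP scale1r rnorm_uv mulr1.
have hy : norm2 (cval y.1, cval y.2) <= 1 by rewrite norm2_cval ny.
by apply: ub_le_sup => //; exists (cval y.1, cval y.2).
Qed.

Lemma gap_ge0 (t s : set (E * E)) : 0 <= gap t s.
Proof.
rewrite /gap /opnorm; set S := (X in sup X).
have [hs|/sup_out ->//] := pselect (has_sup S).
have [[x Sx] ub] := hs; apply: le_trans (ub_le_sup ub Sx).
by have [p _ <-] := Sx; exact: sqrtr_ge0.
Qed.
End GapTransfer.

(** * Module dimension and dimension of the corner *)

Section Dimension.
Context (R : realType) (H : hilbertType R) (E : hilbertKModType H) (u : unitv H).
Local Notation X := (corner E u).
Local Notation hat := (hat u).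

Lemma minimal_theta (g : H) : hdot g g = 1 -> minimal_projection (theta g g).
Proof.
move=> g1; split.
- split=> [|h k]; last by rewrite theta_adj.
  by rewrite kmul_theta g1 scale1r.
- move=> h; have := congr1 (fun a : kop H => hdot (a g) g) h.
  rewrite thetaE g1 scale1r g1 kop0_E hdot0l => /eqP; rewrite oner_eq0//.
move=> q [qq qs] eq.
set c := hdot (q g) g.
have qg : q g = c *: g by rewrite -{1}eq.
have cJ : conjc c = c by rewrite /c -hdotCC -qs.
have qE h : q h = (c * hdot h g) *: g.
  have e1 : q h = hdot (q h) g *: g by rewrite -{1}eq.
  by rewrite {1}e1 qs qg hdotZr cJ.
have cc : c * c = c.
  have := congr1 (fun a : kop H => hdot (a g) g) qq.
  rewrite /= !qE !hdotZl g1 !mulr1 //.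
have : c * (c - 1) = 0 by rewrite mulrBr mulr1 cc subrr.
move=> /eqP; rewrite mulf_eq0 subr_eq0 => /orP[/eqP c0|/eqP c1].
  by left; apply: kop_ext => h; rewrite qE c0 mul0r scale0r.
by right; apply: kop_ext => h; rewrite qE c1 mul1r.
Qed.

(** A unit vector g in the range of p gives the projection [theta g g] below p; by minimality it
    equals p. *)
Lemma minimal_theta_exists (p : kop H) : minimal_projection p ->
  exists2 g : H, hdot g g = 1 & p = theta g g.
Proof.
move=> [[pp ps] p0 pm].
have [z hz] : exists z, p z != 0.
  apply: contrapT => h; apply: p0; apply: kop_ext => z.
  by apply/eqP; apply: contrapT => /negP hz; apply: h; exists z.
have nz : 0 < rnorm (p z).
  by rewrite lt0r rnorm_ge0 andbT; apply/eqP => /rnorm_eq0/eqP; rewrite (negPf hz).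
pose g := ((rnorm (p z))^-1)%:C *: p z.
have g1 : hdot g g = 1.
  rewrite -hdot_norm rnormE rnormZ cabsR ger0_norm ?invr_ge0 ?rnorm_ge0//.
  by rewrite mulVf ?gt_eqF// rmorph1 expr1n.
have ppz : p (p z) = p z by rewrite -[RHS](congr1 (fun a : kop H => a z) pp).
have pg : p g = g by rewrite kop_scale ppz.
exists g => //.
have [[qp qs] q0 _] := minimal_theta g1.
case: (pm (theta g g)) => //.
by rewrite kmul_theta_l pg.
Qed.

(** An orthonormal basis of the corner is one of M in the module sense. Conversely <b i, b i> =
    [theta (g i) (g i)] for any basis of M, and the coordinates [hat (b i) (g i)] form an
    orthonormal basis of the corner, so its cardinality is n. *)
Lemma dimK_corner (M : set E) n : submodule M ->
  odim [set p : X | M (cval p)] n -> dimK M = n.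
Proof.
move=> [M0 MD MZ Ma] oM; set MX := [set p : X | M (cval p)] in oM.
have Msum m (F : 'I_m -> E) : (forall i, M (F i)) -> M (\sum_i F i).
  by move=> h; apply: big_ind => // i _; exact: h.
have sMX := (odim_csub oM).1.
apply: xget_unique.
  have [f of_ Mf] := oM; pose B := [set cval (f i) | i in [set: 'I_n]].
  have fi : injective f.
    move=> i j e; have := of_ i j; rewrite e of_ eqxx; case: eqVneq => // _ /eqP.
    by rewrite oner_eq0.
  exists B.
    split.
    - by move=> _ [i _ <-]; exact: (odim_in i of_ Mf).
    - move=> x Mx; apply/closure_rnorm => e e0.
      have e2 : 0 < e / 2 by rewrite divr_gt0.
      have [m [g [og h1 _]]] := frank_approx u x x e2.
      exists (frank g x); last first.
        by rewrite (le_lt_trans h1)// ltr_pdivrMr// ltr_pMr// ltr1n.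
      move=> S [[S0 SD SZ Sa] BS]; rewrite (frankE u).
      apply: big_ind => // i _; apply: Sa.
      have e1 : MX (hat x (g i)) by exact: Ma.
      have -> : hat x (g i) = onp f (hat x (g i)) by rewrite Mf in e1.
      rewrite /onp cval_sum; apply: big_ind => // j _.
      by rewrite cvalZ; apply: SZ; apply: BS; exists j.
    - move=> _ _ [i _ <-] [j _ <-] hne; rewrite kip_corner.
      have -> : cip (f i) (f j) = ip (f i) (f j) by [].
      rewrite of_; case: eqVneq => [e|_]; last by rewrite scale0r.
      by case: hne; rewrite e.
    - move=> _ [i _ <-]; rewrite kip_corner.
      have -> : cip (f i) (f i) = ip (f i) (f i) by [].
      by rewrite of_ eqxx scale1r; apply: minimal_theta; exact: uvP.
  have iB : {in [set: 'I_n] &, injective (fun i => cval (f i))}.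
    by move=> i j _ _ /cval_inj/fi.
  exact: card_eq_trans (inj_card_eq iB) (card_esym card_II).
move=> m [B [BM Mcl Borth Bmin] cB].
have : ([set: 'I_m] #= B)%card by apply: card_esym; exact: card_eq_trans cB card_II.
move=> /card_set_bijP[b [bB /(_ _ _)]] => bi bs.
have Bb i : B (b i) by exact: bB.
have /choice[g hg] : forall i, exists g : H, hdot g g = 1 /\ kip (b i) (b i) = theta g g.
  by move=> i; have [g g1 ge] := minimal_theta_exists (Bmin _ (Bb i)); exists g.
pose be i : X := hat (b i) (g i).
have obe : onb be.
  move=> i j; rewrite /be hat_form; case: eqVneq => [->|ij].
    by rewrite (hg j).2 thetaE hdotZl !(hg j).1 mulr1.
  rewrite Borth ?kop0_E ?hdot0l// => e; move/eqP: ij; apply.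
  by apply: bi => //; rewrite inE.
have Mbe i : MX (be i) by apply: Ma; apply: BM; exact: Bb.
(* The coordinates of b i vanish at vectors orthogonal to g i, so the single coordinate [be i]
   determines b i. *)
have hatb i k : hat (b i) k = hdot (g i) k *: be i.
  have [g1 ge] := hg i.
  apply/eqP; rewrite -subr_eq0; apply/eqP/rip_eq0.
  have kE : (k : H) = hdot k (g i) *: g i + (k - hdot k (g i) *: g i) by rewrite addrC subrK.
  set k' := k - _ in kE.
  have k'0 : hdot k' (g i) = 0.
    by rewrite /k' hdotDl -scaleNr hdotZl g1 mulr1 subrr.
  have h0 : hat (b i) k' = 0.
    apply: rip_eq0; rewrite /rip hat_form ge thetaE hdotZl k'0 mul0r//.
  rewrite kE hat_argD hat_argZ h0 addr0 -hdotCC -/(be i).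
  rewrite (_ : hdot (g i) (_ + _) = hdot (g i) k) ?subrr ?rip0l//.
  by rewrite -kE.
have perp (p : X) : MX p -> (forall i, ip p (be i) = 0) -> p = 0.
  move=> Mp hp; apply: cval_inj; apply: kip_eq0.
  have kb i : kip (cval p) (b i) = 0.
    apply: kop_form_ext => k h; rewrite -(hat_form u) hatb hat_cval ipZl ipZr hp.
    by rewrite !mulr0 kop0_E hdot0l.
  have : closure (smallest (@submodule _ _ E) B) (cval p) by exact: Mcl.
  move=> /closure_rnorm hcl'.
  apply: kop_form_ext => k h; rewrite kop0_E hdot0l; apply: cabs_eq0; apply/eqP.
  rewrite eq_le cabs_ge0 andbT; apply/ler_addgt0Pl => e e0; rewrite addr0.
  pose c := rnorm (cval p) * rnorm h * rnorm k + 1.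
  have c0 : 0 < c by rewrite ltr_wpDl// !mulr_ge0 ?rnorm_ge0.
  have [x Bx hx] := hcl' _ (divr_gt0 e0 c0).
  (* The vectors orthogonal to p form a submodule containing B, hence containing the submodule
     generated by B, of which x is a member. *)
  have px : kip (cval p) x = 0.
    apply: (Bx [set y | kip (cval p) y = 0]); split.
      split=> /=.
      - exact: kip0r.
      - by move=> y z hy hz; rewrite kipDr hy hz addr0.
      - by move=> a y hy; rewrite kipZr hy scaler0.
      - by move=> a y hy; apply: kop_ext => z; rewrite kipMr hy.
    move=> y By; have [i _ <-] := bs y By; exact: kb.
  have -> : kip (cval p) (cval p) = kip (cval p) (cval p - x).
    by rewrite kipDr kipNr px subr0.
  rewrite -(hat_form u) (le_trans (cabs_ip _ _))//.
  apply: (@le_trans _ _ ((rnorm (cval p) * rnorm h) * (e / c * rnorm k))).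
    rewrite ler_pM ?nrm_ge0//; first exact: nrm_hat_le.
    by rewrite (le_trans (nrm_hat_le _ _ _))// ler_wpM2r ?rnorm_ge0// ltW.
  have -> : rnorm (cval p) * rnorm h * (e / c * rnorm k) =
      e * (rnorm (cval p) * rnorm h * rnorm k) / c by ring.
  by rewrite ler_pdivrMr// ler_pM2l// /c lerDl.
apply: (odim_uniq _ oM); exists be => //.
apply/seteqP; split=> p /=; last first.
  move=> ->; apply: subsp_sum => // i _; have [_ _ h] := sMX; exact: h.
move=> Mp; apply/eqP; rewrite -subr_eq0; apply/eqP; apply: perp; last first.
  by move=> i; exact: onp_orth.
apply: (subspB sMX) => //; apply: subsp_sum => // i _.
by have [_ _ h] := sMX; exact: h.
Qed.
End Dimension.

(** * From Fredholm operators on E to the corner *)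

Section FromModule.
Context (R : realType) (H : hilbertType R) (E : hilbertKModType H) (u : unitv H).
Local Notation X := (corner E u).
Local Notation hat := (hat u).
Local Notation hat2 := (hat2 u).
Local Notation res := (@res R H E u).
Implicit Types (t : set (E * E)) (T : E -> E).

Lemma adjointable_linear T : adjointable T -> linear T. Proof. by case. Qed.

Lemma kadj_kip (x y : E) h : kadj (kip x y) h = kip y x h.
Proof. by apply: hdot_ext => k; rewrite [LHS]hdotCC -kadjP kip_adj [RHS]hdotCC. Qed.

Lemma rnorm_rank_one (a b z : E) : rnorm (rank_one a b z) <= rnorm a * rnorm b * rnorm z.
Proof.
apply: (rnorm_le_hat (u := u)) => [|h]; first by rewrite !mulr_ge0 ?rnorm_ge0.
rewrite hat_act kadj_kip (le_trans (nrm_hat_le _ _ _))//.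
have hk : rnorm (kip a z h) <= rnorm a * rnorm z * rnorm h.
  have [->|k0] := eqVneq (rnorm (kip a z h)) 0.
    by rewrite !mulr_ge0 ?rnorm_ge0.
  have nk : 0 < rnorm (kip a z h) by rewrite lt0r k0 rnorm_ge0.
  rewrite -(ler_pM2r nk) -expr2.
  have -> : rnorm (kip a z h) ^+ 2 = cabs (hdot (kip a z h) (kip a z h)).
    rewrite -hdot_norm rnormE -rmorphXn/= cabsR ger0_norm//.
    by rewrite exprn_ge0// rnorm_ge0.
  rewrite -(hat_form u) (le_trans (cabs_ip _ _))//.
  have -> : rnorm a * rnorm z * rnorm h * rnorm (kip a z h) =
    rnorm a * rnorm (kip a z h) * (rnorm z * rnorm h) by ring.
  by rewrite ler_pM ?nrm_ge0// nrm_hat_le.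
have -> : rnorm a * rnorm b * rnorm z * rnorm h = rnorm b * (rnorm a * rnorm z * rnorm h) by ring.
by rewrite ler_wpM2l ?rnorm_ge0.
Qed.

Lemma rank_one_linear (a b : E) : linear (rank_one a b).
Proof. by move=> c x y; rewrite /rank_one kipDl kipZl kactDl kactZl. Qed.

Definition finrk (V : hspaceType R) (f : V -> V) :=
  bdd f /\ exists (F : set V) k, odim F k /\ forall p, F (f p).

Lemma finrk_dyad n (f g : 'I_n -> X) : finrk (dyad f g).
Proof.
split; first exact: bdd_dyad.
pose S := [set x | exists c : 'I_n -> R[i], x = \sum_j c j *: g j].
have [k oS] : exists k, odim S k.
  by apply: (odim_span _ (w := g)) => //; exact: subsp_span.
by exists S, k; split=> // p; exists (fun j => ip p (f j)).
Qed.

Lemma finrk_add (V : hspaceType R) (f g : V -> V) : finrk f -> finrk g ->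
  finrk (fun x => f x + g x).
Proof.
move=> [bf [F [k [oF hF]]]] [bg [G [m [oG hG]]]]; split; first exact: bdd_add.
have la : linear (fun p : V * V => p.1 + p.2).
  by move=> c p q; rewrite /= scalerDr addrACA.
have [d od] := odim_image la (odim_pair oF oG).
exists [set (p.1 + p.2) | p in F `*` G], d; split=> // p.
by exists (f p, g p) => //; split; [exact: hF|exact: hG].
Qed.

Lemma finrk_scale (V : hspaceType R) c (f : V -> V) : finrk f ->
  finrk (fun x => c *: f x).
Proof.
move=> [bf [F [k [oF hF]]]]; split; first exact: bdd_scale.
by exists F, k; split=> // p; have [_ _ h] := (odim_csub oF).1; exact: h.
Qed.

Lemma finrk_sum n (f : 'I_n -> X -> X) : (forall i, finrk (f i)) ->
  finrk (fun x => \sum_i f i x).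
Proof.
elim: n f => [|n IH] f hf.
  have -> : (fun x => \sum_(i < 0) f i x) = dyad (fun _ : 'I_0 => 0) (fun=> 0) :> (X -> X).
    by apply/funext => x; rewrite big_ord0 /dyad big_ord0.
  exact: finrk_dyad.
have -> : (fun x => \sum_i f i x) = fun x => f ord0 x + \sum_i f (lift ord0 i) x.
  by apply/funext => x; rewrite big_ord_recl.
by apply: finrk_add => //; apply: IH => i.
Qed.

(** Compressed to the corner, a module rank one operator may have infinite rank. Truncating y to
    finitely many coordinates turns it into a dyad, at a small cost in norm. *)
Lemma rank_one_corner (x y : E) (d : R) : 0 < d -> exists2 g : X -> X, finrk g &
  forall p, nrm (hat (rank_one x y (cval p)) u - g p) <= d * nrm p.
Proof.
move=> d0; have x1 : 0 < rnorm x + 1 by rewrite ltr_wpDl// rnorm_ge0.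
have [n [f [of_ h1 _]]] := frank_approx u y y (divr_gt0 d0 x1).
exists (dyad (fun j => hat x (f j)) (fun j => hat y (f j))); first exact: finrk_dyad.
move=> p; have -> : dyad (fun j => hat x (f j)) (fun j => hat y (f j)) p =
    hat (rank_one x (frank f y) (cval p)) u.
  rewrite hat_act kadj_kip hat_frank /onp hat_arg_sum; apply: eq_bigr => j _.
  by rewrite ip_hsp -(hat_form u) -ipC hat_cval_unit.
rewrite -hatB.
have -> : rank_one x y (cval p) - rank_one x (frank f y) (cval p) =
    rank_one x (y - frank f y) (cval p) by rewrite /rank_one kactBr.
rewrite (le_trans (nrm_hat_le _ _ _))// rnorm_uv mulr1.
rewrite (le_trans (rnorm_rank_one _ _ _))// -nrm_corner ler_wpM2r ?nrm_ge0//.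
rewrite (le_trans (ler_wpM2l (rnorm_ge0 _) h1))//.
by rewrite mulrA ler_pdivrMr// mulrC ler_pM2l// lerDl.
Qed.

Lemma opnormE_ge (D : E -> E) (K : R) z : linear D -> 0 <= K ->
  (forall x, rnorm (D x) <= K * rnorm x) ->
  rnorm (D z) <= opnorm (@rnorm R E) D * rnorm z.
Proof.
move=> lD K0 hK.
have ub : has_ubound [set rnorm (D x) | x in [set x | rnorm x <= 1]].
  exists K => _ [x /= hx <-]; rewrite (le_trans (hK x))//.
  by rewrite -[leRHS]mulr1 ler_wpM2l.
have [->|z0] := eqVneq z 0; first by rewrite (lin0 lD) !rnorm0 mulr0.
have nz : 0 < rnorm z.
  by rewrite lt0r rnorm_ge0 andbT; apply/eqP => /rnorm_eq0/eqP; rewrite (negPf z0).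
rewrite -ler_pdivrMr//; apply: ub_le_sup => //.
exists (((rnorm z)^-1)%:C *: z) => /=.
  by rewrite rnormZ cabsR ger0_norm ?invr_ge0 ?rnorm_ge0// mulVf ?gt_eqF.
by rewrite (linZ lD) rnormZ cabsR ger0_norm ?invr_ge0 ?rnorm_ge0// mulrC.
Qed.

Lemma module_compact_corner T (e : R) : module_compact T -> 0 < e ->
  exists2 f : X -> X, finrk f & forall p, nrm (hat (T (cval p)) u - f p) <= e * nrm p.
Proof.
move=> [aT hT] e0; have e2 : 0 < e / 2 by rewrite divr_gt0.
have [n [c [x [y hxy]]]] := hT _ e2.
pose S (z : E) : E := \sum_(i < n) c i *: rank_one (x i) (y i) z.
pose D (z : E) : E := T z - S z.
have lT := adjointable_linear aT; have [K K0 hK] := adjointable_bounded aT.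
have lS : linear S.
  move=> a z w; rewrite /S scaler_sumr -big_split; apply: eq_bigr => i _ /=.
  by rewrite rank_one_linear scalerDr !scalerA mulrC.
have lD : linear D.
  by move=> a z w; rewrite /D lT lS scalerBr opprD addrACA.
pose L := K + \sum_i cabs (c i) * (rnorm (x i) * rnorm (y i)).
have L0 : 0 <= L.
  by rewrite addr_ge0// sumr_ge0// => i _; rewrite !mulr_ge0 ?cabs_ge0 ?rnorm_ge0.
have hD z : rnorm (D z) <= L * rnorm z.
  rewrite /L mulrDl /D (le_trans (rnormD _ _))// rnormN lerD// /S mulr_suml.
  rewrite (le_trans (rnorm_sum _ _ _))// ler_sum// => i _.
  by rewrite rnormZ -!mulrA ler_wpM2l ?cabs_ge0// mulrA rnorm_rank_one.
pose C := 1 + \sum_i cabs (c i).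
have C0 : 0 < C by rewrite ltr_pwDl// sumr_ge0// => i _; exact: cabs_ge0.
have hg i : exists g : X -> X, finrk g /\
    forall p, nrm (hat (rank_one (x i) (y i) (cval p)) u - g p) <= e / 2 / C * nrm p.
  have [g fg hg] := rank_one_corner (x i) (y i) (divr_gt0 e2 C0).
  by exists g.
have [g hg'] := choice hg.
exists (fun p => \sum_i c i *: g i p).
  by apply: finrk_sum => i; apply: finrk_scale; case: (hg' i).
move=> p; rewrite (le_trans (nrmT (hat (S (cval p)) u) _ _))//.
rewrite {1}(splitr e) mulrDl lerD//.
  rewrite -hatB (le_trans (nrm_hat_le _ _ _))// rnorm_uv mulr1 nrm_corner.
  by rewrite (le_trans (opnormE_ge _ lD L0 hD))// ler_wpM2r ?rnorm_ge0// ltW.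
rewrite /S hat_sum -sumrB (le_trans (nrm_sum _ _ _))//.
apply: (@le_trans _ _ (\sum_i cabs (c i) * (e / 2 / C * nrm p))).
  apply: ler_sum => i _; rewrite hatZ -scalerBr nrmZ ler_wpM2l ?cabs_ge0//.
  by case: (hg' i).
rewrite -mulr_suml mulrA ler_wpM2r ?nrm_ge0// mulrA ler_pdivrMr// mulrC ler_pM2l//.
by rewrite lerDr.
Qed.

(** S - 1 and S' - 1 are within 1/2 of finite rank operators f and f' on the corner. On the kernel
    of f this makes S bounded below, which bounds the kernel of t and gives preimage bounds; on the
    kernel of f' it keeps vectors orthogonal to the range of t from being nonzero. *)
Theorem fredR_fredX t : fredR t -> fredX (res t).
Proof.
move=> [[kt ct dt dat rt] [[G aG [S [aS clS mS]]] [G' aG' [S' [aS' clS' mS']]]]].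
have cV := csub_res u kt ct; have [t0 tD tZ ta tf] := kt.
have [K K0 hK] := adjointable_bounded aG.
have [K' K'0 hK'] := adjointable_bounded aG'.
have h12 : 0 < (1 / 2 : R) by rewrite divr_gt0.
have SG x y : t (x, y) -> S x = G y.
  move=> txy; have : graph S (x, G y).
    by rewrite -clS; apply: subset_closure; exists y.
  by move=> /esym.
have tGS y : t (G' y, S' y).
  (* G' is continuous and t is closed, so points of the closure of the graph of t G' still give
     points of t. *)
  have : closure (graph_comp t (graph G')) (y, S' y) by rewrite clS'.
  move=> /closure_rnorm2 hcl'; have /closed_rnorm := ct; apply => e e0.
  have k0 : 0 < K' + 1 by rewrite ltr_wpDl.
  have m0 : 0 < Num.min e (e / (K' + 1)) by rewrite lt_min e0 divr_gt0.
  have [[y' z'] [w hw twz] [h1 h2]] := hcl' _ m0.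
  exists (w, z') => //=; split; last first.
    by apply: (lt_le_trans h2); rewrite ge_min lexx.
  have -> : w = G' y' by exact: hw.
  rewrite -(linB (adjointable_linear aG')) (le_lt_trans (hK' _))//.
  rewrite (@le_lt_trans _ _ ((K' + 1) * rnorm (y - y')))//.
    by rewrite ler_wpM2r ?rnorm_ge0// lerDl.
  rewrite mulrC -ltr_pdivlMr//; apply: (lt_le_trans h1).
  by rewrite ge_min lexx orbT.
have [f [bf [F [k [oF hF]]]] hf] := module_compact_corner mS h12.
have [f' [bf' [F' [k' [oF' hF']]]] hf'] := module_compact_corner mS' h12.
have hS (p : X) : hat (S (cval p) - cval p) u = hat (S (cval p)) u - p.
  by rewrite hatB hat_cval_unit.
have hS' (p : X) : hat (S' (cval p) - cval p) u = hat (S' (cval p)) u - p.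
  by rewrite hatB hat_cval_unit.
(* Where f x = 0, |x| <= |x| / 2 + |G y|, hence |x| <= 2 K |y|. *)
have low x y : res t (x, y) -> f x = 0 -> nrm x <= 2 * K * nrm y.
  move=> /SG /= e fx; have := hf x; rewrite fx subr0 hS e => h1.
  have h2 : nrm (hat (G (cval y)) u) <= K * nrm y.
    rewrite (le_trans (nrm_hat_le _ _ _))// rnorm_uv mulr1 nrm_corner; exact: hK.
  have h3 : nrm x <= nrm (hat (G (cval y)) u - x) + nrm (hat (G (cval y)) u).
    set z := hat _ u; rewrite -[in leLHS](subKr z x).
    by rewrite (le_trans (nrmDB _ _))// addrC.
  by lra.
have fn (x : X) : nrm x <= 1 / 2 * nrm x -> x = 0.
  by move=> h; apply: nrm_eq0; have := nrm_ge0 x; lra.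
split=> //.
- move=> y hy; apply: cval_inj; exact: (tf 0 _ _ hy t0).
- move=> x e e0; have /dense_rnorm hd := dt.
  have [x' [y' txy] hx] := hd (cval x) e e0.
  exists (hat x' u).
    by exists (hat y' u); exact: (hat_res u u kt txy).
  rewrite -{1}[x]hat_cval_unit -hatB (le_trans (nrm_hat_le _ _ _))//.
  by rewrite rnorm_uv mulr1 ltW.
- apply: (odim_inj (T := f) (csub_vker cV).1 oF bf.1) => // x Nx fx.
  apply: fn; have := hf x; rewrite fx subr0 hS (SG _ _ Nx) /= (lin0 (adjointable_linear aG)).
  by rewrite hat0 sub0r nrmN.
- apply: (odim_inj (T := f') (csub_vcok cV).1 oF' bf'.1) => // y My fy.
  have := hf' y; rewrite fy subr0 hS'; set z := hat (S' (cval y)) u => hz.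
  have rz : vran (res t) z.
    exists (hat (G' (cval y)) u); exact: (hat_res u u kt (tGS (cval y))).
  apply: fn; rewrite (le_trans _ hz)//.
  rewrite -(ler_pXn2r (n := 2)) ?nnegrE ?nrm_ge0//.
  rewrite addrC pyth ?nrmN ?lerDl ?sqr_ge0// ripNl My ?oppr0//.
- apply: (finite_codim_bound cV bf oF hF _ low).
  by rewrite mulr_ge0.
Qed.
End FromModule.

(** * From Fredholm relations on the corner to E *)

Section ToModule.
Context (R : realType) (H : hilbertType R) (E : hilbertKModType H) (u : unitv H).
Local Notation X := (corner E u).
Local Notation hat := (hat u).
Local Notation hat2 := (hat2 u).
Local Notation res := (@res R H E u).
Implicit Types (t : set (E * E)) (V : set (X * X)).

Lemma klinear_hatset V : csub V -> (forall y, V (0, y) -> y = 0) ->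
  klinear (hatset V).
Proof.
move=> [[V0 VD VZ] _] Vf; split.
- by move=> h; rewrite (lin0 (linear_hat2 u h)).
- by move=> p q hp hq h; rewrite (linD (linear_hat2 u h)); exact: VD.
- by move=> c p hp h; rewrite (linZ (linear_hat2 u h)); exact: VZ.
- by move=> a x y hp h; rewrite /hat2 /= !hat_act; exact: hp.
move=> x y z hy hz; apply: (hat_ext (u := u)) => h.
apply/eqP; rewrite -subr_eq0; apply/eqP/Vf.
have := VD _ _ (hy h) (VZ (-1) _ (hz h)); rewrite scaleN1r.
by congr V; apply/pair_equal_spec; rewrite /= subrr.
Qed.

(** A truncation of x has finitely many coordinates; each is replaced by a nearby element of D in
    the corner. Truncation and replacement cost e / 3 each. *)
Lemma dense_corner (D : set E) :
  D 0 -> (forall x y, D x -> D y -> D (x + y)) ->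
  (forall a x, D x -> D (kact a x)) ->
  (forall (p : X) (e : R), 0 < e -> exists2 q : X, D (cval q) & nrm (p - q) <= e) ->
  dense D.
Proof.
move=> D0 DD Da hD; apply/dense_rnorm => x e e0.
have e3 : 0 < e / 3 by rewrite divr_gt0.
have [n [f [of_ h1 _]]] := frank_approx u x x e3.
have d0 : 0 < e / 3 / n.+1%:R by rewrite divr_gt0.
have hq i : exists q : X, D (cval q) /\ nrm (hat x (f i) - q) <= e / 3 / n.+1%:R.
  by have [q h2 h3] := hD (hat x (f i)) _ d0; exists q.
have [q hq'] := choice hq.
exists (\sum_i kact (theta (f i) u) (cval (q i))).
  by apply: big_ind => // i _; apply: Da; case: (hq' i).
rewrite (le_lt_trans (rnormT (frank f x) _ _))//.
apply: (@le_lt_trans _ _ (e / 3 + e / 3)); last by lra.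
rewrite lerD// (frankE u) -sumrB (le_trans (rnorm_sum _ _ _))//.
apply: (@le_trans _ _ (\sum_(i < n) e / 3 / n.+1%:R)).
  apply: ler_sum => i _; rewrite -kactBr (le_trans (rnorm_theta_act _ _ _))//.
  have -> : rnorm (f i : H) = 1 by rewrite -nrm_hsp (onb_nrm i of_).
  by rewrite rnorm_uv !mul1r -cvalB -nrm_corner; case: (hq' i).
rewrite sumr_const card_ord -[leLHS]mulr_natr mulrAC ler_pdivrMr ?ltr0n//.
by rewrite ler_pM2l// ler_nat.
Qed.

Lemma adjoint_cval V (a b : X) : (forall p, V p -> ip p.2 a = ip p.1 b) ->
  adjoint (hatset V) (cval a, cval b).
Proof.
move=> hab x y hxy; apply: (kip_hat_ext (u := u)) => h k.
by rewrite /= !hat_cval !ipZr (hab _ (hxy h)).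
Qed.

Lemma adjoint0 t : adjoint t 0.
Proof. by move=> x y _; rewrite !kip0r. Qed.

Lemma adjointD t p q : adjoint t p -> adjoint t q -> adjoint t (p + q).
Proof. by move=> hp hq x y h; rewrite !kipDr (hp _ _ h) (hq _ _ h). Qed.

Lemma adjointZ t (c : R[i]) p : adjoint t p -> adjoint t (c *: p).
Proof. by move=> hp x y h; rewrite !kipZr (hp _ _ h). Qed.

Lemma adjoint_act t (a : kop H) p : adjoint t p -> adjoint t (kact a p.1, kact a p.2).
Proof. by move=> hp x y h; apply: kop_ext => z; rewrite !kipMr (hp _ _ h). Qed.

(** The Moore-Penrose inverse of the adjoint lies in the adjoint of the Moore-Penrose inverse: both
    sides equal <l p.2, q.2>. *)
Lemma mpg_adjoint (l : X -> X) p q : bdd l -> mpg l p -> mpg (adj l) q ->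
  ip p.2 q.1 = ip p.1 q.2.
Proof.
move=> bl [oy hx] [ob ha]; have bal := adj_bdd bl.
have cM := csub_ker bl; have cN := csub_ker bal.
rewrite adjK// in ha.
have h1 : ip p.2 (q.1 - adj l q.2) = 0 by apply: (orth_ip cM.1).
have h2 : ip (p.1 - l p.2) q.2 = 0.
  by rewrite ipC (orth_ip cN.1 ob hx) conjc0.
move: h1 h2; rewrite ipBr ipBl -(adj_ip p.2 q.2 bl) => /eqP; rewrite subr_eq0 => /eqP ->.
by move/eqP; rewrite subr_eq0 => /eqP ->.
Qed.

Lemma hatset_cval V (p : X * X) : subsp V -> V p -> hatset V (cval p.1, cval p.2).
Proof. by move=> [_ _ VZ] Vp h; rewrite hat2_cval; exact: VZ. Qed.

Lemma regular_hatset V : fredX V -> regular (hatset V).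
Proof.
move=> fV; have cV := fredX_csub fV; have kV := klinear_hatset cV (fredX_fun fV).
have [l bl [VE kl kal]] := fredX_mpg fV; have bal := adj_bdd bl.
have [t0 tD tZ ta tf] := kV.
have fV' : fredX (mpg (adj l)).
  by apply: mpg_fredX => //; rewrite ?adjK// ?kl ?kal; [exact: fredX_ker|exact: fredX_cok].
split=> //.
- exact: closed_hatset cV.
- apply: dense_corner.
  + by exists 0.
  + by move=> x y [x' hx] [y' hy]; exists (x' + y'); exact: (tD _ _ hx hy).
  + by move=> a x [x' hx]; exists (kact a x'); exact: ta.
  + move=> p e e0; have [q [q' hq] hpq] := fredX_dense fV p e0.
    by exists q => //; exists (cval q'); exact: (hatset_cval cV.1 hq).
- apply: dense_corner.
  + by exists 0; exact: adjoint0.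
  + by move=> x y [x' hx] [y' hy]; exists (x' + y'); exact: (adjointD hx hy).
  + by move=> a x [x' hx]; exists (kact a x'); exact: (adjoint_act a hx).
  + move=> p e e0; have [q [q' hq] hpq] := fredX_dense fV' p e0.
    exists q => //; exists (cval q'); apply: adjoint_cval => r.
    by rewrite VE => hr; exact: (mpg_adjoint bl hr hq).
- apply: dense_corner.
  + exists 0; last by rewrite addr0.
    by exists 0; [exact: t0|exact: adjoint0].
  + move=> _ _ [p [y h1 h2] <-] [p' [y' h1' h2'] <-].
    exists (p + p'); last by rewrite addrACA.
    by exists (y + y'); [exact: (tD _ _ h1 h1')|exact: (adjointD h2 h2')].
  + move=> a _ [p [y h1 h2] <-]; exists (kact a p.1, kact a p.2); last by rewrite /= kactDr.
    by exists (kact a y); [exact: ta|exact: (adjoint_act a h2)].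
  + move=> p e e0; exists p; last by rewrite subrr nrm0 ltW.
    (* Projecting (p, 0) onto the graph solves the equation for 1 plus the adjoint after t: the
       remainder (p - q.1, - q.2) is orthogonal to V, which says that (q.2, p - q.1) belongs to the
       adjoint. *)
    pose q := prj V (p, 0); have Vq := prj_in cV (p, 0).
    exists (cval q.1, cval (p - q.1)); last by rewrite /= addrC subrK.
    exists (cval q.2); first exact: (hatset_cval cV.1 Vq).
    apply: adjoint_cval => r Vr.
    have := orth_ip cV.1 (prj_orthP cV (p, 0)) Vr; rewrite -/q ip_pair /= sub0r ipNl => /eqP.
    rewrite subr_eq0 => /eqP h; rewrite [LHS]ipC [RHS]ipC; congr conjc.
    by rewrite h.
Qed.

Lemma graph_closed (S : E -> E) : adjointable S -> closure (graph S) `<=` graph S.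
Proof.
move=> aS p /closure_rnorm2 hp; have [K K0 hK] := adjointable_bounded aS.
rewrite /graph /=; apply/eqP; rewrite -subr_eq0; apply/eqP/rnorm_eq0/eqP.
rewrite eq_le rnorm_ge0 andbT; apply/ler_addgt0Pl => e e0; rewrite addr0.
have k0 : 0 < K + 1 by rewrite ltr_wpDl.
have [q hq [h1 h2]] := hp _ (divr_gt0 e0 k0).
have -> : e = e / (K + 1) + K * (e / (K + 1)) by field; rewrite gt_eqF.
rewrite (le_trans (rnormT q.2 _ _))// lerD ?(ltW h2)//.
rewrite (_ : q.2 = S q.1)// -(linB (adjointable_linear aS)) (le_trans (hK _))//.
by rewrite ler_wpM2l// rnormB ltW.
Qed.

(** S - 1 is exactly minus a sum of module rank one operators, so the approximation error is 0 for
    every e. *)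
Lemma module_compact_onp n (f : 'I_n -> X) (S : E -> E) : onb f -> adjointable S ->
  (forall x h, hat (S x) h = hat x h - onp f (hat x h)) ->
  module_compact (fun x => S x - x).
Proof.
move=> of_ aS hS.
have SE x : S x - x = \sum_(i < n) (-1) *: rank_one (cval (f i)) (cval (f i)) x.
  apply: (hat_ext (u := u)) => h; rewrite hatB hS addrC addKr hat_sum.
  rewrite /onp -sumrN; apply: eq_bigr => i _.
  rewrite hatZ scaleN1r; congr (- _).
  rewrite hat_act kadj_kip hat_cval; congr (_ *: _).
  by rewrite -kip_adj -(hat_form u) hat_cval_unit.
split.
  apply: (lift_adjointable (u := u) (l := fun p => (-1) *: onp f p)).
    by apply: bdd_scale; exact: bdd_onp.
  by move=> x h; rewrite hatB hS addrC addKr scaleN1r.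
move=> e e0; exists n, (fun=> -1), (fun i => cval (f i)), (fun i => cval (f i)).
rewrite (_ : (fun z => _) = fun=> 0); last by apply/funext => z; rewrite SE subrr.
apply: le_lt_trans e0; apply: sup_le_ub; last by move=> _ [x _ <-]; rewrite rnorm0.
by exists (rnorm (0 : E)), 0 => //=; rewrite rnorm0.
Qed.

(** The lift L of the Moore-Penrose inverse is a pseudo inverse on both sides. L after t is 1 minus
    the projection onto the kernel, on a dense domain only, whence the closure; t after L is
    everywhere 1 minus the projection onto the cokernel. *)
Lemma fredholm_hatset V : fredX V -> fredholm (hatset V).
Proof.
move=> fV; have cV := fredX_csub fV; have rV := regular_hatset fV.
have [l bl [VE kl kal]] := fredX_mpg fV; have bal := adj_bdd bl.
have cM := csub_ker bl; have cN := csub_ker bal.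
have [L hL] := lift1 bl; have aL := lift_adjointable bl hL.
have lift_onp k (f : 'I_k -> X) : exists2 S : E -> E, adjointable S &
    forall x h, hat (S x) h = hat x h - onp f (hat x h).
  have bT : bdd (fun p : X => p - onp f p).
    by apply: bdd_sub; [exact: bdd_id|exact: bdd_onp].
  by have [S hS] := lift1 bT; exists S => //; exact: lift_adjointable bT hS.
split.
- have [n [f of_ Nf]] := fredX_ker fV; have [S aS hS] := lift_onp n f.
  have pN : prj (hker (adj l)) = onp f by rewrite kal Nf; exact: prj_onp.
  exists L => //; exists S; split=> //; last exact: (module_compact_onp of_ aS hS).
  have key x z : hatset V (x, z) -> L z = S x.
    move=> hxz; apply: (hat_ext (u := u)) => h; rewrite hL hS -pN.
    have := hxz h; rewrite VE => -[/= oz Nx].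
    have oN : orth (hker (adj l)) (l (hat z h)).
      by move=> w hw; rewrite adjP// hw rip0r.
    have := prj_id cN Nx; rewrite (linB (prj_linear cN)) (prj_eq0 cN oN) subr0 => ->.
    by rewrite opprB addrC subrK.
  apply/seteqP; split.
    apply: subset_trans (graph_closed aS); apply: closure_subset.
    by move=> [x z] [y hxy zy]; exact: etrans zy (key _ _ hxy).
  move=> [x y]; rewrite {1}/graph /= => ->; apply/closure_rnorm2 => e e0.
  have [K K0 hK] := adjointable_bounded aS.
  have m0 : 0 < Num.min e (e / (K + 1)).
    by rewrite lt_min e0 divr_gt0// ltr_wpDl.
  have /dense_rnorm hd := regular_dense rV; have [x' [z hxz] hx] := hd x _ m0.
  exists (x', S x'); first by exists z => //; rewrite /graph /= (key _ _ hxz).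
  split=> /=; first by rewrite (lt_le_trans hx)// ge_min lexx.
  rewrite -(linB (adjointable_linear aS)) (le_lt_trans (hK _))//.
  rewrite (@le_lt_trans _ _ ((K + 1) * rnorm (x - x')))//.
    by rewrite ler_wpM2r ?rnorm_ge0// lerDl.
  rewrite mulrC -ltr_pdivlMr ?ltr_wpDl//.
  by rewrite (lt_le_trans hx)// ge_min lexx orbT.
have [n [f of_ Mf]] := fredX_cok fV; have [S aS hS] := lift_onp n f.
have pM : prj (hker l) = onp f by rewrite kl Mf; exact: prj_onp.
exists L => //; exists S; split=> //; last exact: (module_compact_onp of_ aS hS).
have -> : graph_comp (hatset V) (graph L) = graph S.
  apply/seteqP; split=> -[x z].
    move=> [y /= hy hyz]; rewrite /graph /=; apply: (hat_ext (u := u)) => h.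
    have := hyz h; rewrite VE /graph /= in hy *; rewrite hy /hat2 /= hL => -[/= oz Nx].
    rewrite hS -pM.
    have lxz : l (hat x h - hat z h) = 0.
      apply: rip_eq0; rewrite -(linB bl.1) in Nx.
      by rewrite {2}(linB bl.1) -(linB bl.1) adjP// Nx rip0r.
    have Mxz : hker l (hat x h - hat z h) by [].
    have := prj_id cM Mxz; rewrite (linB (prj_linear cM)) (prj_eq0 cM oz) subr0 => ->.
    by rewrite opprB addrC subrK.
  rewrite /graph /= => ->; exists (L x) => // h; rewrite VE; split=> /=.
    by rewrite hS -pM; exact: prj_orthP.
  rewrite hL hS -pM (linB bl.1) (prj_in cM _ : l _ = 0) subr0 subrr.
  exact: (lin0 bal.1).
apply/seteqP; split; [exact: graph_closed|exact: subset_closure].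
Qed.

Theorem fredX_fredR V : fredX V -> fredR (hatset V).
Proof. by move=> fV; split; [exact: regular_hatset|exact: fredholm_hatset]. Qed.

Lemma dimK_ker t n : klinear t -> odim (vker (res t)) n ->
  dimK (ker t) = n.
Proof.
move=> kt oN; have [t0 tD tZ ta tf] := kt.
apply: (dimK_corner (u := u)) => //; split.
- exact: t0.
- by move=> x y hx hy; have := tD _ _ hx hy; congr t; apply/pair_equal_spec; rewrite /= addr0.
- by move=> c x hx; have := tZ c _ hx; congr t; apply/pair_equal_spec; rewrite /= scaler0.
- by move=> a x hx; have := ta a _ _ hx; rewrite kact0r.
Qed.

Lemma dimK_coker t m : klinear t -> odim (vcok (res t)) m ->
  dimK (ker (adjoint t)) = m.
Proof.
move=> kt oM; have [t0 tD tZ ta tf] := kt.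
have sR : subsp (vran (res t)).
  split; first by exists 0; exact: t0.
    by move=> x y [x' hx] [y' hy]; exists (x' + y'); exact: (tD _ _ hx hy).
  by move=> c x [x' hx]; exists (c *: x'); exact: (tZ c _ hx).
apply: (dimK_corner (u := u)).
- split.
  + exact: adjoint0.
  + by move=> x y hx hy; have := adjointD hx hy; congr adjoint; apply/pair_equal_spec; rewrite /= addr0.
  + move=> c x hx; have := adjointZ c hx; congr adjoint; apply/pair_equal_spec; rewrite /= scaler0//.
  + by move=> a x hx; have := adjoint_act a hx; rewrite /= kact0r.
suff -> : [set p : X | ker (adjoint t) (cval p)] = vcok (res t) by [].
apply/seteqP; split=> p /=.
  move=> hp y [x hxy]; rewrite ripC /rip ip_corner (hp _ _ hxy).
  by rewrite kip0r kop0_E hdot0l.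
move=> hp x y hxy; apply: (kip_hat_ext (u := u)) => h k.
rewrite /= hat_cval ipZr hat0 ip0r.
by rewrite ipC (orth_ip sR hp) ?conjc0 ?mulr0//; exists (hat x h); exact: (hat_res u h kt hxy).
Qed.
End ToModule.

(** * Homotopies *)

Section UnitInterval.
Context (R : realType).

Lemma cvg_within01 (f : R -> R) (u : R) :
  (f v @[v --> within `[0, 1]%classic (nbhs u)] --> (0 : R)) <->
  (forall e, 0 < e -> exists2 d, 0 < d &
     forall v, 0 <= v <= 1 -> `|v - u| < d -> `|f v| < e).
Proof.
split=> [/cvgrPdist_lt hf e e0|hf].
  have := hf e e0; rewrite near_withinE => /nbhs_ballP[d /= d0 hd].
  exists d => // v hv vu; have := hd v; rewrite sub0r normrN; apply.
    by rewrite -ball_normE /= distrC.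
  by rewrite /= in_itv.
apply/cvgrPdist_lt => e e0; have [d d0 hd] := hf e e0.
rewrite near_withinE; apply/nbhs_ballP; exists d => // v.
rewrite -ball_normE /= distrC => vu; rewrite in_itv /= => hv.
by rewrite sub0r normrN; exact: hd.
Qed.

(** Connectedness of the interval by a supremum argument: the set of a such that f is constant on
    [0, a] contains its supremum, which cannot be less than 1. *)
Lemma locally_constant01 (T : Type) (f : R -> T) :
  (forall u, 0 <= u <= 1 -> exists2 d, 0 < d &
     forall v, 0 <= v <= 1 -> `|v - u| < d -> f v = f u) -> f 0 = f 1.
Proof.
move=> hf; pose S := [set a | 0 <= a <= 1 /\ forall b, 0 <= b <= a -> f b = f 0].
have S0 : S 0.
  split; first by rewrite lexx ler01.
  by move=> b hb; congr f; apply/eqP; rewrite eq_le andbC.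
have hS : has_sup S by split; [exists 0|exists 1 => a [/andP[]]].
have s0 : 0 <= sup S by apply: ub_le_sup S0; exact: hS.2.
have s1 : sup S <= 1 by apply: sup_le_ub; [exists 0|move=> a [/andP[]]].
have [d d0 hd] := hf (sup S) (introT andP (conj s0 s1)).
have [a [/andP[a0 a1] ha] sa] := sup_adherent d0 hS.
have as_ : a <= sup S by apply: ub_le_sup; [exact: hS.2|split=> //; rewrite a0].
have fs : f (sup S) = f 0.
  rewrite -(hd a) ?a0//; last by rewrite ler0_norm; lra.
  by apply: ha; rewrite a0 lexx.
have key c : 0 <= c <= 1 -> c < sup S + d -> f c = f 0.
  move=> hc cd; have [ca|ac] := leP c a; first by apply: ha; lra.
  by rewrite hd// ltr_norml; lra.
have [s1'|s1'] := ltP (sup S) 1; last by rewrite key//; lra.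
have : Num.min 1 (sup S + d / 2) <= sup S.
  apply: ub_le_sup; first exact: hS.2.
  split; first by rewrite le_min ler01 ge_min lexx/= andbT; lra.
  by move=> b; rewrite le_min => /and3P[b0 b1 bs]; apply: key; lra.
by rewrite ge_min => /orP[] ?; exfalso; lra.
Qed.
End UnitInterval.

(** * Index and homotopy for operators on E *)

Section Index.
Context (R : realType) (H : hilbertType R) (E : hilbertKModType H).
Implicit Types (t s : set (E * E)).

Lemma fredR_klinear t : fredR t -> klinear t. Proof. by case=> -[]. Qed.
Lemma fredR_closed t : fredR t -> closed t. Proof. by case=> -[]. Qed.

Section Corner.
Context (u : unitv H).
Local Notation res := (@res R H E u).

Lemma fredR_hatset t : fredR t -> hatset (res t) = t.
Proof. by move=> ft; apply: hatset_res; [exact: fredR_klinear|exact: fredR_closed]. Qed.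

Lemma fredR_index t : fredR t -> exists n m,
  [/\ odim (vker (res t)) n, odim (vcok (res t)) m & ind t = n%:Z - m%:Z].
Proof.
move=> ft; have fX := fredR_fredX u ft; have kt := fredR_klinear ft.
have [n oN] := fredX_ker fX; have [m oM] := fredX_cok fX.
by exists n, m; split=> //; rewrite /ind (dimK_ker kt oN) (dimK_coker kt oM).
Qed.

Lemma homotopic_same_ind t s : gap_homotopic t s -> ind t = ind s.
Proof.
move=> [g [<- <- gf gc]].
have fg v : 0 <= v <= 1 -> fredR (g v) by move=> hv; apply: gf; rewrite /= in_itv.
apply: (locally_constant01 (f := fun v => ind (g v))) => v hv.
have [n [m [oN oM ->]]] := fredR_index (fg v hv).
have fX := fredR_fredX u (fg v hv).
have [e e0 he] := index_locally_constant fX oN oM.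
have hv' : `[0, 1]%classic v by rewrite /= in_itv.
have /cvg_within01/(_ _ e0)[d d0 hd] := gc v hv'.
exists d => // w hw wv.
have fX' := fredR_fredX u (fg w hw).
have [n' [m' [oN' oM' ->]]] := fredR_index (fg w hw).
have ge : pgap (res (g v)) (res (g w)) e.
  apply: pgap_sym => z.
  rewrite (le_trans (pgap_gap (fredX_csub fX') (fredX_csub fX) z))//.
  rewrite (fredR_hatset (fg v hv)) (fredR_hatset (fg w hw)).
  by rewrite ler_wpM2r ?nrm_ge0// (le_trans (ler_norm _))// ltW// hd.
have := he _ _ _ fX' ge oN' oM'; lia.
Qed.

Lemma same_ind_homotopic t s : fredR t -> fredR s -> ind t = ind s ->
  gap_homotopic t s.
Proof.
move=> ft fs.
have [n [m [oN oM ->]]] := fredR_index ft.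
have [n' [m' [oN' oM' ->]]] := fredR_index fs => e.
have enm : (n + m' = n' + m)%N by lia.
have [g [C [g0 g1 gf gC]]] := same_index_hconn (fredR_fredX u ft) (fredR_fredX u fs) oN oM oN' oM' enm.
exists (fun v => hatset (g v)); split.
- by rewrite g0 fredR_hatset.
- by rewrite g1 fredR_hatset.
- by move=> v; rewrite /= in_itv => hv; apply: fredX_fredR; exact: gf.
move=> v; rewrite /= in_itv /= => hv; apply/cvg_within01 => d d0.
have C1 : 0 < `|C| + 1 by rewrite ltr_wpDl.
exists (d / (`|C| + 1)); first by rewrite divr_gt0.
move=> w hw wv; rewrite ger0_norm ?gap_ge0//.
have [cw cv] := (fredX_csub (gf w hw), fredX_csub (gf v hv)).
have hp : pgap (g w) (g v) (`|C| * `|w - v|).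
  move=> z; rewrite (le_trans (gC w v hw hv z))// ler_wpM2r ?nrm_ge0//.
  by rewrite ler_wpM2r// ler_norm.
rewrite (le_lt_trans (gap_le cw cv _ hp)) ?mulr_ge0//.
rewrite (@le_lt_trans _ _ ((`|C| + 1) * `|w - v|))//.
  by rewrite ler_wpM2r// lerDl.
by rewrite mulrC -ltr_pdivlMr.
Qed.
End Corner.

(** A unit vector is needed to form a corner. *)
Lemma zero_or_unit : (forall h : H, h = 0) \/ exists g : H, hdot g g = 1.
Proof.
have [[h h0]|hn] := pselect (exists h : H, h != 0); last first.
  by left=> h; apply/eqP; apply: contrapT => /negP h0; apply: hn; exists h.
right; exists (((rnorm h)^-1)%:C *: h); rewrite -hdot_norm rnormE rnormZ cabsR.
have nh : rnorm h != 0 by apply: contra_neq h0 => /rnorm_eq0.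
by rewrite ger0_norm ?invr_ge0 ?rnorm_ge0// mulVf// rmorph1 expr1n.
Qed.

(** Over H = 0 all inner products vanish, so E = 0 and E + E has a single nonempty subset. *)
Lemma fredR_trivial t s : (forall h : H, h = 0) -> fredR t -> fredR s -> t = s.
Proof.
move=> H0 ft fs; have E0 (x : E) : x = 0.
  by apply: kip_eq0; apply: kop_ext => h; rewrite [LHS]H0 [RHS]H0.
have tT r : fredR r -> r = [set: E * E].
  move=> /fredR_klinear[r0 _ _ _ _]; apply/seteqP; split=> // -[x y] _.
  by rewrite (E0 x) (E0 y).
by rewrite (tT t)// (tT s).
Qed.

Lemma gap_homotopic_refl t : fredR t -> gap_homotopic t t.
Proof.
move=> ft; exists (fun=> t); split=> // v _; apply/cvg_within01 => e e0.
exists 1 => // w _ _; rewrite (_ : gap t t = 0) ?normr0//.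
have n0 : norm2 (0 : E * E) = 0.
  rewrite /norm2 (_ : kip2 0 0 = 0); last by rewrite /kip2 !kip0r addr0.
  rewrite (_ : opnorm _ _ = 0) ?sqrtr0//; apply/eqP; rewrite eq_le opnorm_ge0 andbT.
  by apply: opnorm_le => // h k; rewrite kop0_E hdot0l -[0%R]/(0%:C) cabsR normr0 !mul0r.
rewrite /gap /opnorm (_ : [set _ | _ in _] = [set 0]) ?sup1//.
apply/seteqP; split=> [_ [p _ <-]|_ ->]; first by rewrite subrr.
by exists 0 => /=; rewrite ?n0 ?subrr ?n0.
Qed.
End Index.

Theorem corollary4p2 (R : realType) (H : hilbertType R) (E : hilbertKModType H)
    (t s : set (E * E)) (ht : fredR t) (hs : fredR s) :
  ind t = ind s <-> gap_homotopic t s.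
Proof.
have [H0|[g g1]] := zero_or_unit H.
  by rewrite (fredR_trivial H0 ht hs); split=> // _; exact: gap_homotopic_refl.
split; first exact: (same_ind_homotopic (Unitv g1)).
exact: (homotopic_same_ind (Unitv g1)).
Qed.
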